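(* (1) \textsc{Collision} polynomial-time reduces to \textsc{Bad $2$-Coloring} (so \textsc{Bad $2$-Coloring} is PPP-hard). (2) For every $k\ge 2$, \textsc{Bad $k$-Coloring} polynomial-time reduces to \textsc{$k$-Tur\'an}; in particular \textsc{Bad $2$-Coloring} reduces to \textsc{Mantel}. (3) For every $k\ge 2$, \textsc{Bad $k$-Coloring} polynomial-time reduces to \textsc{Bad $(k+1)$-Coloring}. (4) For every $k\ge 2$, \textsc{$k$-Tur\'an} polynomial-time reduces to \textsc{$(k+1)$-Tur\'an}.
   Context: All circuits are Boolean circuits of size polynomial in $n$; $k$ is a fixed constant. A search problem $A$ polynomial-time reduces to a search problem $B$ if there are polynomial-time computable maps $f,g$ such that for every instance $I$ of $A$, $f(I)$ is an instance of $B$, and for every solution $s$ of $f(I)$, $g(I,s)$ is a solution of $I$. \textsc{Collision}: given a poly($n$)-size circuit $C:\{0,1\}^n\to\{0,1\}^n$ (identified with $[0,2^n-1]\to[0,2^n-1]$), find either $x$ with $C(x)=0$, or $x\neq y$ with $C(x)=C(y)$. PPP is the class of search problems reducible to \textsc{Collision}. \textsc{Bad $k$-Coloring}: the vertex set is $V=[0,k2^n-1]$. The input is a poly($n$)-size circuit $E:[0,\binom{k}{2}2^{2n}]\to V^2$ (listing $\binom{k}{2}2^{2n}+1$ purported edges of a graph on $V$) and a poly($n$)-size circuit $C:V\to\{1,\dots,k\}$ (a coloring of the vertices). A solution is either two distinct indices $i\neq j$ such that $E(i)$ and $E(j)$ are the same unordered pair, or an index $i$ with $E(i)=(u,v)$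 and $C(u)=C(v)$ (this includes the case $u=v$). \textsc{$k$-Tur\'an}: the vertex set is $V=[0,k2^n-1]$ and the input is a poly($n$)-size circuit $E:[0,\binom{k}{2}2^{2n}]\to V^2$. A solution is either an error in $E$ — an index $i$ with $E(i)=(u,u)$, or two distinct indices $i\neq j$ with $E(i),E(j)$ the same unordered pair — or a set of $\binom{k+1}{2}$ indices whose edges $E(\cdot)$ form a clique on $k+1$ vertices. \textsc{Mantel} is \textsc{$2$-Tur\'an}. *)

(* Defs.v *)
From mathcomp Require Import all_boot.
Set Implicit Arguments. Unset Strict Implicit. Unset Printing Implicit Defensive.

Inductive code := CLeaf of seq bool | CNode of seq code.

(* symbols are bit pairs: 00 = bit 0, 01 = bit 1, 10 = open, 11 = close;
   leaf = open 01 <bits> close, node = open 00 <children> close. *)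
Fixpoint enc_code (c : code) : seq bool :=
  match c with
  | CLeaf bs => [:: true; false; false; true]
                  ++ flatten [seq [:: false; b] | b <- bs] ++ [:: true; true]
  | CNode cs => [:: true; false; false; false]
                  ++ (fix encs (l : seq code) : seq bool :=
                        match l with [::] => [::] | c :: l => enc_code c ++ encs l end) cs
                  ++ [:: true; true]
  end.

Fixpoint bin_aux (fuel n : nat) : seq bool :=
  match fuel with
  | 0 => [::]
  | f.+1 => if n == 0 then [::] else odd n :: bin_aux f n./2
  end.
Definition bin (n : nat) : seq bool := bin_aux n n.

Definition code_nat (n : nat) : code := CLeaf (bin n).
Definition code_unary (n : nat) : code := CLeaf (nseq n true).

(* wires 0..cin-1 are the inputs, wire cin+j is the output of gate j;
   gates may only usefully refer to earlier wires (others read as false). *)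
Inductive gate := GConst of bool | GNot of nat | GAnd of nat & nat | GOr of nat & nat.

Record circuit := Circuit { cin : nat; cgates : seq gate; couts : seq nat }.

Definition eval_gate (vs : seq bool) (g : gate) : bool :=
  match g with
  | GConst b => b
  | GNot i => ~~ nth false vs i
  | GAnd i j => nth false vs i && nth false vs j
  | GOr i j => nth false vs i || nth false vs j
  end.

Definition circ_eval (C : circuit) (inp : seq bool) : seq bool :=
  let vs := foldl (fun vs g => rcons vs (eval_gate vs g)) inp (cgates C) in
  map (nth false vs) (couts C).

Definition code_gate (g : gate) : code :=
  match g with
  | GConst b => CNode [:: code_nat 0; CLeaf [:: b]]
  | GNot i => CNode [:: code_nat 1; code_nat i]
  | GAnd i j => CNode [:: code_nat 2; code_nat i; code_nat j]
  | GOr i j => CNode [:: code_nat 3; code_nat i; code_nat j]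
  end.

(* the number of inputs is written in unary, so an encoded circuit with
   n inputs has length at least n *)
Definition code_circuit (C : circuit) : code :=
  CNode [:: code_unary (cin C); CNode (map code_gate (cgates C));
            CNode (map code_nat (couts C))].

Definition bits_of (w x : nat) : seq bool := [seq odd (x %/ 2 ^ i) | i <- iota 0 w].
Definition nat_of_bits (bs : seq bool) : nat := foldr (fun (b : bool) (acc : nat) => nat_of_bool b + acc.*2) 0 bs.

(* number of bits needed to write every integer in [0, m]: least a with m < 2^a *)
Definition width (m : nat) : nat := up_log 2 m.+1.

Definition circ_apply (C : circuit) (x : nat) : nat :=
  nat_of_bits (circ_eval C (bits_of (cin C) x)).

Inductive move := MoveL | MoveR | Stay.

(* single tape, alphabet {0,1,blank} (blank = None), states 'I_(Q+2);
   state 0 is the start state, state 1 the halting state *)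
Record TM := MkTM {
  tm_Q : nat;
  tm_delta : 'I_tm_Q.+2 -> option bool -> 'I_tm_Q.+2 * option bool * move }.

Record config (M : TM) := Config {
  cst : 'I_(tm_Q M).+2;
  cleft : seq (option bool);   (* cells left of the head, nearest first *)
  ccur : option bool;
  cright : seq (option bool) (* cells right of the head, nearest first *) }.

Definition halted (M : TM) (c : config M) : bool := val (cst c) == 1.

Definition tm_step (M : TM) (c : config M) : config M :=
  if halted c then c else
  match tm_delta (cst c) (ccur c) with
  | (q', w, MoveL) =>
      match cleft c with
      | [::] => Config q' [::] None (w :: cright c)
      | a :: l => Config q' l a (w :: cright c)
      end
  | (q', w, MoveR) =>
      match cright c with
      | [::] => Config q' (w :: cleft c) None [::]
      | a :: r => Config q' (w :: cleft c) a r
      end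
  | (q', w, Stay) => Config q' (cleft c) w (cright c)
  end.

Definition tm_init (M : TM) (x : seq bool) : config M :=
  match x with
  | [::] => Config ord0 [::] None [::]
  | b :: r => Config ord0 [::] (Some b) (map Some r)
  end.

Definition tm_run (M : TM) (t : nat) (x : seq bool) : config M :=
  iter t (@tm_step M) (tm_init M x).

Fixpoint read_word (l : seq (option bool)) : seq bool :=
  match l with
  | Some b :: l' => b :: read_word l'
  | _ => [::]
  end.
Definition tm_output (M : TM) (c : config M) : seq bool := read_word (ccur c :: cright c).

Definition tm_computes_within (M : TM) (x y : seq bool) (T : nat) : Prop :=
  exists t, t <= T /\ halted (tm_run M t x) /\ tm_output (tm_run M t x) = y.

Definition polybound (c m : nat) : nat := m ^ c + c.

Record search_problem := SearchProblem {
  sp_inst : Type;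
  sp_valid : sp_inst -> Prop;
  sp_code : sp_inst -> code;
  sp_sol : Type;
  sp_sol_code : sp_sol -> code;
  sp_is_sol : sp_inst -> sp_sol -> Prop }.

Definition poly_reduces (A B : search_problem) : Prop :=
  exists (f : sp_inst A -> sp_inst B) (g : sp_inst A -> sp_sol B -> sp_sol A)
         (Mf Mg : TM) (c : nat),
  forall I : sp_inst A, sp_valid I ->
    let x := enc_code (sp_code I) in
    [/\ sp_valid (f I),
        tm_computes_within Mf x (enc_code (sp_code (f I))) (polybound c (size x))
      & forall s : sp_sol B, sp_is_sol (f I) s ->
          let xs := enc_code (CNode [:: sp_code I; sp_sol_code s]) in
          sp_is_sol I (g I s) /\
          tm_computes_within Mg xs (enc_code (sp_sol_code (g I s)))
                             (polybound c (size xs))].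

Inductive col_sol := ColZero of nat | ColPair of nat & nat.

Definition col_valid (C : circuit) : Prop := size (couts C) = cin C.

Definition col_is_sol (C : circuit) (s : col_sol) : Prop :=
  match s with
  | ColZero x => x < 2 ^ cin C /\ circ_apply C x = 0
  | ColPair x y => [/\ x < 2 ^ cin C, y < 2 ^ cin C, x <> y
                     & circ_apply C x = circ_apply C y]
  end.

Definition code_col_sol (s : col_sol) : code :=
  match s with
  | ColZero x => CNode [:: code_nat 0; code_nat x]
  | ColPair x y => CNode [:: code_nat 1; code_nat x; code_nat y]
  end.

Definition Collision : search_problem :=
  SearchProblem col_valid code_circuit code_col_sol col_is_sol.

Definition nverts (k n : nat) : nat := k * 2 ^ n.
Definition max_edge_index (k n : nat) : nat := 'C(k, 2) * 2 ^ (2 * n).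
Definition vwidth (k n : nat) : nat := width (nverts k n).-1.

(* E : [0, max_edge_index] -> V^2; the input is written on width(max_edge_index)
   bits, the output on 2*vwidth bits (first endpoint, then second endpoint);
   an output value is read modulo |V| (so every output denotes a vertex). *)
Definition edge_valid (k n : nat) (E : circuit) : Prop :=
  cin E = width (max_edge_index k n) /\ size (couts E) = (vwidth k n).*2.

Definition edge_of (k n : nat) (E : circuit) (i : nat) : nat * nat :=
  let out := circ_eval E (bits_of (cin E) i) in
  (nat_of_bits (take (vwidth k n) out) %% nverts k n,
   nat_of_bits (drop (vwidth k n) out) %% nverts k n).

Definition same_pair (e f : nat * nat) : bool :=
  ((e.1 == f.1) && (e.2 == f.2)) || ((e.1 == f.2) && (e.2 == f.1)).

Record bc_inst := BCInst { bc_n : nat; bc_E : circuit; bc_C : circuit }.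

(* C : V -> {1..k}: input on vwidth bits, colour = output value modulo k *)
Definition bc_valid (k : nat) (I : bc_inst) : Prop :=
  edge_valid k (bc_n I) (bc_E I) /\ cin (bc_C I) = vwidth k (bc_n I).

Definition color_of (k : nat) (I : bc_inst) (v : nat) : nat :=
  (circ_apply (bc_C I) v %% k).+1.

Inductive bc_sol := BCDup of nat & nat | BCMono of nat.

Definition bc_is_sol (k : nat) (I : bc_inst) (s : bc_sol) : Prop :=
  let n := bc_n I in let N := max_edge_index k n in
  let e := edge_of k n (bc_E I) in
  match s with
  | BCDup i j => [/\ i <= N, j <= N, i <> j & same_pair (e i) (e j)]
  | BCMono i => i <= N /\ color_of k I (e i).1 = color_of k I (e i).2
  end.

Definition code_bc_inst (I : bc_inst) : code :=
  CNode [:: code_unary (bc_n I); code_circuit (bc_E I); code_circuit (bc_C I)].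

Definition code_bc_sol (s : bc_sol) : code :=
  match s with
  | BCDup i j => CNode [:: code_nat 0; code_nat i; code_nat j]
  | BCMono i => CNode [:: code_nat 1; code_nat i]
  end.

Definition BadColoring (k : nat) : search_problem :=
  SearchProblem (bc_valid k) code_bc_inst code_bc_sol (bc_is_sol k).

Record tu_inst := TUInst { tu_n : nat; tu_E : circuit }.

Definition tu_valid (k : nat) (I : tu_inst) : Prop := edge_valid k (tu_n I) (tu_E I).

Inductive tu_sol := TULoop of nat | TUDup of nat & nat | TUClique of seq nat.

Definition tu_is_sol (k : nat) (I : tu_inst) (s : tu_sol) : Prop :=
  let n := tu_n I in let N := max_edge_index k n in
  let e := edge_of k n (tu_E I) in
  match s with
  | TULoop i => i <= N /\ (e i).1 = (e i).2
  | TUDup i j => [/\ i <= N, j <= N, i <> j & same_pair (e i) (e j)]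
  | TUClique Ix =>
      [/\ uniq Ix, size Ix = 'C(k.+1, 2), all (fun i => i <= N) Ix &
          exists W : seq nat, [/\ uniq W, size W = k.+1,
            all (fun i => ((e i).1 \in W) && ((e i).2 \in W)) Ix &
            forall u v, u \in W -> v \in W -> u <> v ->
              exists2 i, i \in Ix & same_pair (e i) (u, v)]]
  end.

Definition code_tu_inst (I : tu_inst) : code :=
  CNode [:: code_unary (tu_n I); code_circuit (tu_E I)].

Definition code_tu_sol (s : tu_sol) : code :=
  match s with
  | TULoop i => CNode [:: code_nat 0; code_nat i]
  | TUDup i j => CNode [:: code_nat 1; code_nat i; code_nat j]
  | TUClique Ix => CNode [:: code_nat 2; CNode (map code_nat Ix)]
  end.

Definition Turan (k : nat) : search_problem :=
  SearchProblem (tu_valid k) code_tu_inst code_tu_sol (tu_is_sol k).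

Definition Mantel : search_problem := Turan 2.

(* Main.v *)
Require Import Defs.
From mathcomp Require Import all_boot zify.
From Stdlib Require Import Classical IndefiniteDescription.
Set Implicit Arguments. Unset Strict Implicit. Unset Printing Implicit Defensive.

(** What shapes the circuits is that endpoints are read modulo [k * 2 ^ n] and colours modulo [k],
    where [k] need not be a power of two. With a vertex written [x + 2 ^ n * y], [x < 2 ^ n],
    reduction modulo [k * 2 ^ n] touches only [y], which has a constant number of bits. An index
    splits likewise into two words of [n] bits and a high part of constant width, so that all
    arithmetic with binomial coefficients happens in tables. The output of the colour circuit has
    unbounded width instead, and is reduced modulo [k] by Horner's rule, one table per bit. When [k]
    grows, old values must be reduced modulo their old modulus before the new, larger modulus is
    applied to them.

    What shapes the cost analysis is that a fold may double its state at every step. Each fold thus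
    comes with a proof that its intermediate states stay of polynomial size, usually because a step
    adds an amount that does not depend on the state. *)

(** A small functional language on codes, whose only iteration is a bounded
    fold, is compiled to one-tape machines in time polynomial in a cost that
    bounds the work and all intermediate sizes; so each reduction is a pair of
    programs of polynomial cost. All circuits depending on [k] only are tables
    wired into the instance by these programs.

    (1) Colour [2^n] left and [2^n] right vertices by their side, and join
    [C x] on the left to [C y] on the right for all [x], [y]; the last of the
    [4^n + 1] edges joins the two zeros. No edge is monochromatic, and two
    equal edges give a collision of [C], or a zero of [C] if one is the last.
    (2) Forget the colouring: a clique on [k + 1] vertices has a monochromatic
    edge.
    (3), (4) Add [2^n] new vertices joined to all the old ones. As
    [(k+1 choose 2) = (k choose 2) + k], the number of edges is exactly the one
    required. Repeated edges and loops are old. For colourings, the new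
    vertices get a colour of their own, so a monochromatic edge is old. A
    clique has at most one new vertex, as new vertices are pairwise not joined;
    removing it (or any vertex if there is none) leaves an old clique. *)

(** * A structured tape language and its compilation to Turing machines *)

Notation sym := (option bool).
Definition tape := (seq sym * seq sym)%type.
Definition cur (t : tape) : sym := head None t.2.
Definition act (w : sym) (m : move) (t : tape) : tape :=
  match m with
  | MoveL => (behead t.1, head None t.1 :: w :: behead t.2)
  | MoveR => (w :: t.1, behead t.2)
  | Stay => (t.1, w :: behead t.2)
  end.

Arguments act : simpl never.

(** The blank has a double role: it separates words on the tape, and it is the only exit test of
    [Loop]. Every other test is turned into one of these by moving the head onto or off a blank. *)
Inductive prog :=
| Write of sym
| Move of move
| Seq of prog & prog
| Case of prog & prog & prog
| Loop of prog.

Definition branch (p q r : prog) (s : sym) : prog :=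
  match s with None => p | Some false => q | Some true => r end.

(** The counts are exact numbers of machine steps: a [Case] pays a jump in and a jump out, each
    round of a [Loop] pays its test and the jump back, and leaving the loop costs the last test. *)
Inductive exec : prog -> tape -> nat -> tape -> Prop :=
| ExWrite s t : exec (Write s) t 1 (act s Stay t)
| ExMove m t : exec (Move m) t 1 (act (cur t) m t)
| ExSeq p q t1 t2 t3 n1 n2 :
    exec p t1 n1 t2 -> exec q t2 n2 t3 -> exec (Seq p q) t1 (n1 + n2) t3
| ExCase p q r t n t' :
    exec (branch p q r (cur t)) t n t' -> exec (Case p q r) t n.+2 t'
| ExLoop0 p t : cur t = None -> exec (Loop p) t 1 t
| ExLoopS p t1 t2 t3 n1 n2 : cur t1 <> None ->
    exec p t1 n1 t2 -> exec (Loop p) t2 n2 t3 ->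
    exec (Loop p) t1 (n1 + n2).+2 t3.

Fixpoint psize (p : prog) : nat :=
  match p with
  | Write _ | Move _ => 1
  | Seq p q => psize p + psize q
  | Case p q r => (psize p + psize q + psize r).+4
  | Loop p => (psize p).+2
  end.

Definition row := sym -> nat * sym * move.
Definition jump (q : nat) : row := fun x => (q, x, Stay).

(** The block of states from [o] to [o + psize p - 1] is entered at [o] and left by falling through
    to [o + psize p], so sequencing is concatenation. In a [Case] each branch is followed by a jump
    to the common exit. *)
Fixpoint rows (o : nat) (p : prog) : seq row :=
  match p with
  | Write s => [:: fun _ => (o.+1, s, Stay)]
  | Move m => [:: fun x => (o.+1, x, m)]
  | Seq p q => rows o p ++ rows (o + psize p) q
  | Case p q r =>
      let op := o.+1 in
      let oq := op + (psize p).+1 in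
      let or := oq + (psize q).+1 in
      let e := or + (psize r).+1 in
      (fun x => (match x with None => op | Some false => oq | Some true => or end,
                 x, Stay))
        :: rows op p ++ jump e :: rows oq q ++ jump e :: rows or r ++ [:: jump e]
  | Loop p =>
      (fun x => (if x is None then o + (psize p).+2 else o.+1, x, Stay))
        :: rows o.+1 p ++ [:: jump o]
  end.

Lemma size_rows o p : size (rows o p) = psize p.
Proof.
elim: p o => //= [p IHp q IHq|p IHp q IHq r IHr|p IHp] o.
- by rewrite size_cat IHp IHq.
- by rewrite !(size_cat, size_rcons, IHp, IHq, IHr) /= !(size_cat, size_rcons, IHp, IHq, IHr) /= !(size_cat, size_rcons, IHp, IHq, IHr) /=; lia.
- by rewrite size_cat IHp /= addn1.
Qed.

(** A machine has [tm_Q.+2] states, whence the [- 2]: state [q] is then row [q]. *)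
Definition tm_of_rows (R : seq row) : TM :=
  @MkTM (size R - 2) (fun q x =>
    let: (q', w, m) := nth (jump 1) R q x in (inord q', w, m)).

(** A configuration always has a scanned cell, whereas the right part of a [tape] may be empty; both
    [[::]] and [[:: None]] give the same configuration. *)
Definition conf (M : TM) (q : nat) (t : tape) : config M :=
  Config (inord q) t.1 (head None t.2) (behead t.2).
Arguments conf : clear implicits.

Section Simulation.
Variable R : seq row.
Let M := tm_of_rows R.

Lemma step_conf q t q' w m :
  q < size R -> q != 1 -> nth (jump 1) R q (cur t) = (q', w, m) ->
  tm_step (conf M q t) = conf M q' (act w m t).
Proof.
move=> ltq nq1 Hrow.
have vq : val (inord q : 'I_(tm_Q M).+2) = q by rewrite /= inordK //=; lia.
rewrite /tm_step /halted {1}/conf [cst _]/= vq (negbTE nq1).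
rewrite [tm_delta _ _]/= vq -/(cur t) Hrow.
by case: m Hrow => _; case: t => [[|a l] [|b [|c r]]].
Qed.

(** Induction on the execution, for code placed anywhere in the table. The condition [1 < size pre]
    keeps the states of the block away from the halting state 1, where [tm_step] would stop. *)
Lemma exec_iter p t n t' : exec p t n t' ->
  forall pre post, R = pre ++ rows (size pre) p ++ post -> 1 < size pre ->
  iter n (@tm_step M) (conf M (size pre) t) = conf M (size pre + psize p) t'.
Proof.
have nq1 k : 1 < k -> k != 1 by lia.
elim=> {p t n t'} [s t|m t|p q t1 t2 t3 n1 n2 _ IH1 _ IH2|p q r t n t' _ IH
                  |p t ct|p t1 t2 t3 n1 n2 ct _ IH1 _ IH2] pre post eR gt1.
- rewrite /= addn1; apply: step_conf; rewrite ?nq1 // eR.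
    by rewrite size_cat /=; lia.
  by rewrite nth_cat ltnn subnn.
- rewrite /= addn1; apply: step_conf; rewrite ?nq1 // eR.
    by rewrite size_cat /=; lia.
  by rewrite nth_cat ltnn subnn.
- rewrite addnC iterD (IH1 pre (rows (size pre + psize p) q ++ post)) //; last first.
    by rewrite eR /= -catA.
  have sz : size (pre ++ rows (size pre) p) = size pre + psize p.
    by rewrite size_cat size_rows.
  by rewrite -sz (IH2 _ post) ?sz //= ?addnA // ?eR ?catA //=; lia.
- set e := size pre + psize (Case p q r).
  have Ee : e = (size pre).+1 + (psize p).+1 + (psize q).+1 + (psize r).+1.
    by rewrite /e /=; lia.
  rewrite [rows _ (Case _ _ _)]/= -Ee in eR; rewrite -/e.
  have -> : n.+2 = n.+1 + 1 by lia.
  rewrite iterD [iter 1 _ _]/=.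
  set o := match cur t with None => (size pre).+1 | Some false => (size pre).+1 + (psize p).+1
           | Some true => (size pre).+1 + (psize p).+1 + (psize q).+1 end.
  have -> : tm_step (conf M (size pre) t) = conf M o (act (cur t) Stay t).
    apply: step_conf; rewrite ?nq1 // eR; first by rewrite size_cat /=; lia.
    by rewrite nth_cat ltnn subnn.
  have -> : conf M o (act (cur t) Stay t) = conf M o t by [].
  have [pre' [post' [eR' sz' eb]]] : exists pre' post',
     [/\ R = pre' ++ rows (size pre') (branch p q r (cur t)) ++ jump e :: post',
      size pre' = o & 1 < size pre'].
    rewrite eR /o; set hd := (fun x : sym => _); case: (cur t) => [[]|] /=.
    + pose P := rcons pre hd ++ rows (size pre).+1 p ++ jump e :: rows ((size pre).+1 + (psize p).+1) q ++ [:: jump e].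
      have sP : size P = (size pre).+1 + (psize p).+1 + (psize q).+1.
        by rewrite /P size_cat size_rcons size_cat /= size_cat !size_rows /=; lia.
      exists P, post; rewrite sP; split=> //; last by lia.
      by rewrite /P -cats1 !(cat_cons, cat0s, =^~ catA).
    + pose P := rcons pre hd ++ rows (size pre).+1 p ++ [:: jump e].
      have sP : size P = (size pre).+1 + (psize p).+1.
        by rewrite /P size_cat size_rcons size_cat /= size_rows /=; lia.
      exists P, (rows ((size pre).+1 + (psize p).+1 + (psize q).+1) r ++ jump e :: post); rewrite sP; split=> //; last by lia.
      by rewrite /P -cats1 !(cat_cons, cat0s, =^~ catA).
    + exists (rcons pre hd), (rows ((size pre).+1 + (psize p).+1) q ++ jump e :: rows ((size pre).+1 + (psize p).+1 + (psize q).+1) r ++ jump e :: post).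
      rewrite size_rcons; split=> //; last by lia.
      by rewrite -cats1 !(cat_cons, cat0s, =^~ catA).
  have -> : n.+1 = 1 + n by lia.
  rewrite iterD -sz' (IH pre' (jump e :: post')) //= .
  apply: (step_conf (w := cur t') (m := Stay)); rewrite ?nq1 //; try lia.
  + by rewrite eR' !size_cat size_rows /=; lia.
  + by rewrite eR' catA nth_cat size_cat size_rows ltnn subnn.
- rewrite /=; apply: (step_conf (w := cur t) (m := Stay)); rewrite ?nq1 // eR.
    by rewrite size_cat /=; lia.
  by rewrite nth_cat ltnn subnn /= ct.
- have -> : (n1 + n2).+2 = n2 + (1 + (n1 + 1)) by lia.
  rewrite !iterD [iter 1 _ (conf _ _ _)]/=.
  have -> : tm_step (conf M (size pre) t1) = conf M (size pre).+1 t1.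
    apply: (step_conf (w := cur t1) (m := Stay)); rewrite ?nq1 // eR.
      by rewrite size_cat /=; lia.
    by rewrite nth_cat ltnn subnn /=; case: (cur t1) ct.
  have sz : size (rcons pre (fun x : option bool => (if x is None then size pre + (psize p).+2 else (size pre).+1, x, Stay))) = (size pre).+1 by rewrite size_rcons.
  rewrite -{1}sz (IH1 _ (jump (size pre) :: post)) ?sz //; last first.
  + exact: leqW.
  + by rewrite eR /= -cats1 !(cat_cons, cat0s, =^~ catA).
  rewrite [iter 1 _ _]/=.
  have -> : tm_step (conf M ((size pre).+1 + psize p) t2) = conf M (size pre) t2.
    apply: (step_conf (w := cur t2) (m := Stay)); rewrite ?nq1 //; try lia.
    + by rewrite eR !size_cat /= !size_cat size_rows /=; lia.
    + rewrite eR nth_cat ifN; last lia.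
      rewrite (_ : _ - _ = (psize p).+1); last lia.
      by rewrite /= -catA nth_cat size_rows ltnn subnn.
  exact: (IH2 pre post).
Qed.
End Simulation.

(** State 0 jumps to the code at 2, state 1 only occupies the place of the halting state, and the
    last row halts. These two jumps are the extra [n.+2] below. *)
Definition tm_of_prog (p : prog) : TM :=
  tm_of_rows ([:: jump 2; jump 1] ++ rows 2 p ++ [:: jump 1]).

Lemma tm_of_progP p x n l w y : x != [::] ->
  exec p ([::], map Some x) n (l, w) -> read_word (head None w :: behead w) = y ->
  tm_computes_within (tm_of_prog p) x y n.+2.
Proof.
move=> nx Hex Hy; set R := [:: jump 2; jump 1] ++ rows 2 p ++ [:: jump 1].
have szR : size R = (psize p).+3 by rewrite /R /= size_cat size_rows addn1.
exists n.+2; split=> //.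
suff -> : tm_run (tm_of_prog p) n.+2 x = conf (tm_of_prog p) 1 (l, w).
  by split; rewrite /halted //= inordK //=.
have -> : n.+2 = 1 + (n + 1) by lia.
rewrite /tm_run !iterD.
have -> : tm_init (tm_of_prog p) x = conf (tm_of_prog p) 0 ([::], map Some x).
  case: x nx {Hex} => //= b r _; rewrite /conf /=; congr (Config _ _ _ _).
  by apply: val_inj; rewrite /= inordK.
have -> : iter 1 (@tm_step (tm_of_prog p)) (conf (tm_of_prog p) 0 ([::], map Some x)) =
    conf (tm_of_prog p) 2 ([::], map Some x).
  by rewrite /= (step_conf (q' := 2) (w := head None (map Some x)) (m := Stay)) // szR.
rewrite (exec_iter Hex (pre := [:: jump 2; jump 1]) (post := [:: jump 1])) //.
rewrite [iter 1 _ _]/=; apply: (step_conf (w := head None w) (m := Stay)) => //.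
- by rewrite -/R szR /=; lia.
- by rewrite /= nth_cat size_rows ltnn subnn.
Qed.

(** * Words on the tape *)

Definition runs (p : prog) (t : tape) (T : nat) (t' : tape) : Prop :=
  exists2 n, n <= T & exec p t n t'.

Declare Scope prog_scope.
Delimit Scope prog_scope with prog.
Bind Scope prog_scope with prog.
Notation "p ;; q" := (Seq p q) (at level 58, right associativity) : prog_scope.
Open Scope prog_scope.
Notation goL := (Move MoveL).
Notation goR := (Move MoveR).
Notation skip := (Move Stay).

Lemma runs_le p t T T' t' : T <= T' -> runs p t T t' -> runs p t T' t'.
Proof. by move=> le [n len Hn]; exists n; first exact: leq_trans le. Qed.

Lemma runs_seq p q t1 T1 t2 T2 t3 :
  runs p t1 T1 t2 -> runs q t2 T2 t3 -> runs (p ;; q) t1 (T1 + T2) t3.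
Proof.
by move=> [n1 l1 H1] [n2 l2 H2]; exists (n1 + n2); [exact: leq_add|apply: ExSeq H1 H2].
Qed.

Lemma runs_case p q r t T t' :
  runs (branch p q r (cur t)) t T t' -> runs (Case p q r) t T.+2 t'.
Proof. by move=> [n ln H]; exists n.+2; last exact: ExCase. Qed.

Lemma runs_loop0 p t : cur t = None -> runs (Loop p) t 1 t.
Proof. by exists 1; last exact: ExLoop0. Qed.

Lemma runs_loopS p t1 T1 t2 T2 t3 : cur t1 <> None ->
  runs p t1 T1 t2 -> runs (Loop p) t2 T2 t3 -> runs (Loop p) t1 (T1 + T2).+2 t3.
Proof.
move=> c [n1 l1 H1] [n2 l2 H2]; exists (n1 + n2).+2; last exact: ExLoopS H2.
by rewrite !ltnS leq_add.
Qed.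

Lemma runs_write s l a w : runs (Write s) (l, a :: w) 1 (l, s :: w).
Proof. by exists 1; last exact: ExWrite. Qed.
Lemma runs_R l a w : runs goR (l, a :: w) 1 (a :: l, w).
Proof. by exists 1; last exact: (ExMove MoveR (l, a :: w)). Qed.
Lemma runs_L l a w : runs goL (l, a :: w) 1 (behead l, head None l :: a :: w).
Proof. by exists 1; last exact: (ExMove MoveL (l, a :: w)). Qed.
Lemma runs_Lc b l a w : runs goL (b :: l, a :: w) 1 (l, b :: a :: w).
Proof. exact: runs_L (b :: l) a w. Qed.
Lemma runs_skip l a w : runs skip (l, a :: w) 1 (l, a :: w).
Proof. by exists 1; last exact: (ExMove Stay (l, a :: w)). Qed.

Definition op := (sym + move)%type.
Notation Wr s := (inl s : op).
Notation Mv m := (inr m : op).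
Definition op_prog (o : op) : prog := match o with inl s => Write s | inr m => Move m end.
Definition op_act (o : op) (t : tape) : tape :=
  match o with inl s => act s Stay t | inr m => act (cur t) m t end.
Fixpoint line (ops : seq op) : prog :=
  match ops with [::] => skip | o :: ops => op_prog o ;; line ops end.
Definition line_act (ops : seq op) (t : tape) : tape := foldl (fun t o => op_act o t) t ops.

Lemma runs_line ops t : (line_act ops t).2 != [::] ->
  runs (line ops) t (size ops).+1 (line_act ops t).
Proof.
elim: ops t => [[l [|a w]] // _|o ops IH t] /=; first exact: runs_skip.
move=> H; apply: (runs_seq (T1 := 1) _ (IH _ H)).
by case: o H => [s|m] _; exists 1 => //=; [exact: ExWrite|exact: ExMove].
Qed.

Notation B := (map Some).
Lemma runs_goR s l w :
  runs (Loop goR) (l, B s ++ None :: w) (3 * size s + 1) (rev (B s) ++ l, None :: w).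
Proof.
elim: s l => [|b s IH] l /=; first exact: runs_loop0.
rewrite rev_cons cat_rcons; apply: runs_le (runs_loopS _ (runs_R _ _ _) (IH _)) => //; lia.
Qed.

Lemma runs_goL r l w : runs (Loop goL)
  (behead (B r ++ None :: l), head None (B r ++ None :: l) :: w) (3 * size r + 1)
  (l, None :: B (rev r) ++ w).
Proof.
elim: r w => [|b r IH] w /=; first exact: runs_loop0.
rewrite rev_cons map_rcons cat_rcons.
by apply: runs_le (runs_loopS _ (runs_L _ _ _) (IH _)) => //; lia.
Qed.

Definition toL : prog := goL ;; Loop goL ;; goR.
Lemma runs_toL s l a w :
  runs toL (rev (B s) ++ None :: l, a :: w) (3 * size s + 3) (None :: l, B s ++ a :: w).
Proof.
rewrite -map_rev -{2 3}[s]revK size_rev; move: (rev s) => r {s}.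
by apply: runs_le (runs_seq (runs_L _ _ _) (runs_seq (runs_goL _ _ _) (runs_R _ _ _))); lia.
Qed.

Definition overR : prog := Loop goR ;; goR.
Lemma runs_overR s l w :
  runs overR (l, B s ++ None :: w) (3 * size s + 2) (None :: rev (B s) ++ l, w).
Proof.
by apply: runs_le (runs_seq (runs_goR _ _ _) (runs_R _ _ _)); lia.
Qed.

Definition overL : prog := goL ;; toL.
Lemma runs_overL s l a w :
  runs overL (None :: rev (B s) ++ None :: l, a :: w) (3 * size s + 4)
       (None :: l, B s ++ None :: a :: w).
Proof.
by apply: runs_le (runs_seq (runs_Lc _ _ _ _) (runs_toL s l None (a :: w))); lia.
Qed.

Fixpoint rep (n : nat) (p : prog) : prog :=
  match n with 0 => skip | n.+1 => p ;; rep n p end.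

(** Each word is closed by one blank. Words contain no blank, so [overR] and [overL] step over
    exactly one block. *)
Definition eb (ss : seq (seq bool)) : seq sym := flatten [seq rcons (B s) None | s <- ss].
Lemma eb_cons s ss : eb (s :: ss) = B s ++ None :: eb ss.
Proof. by rewrite /eb /= cat_rcons. Qed.
Lemma eb_rcons ss s : eb (rcons ss s) = eb ss ++ B s ++ [:: None].
Proof. by rewrite /eb map_rcons flatten_rcons cats1. Qed.
Lemma eb_cat s1 s2 : eb (s1 ++ s2) = eb s1 ++ eb s2.
Proof. by rewrite /eb map_cat flatten_cat. Qed.

(** The cell left of a block boundary is blank whether it closes a previous block or belongs to the
    margin; leftward loops over a word therefore stop there in both cases. *)
Lemma eb_left ss l : exists l', rev (eb ss) ++ None :: l = None :: l'.
Proof.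
case/lastP: ss => [|ss s]; first by exists l.
by rewrite eb_rcons !rev_cat /= -!catA /=; eexists.
Qed.

Lemma runs_overRn ss l a w :
  runs (rep (size ss) overR) (l, eb ss ++ a :: w) (3 * size (eb ss) + 1)
       (rev (eb ss) ++ l, a :: w).
Proof.
elim: ss l => [|s ss IH] l; first exact: runs_skip.
rewrite eb_cons -catA rev_cat rev_cons -cats1 -!catA /=.
apply: runs_le (runs_seq (runs_overR _ _ _) (IH _)).
by rewrite size_cat /= size_map; lia.
Qed.

Lemma runs_overLn ss l a w :
  runs (rep (size ss) overL) (rev (eb ss) ++ None :: l, a :: w) (4 * size (eb ss) + 1)
       (None :: l, eb ss ++ a :: w).
Proof.
elim/last_ind: ss a w => [|ss s IH] a w; first exact: runs_skip.
have [l' El] := eb_left ss l.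
rewrite size_rcons eb_rcons !rev_cat /= -!catA [_ ++ None :: l]El /=.
case E: (B s ++ None :: a :: w) => [|c w']; first by case: (s) E.
apply: runs_le (runs_seq (runs_overL _ _ _ _) _).
2: { rewrite E -El; exact: IH. }
by rewrite !size_cat /= size_map; lia.
Qed.

(** * Shifting, deleting, writing and copying blocks *)

Definition shift_bit (b : bool) : prog :=
  line [:: Wr None; Mv MoveR; Wr (Some b); Mv MoveL; Mv MoveL].

(** The word to the left of the head moves one cell to the right, last bit first, so no bit is
    overwritten before it has been moved. *)
Definition shift : prog :=
  goL ;; Loop (Case skip (shift_bit false) (shift_bit true)) ;; goR ;; goR.

Lemma runs_shift s l w :
  runs shift (rev (B s) ++ None :: l, None :: w) (10 * size s + 4)
       (None :: None :: l, B s ++ w).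
Proof.
rewrite -map_rev -{2 3}[s]revK size_rev; move: (rev s) => r {s}.
suff H : runs (Loop (Case skip (shift_bit false) (shift_bit true)))
  (behead (B r ++ None :: l), head None (B r ++ None :: l) :: None :: w) (10 * size r + 1)
  (l, None :: None :: B (rev r) ++ w).
  apply: runs_le (runs_seq (runs_L _ _ _) (runs_seq H (runs_seq (runs_R _ _ _) (runs_R _ _ _)))).
  lia.
elim: r w => [|b r IH] w; first exact: runs_loop0.
rewrite rev_cons map_rcons cat_rcons /=.
apply: (@runs_le _ _ ((6.+2 + (10 * size r + 1)).+2)); first lia.
apply: runs_loopS (IH _) => //.
apply: runs_case; rewrite /cur /=.
case: b => /=; apply: runs_le (runs_line _) => //=; lia.
Qed.

Definition shift1 : prog := goL ;; shift ;; goL.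
Lemma runs_shift1 s l w :
  runs shift1 (None :: rev (B s) ++ None :: l, None :: w) (10 * size s + 6)
       (None :: l, None :: B s ++ None :: w).
Proof.
case E: (B s ++ None :: w) => [|c w']; first by case: (s) E.
apply: runs_le (runs_seq (runs_Lc _ _ _ _) (runs_seq (runs_shift s l (None :: w)) _)).
2: { rewrite E; exact: runs_L. }
lia.
Qed.

Definition shiftn (n : nat) : prog := rep n shift1 ;; goR.
Lemma runs_shiftn ss l w :
  runs (shiftn (size ss)) (rev (eb ss) ++ None :: l, None :: w) (10 * size (eb ss) + 2)
       (None :: None :: l, eb ss ++ w).
Proof.
suff H : runs (rep (size ss) shift1) (rev (eb ss) ++ None :: l, None :: w)
   (10 * size (eb ss) + 1) (None :: l, None :: eb ss ++ w).
  by apply: runs_le (runs_seq H (runs_R _ _ _)); lia.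
elim/last_ind: ss w => [|ss s IH] w; first exact: runs_skip.
have [l' El] := eb_left ss l.
rewrite size_rcons eb_rcons !rev_cat /= -!catA [_ ++ None :: l]El /=.
apply: runs_le (runs_seq (runs_shift1 _ _ _) _).
2: { rewrite -El; exact: IH. }
by rewrite !size_cat /= size_map; lia.
Qed.

(** The bits of block [n] are erased one at a time; after each, the [n] blocks in front move one
    cell right to close the gap, and a final shift swallows the separator. Nothing to the right
    moves, and the freed cells join the blank margin on the left. *)
Definition del (n : nat) : prog :=
  rep n overR ;; Loop (Write None ;; shiftn n ;; rep n overR) ;; shiftn n.

Lemma runs_del ss s m a w : exists m',
  runs (del (size ss)) (nseq m.+1 None, eb ss ++ B s ++ None :: a :: w)
       (20 * (size s).+1 * (size (eb ss)).+1) (nseq m'.+1 None, eb ss ++ a :: w).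
Proof.
have H1 k : runs (rep (size ss) overR) (nseq k.+1 None, eb ss ++ B s ++ None :: a :: w)
  (3 * size (eb ss) + 1) (rev (eb ss) ++ nseq k.+1 None, B s ++ None :: a :: w).
  case E: (B s ++ None :: a :: w) => [|c w']; first by case: (s) E.
  exact: runs_overRn.
exists (m + size s).+1.
apply: (@runs_le _ _ (3 * size (eb ss) + 1 + ((15 * (size (eb ss)).+1 * size s + 1) + (10 * size (eb ss) + 2)))).
  by nia.
apply: runs_seq (H1 m) _; apply: (@runs_seq _ _ _ _ (rev (eb ss) ++ nseq (m + size s).+1 None, None :: a :: w)).
  elim: s m {H1} => [|b s IH] m; first by rewrite addn0 muln0; exact: runs_loop0.
  rewrite /=.
  apply: (@runs_le _ _ (((1 + ((10 * size (eb ss) + 2) + (3 * size (eb ss) + 1))) + (15 * (size (eb ss)).+1 * size s + 1)).+2)).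
    by nia.
  apply: (@runs_loopS _ _ _ (rev (eb ss) ++ nseq m.+2 None, B s ++ None :: a :: w)) => //.
    2: { by have := IH m.+1; rewrite [m.+1 + _]addSnnS. }
  apply: runs_seq (runs_write _ _ _ _) _.
  apply: runs_seq (runs_shiftn _ _ _) _.
  case E: (B s ++ None :: a :: w) => [|c w']; first by case: (s) E.
  exact: (runs_overRn ss (nseq m.+2 None)).
exact: runs_shiftn.
Qed.

(** Stepping left and back turns an implicit blank beyond the end of the list into an explicit
    [None], which restores the normal form of a nonempty left margin. *)
Definition padL : prog := goL ;; goR.
Lemma runs_padL m a w : exists m', runs padL (nseq m None, a :: w) 2 (nseq m'.+1 None, a :: w).
Proof.
exists m.-1; apply: (runs_seq (runs_L _ _ _)).
by case: m => [|m]; exact: runs_R.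
Qed.

Fixpoint push (v : seq sym) : prog :=
  match v with [::] => skip | s :: v => push v ;; goL ;; Write s end.
Lemma runs_push v m a w : exists m',
  runs (push v ;; padL) (nseq m None, a :: w) (2 * size v + 3) (nseq m'.+1 None, v ++ a :: w).
Proof.
have H : runs (push v) (nseq m None, a :: w) (2 * size v + 1) (nseq (m - size v) None, v ++ a :: w).
  elim: v => [|s v IH] /=; first by rewrite subn0; exact: runs_skip.
  case E: (v ++ a :: w) IH => [|c w'] IH; first by case: (v) E.
  have El: nseq (m - (size v).+1) None = behead (nseq (m - size v) (None : sym)).
    by rewrite subnS; case: (m - _).
  rewrite El; apply: runs_le (runs_seq IH (runs_seq (runs_L _ _ _) (runs_write _ _ _ _))).
  lia.
case E: (v ++ a :: w) H => [|c w'] H; first by case: (v) E.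
have [m' Hm] := runs_padL (m - size v) c w'.
by exists m'; apply: runs_le (runs_seq H Hm); lia.
Qed.

(** The bit being copied is replaced by a blank, which marks the place: after the bit has been put
    in front of the partial copy, [Loop goR] comes to rest on the mark and the bit is restored. The
    partial copy is one more block, whence [n.+1]. *)
Definition pick_bit (n : nat) (b : bool) : prog :=
  Write None ;; toL ;; rep n.+1 overL ;; goL ;; Write (Some b) ;; padL ;;
  rep n.+1 overR ;; Loop goR ;; Write (Some b) ;; goL.

(** A margin blank serves as the separator of an initially empty copy. Bits are taken from the last
    to the first, because the copy grows at its front. *)
Definition pick (n : nat) : prog :=
  goL ;; padL ;; rep n.+1 overR ;; Loop goR ;; goL ;;
  Loop (Case skip (pick_bit n false) (pick_bit n true)) ;;
  goR ;; rep n.+1 overL.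

(** [L k u] is the tape to the left of the bit being copied: the bits [r] still to copy, the blocks
    [ss], the partial copy [u] and the margin. The [head] and [behead] in the conclusion say that
    the head has moved on to the next bit of [r], or to the blank before it. *)
Lemma runs_pick_bit ss u r b m w :
  let X := size r + size u + size (eb ss) in
  let L k u := B r ++ rev (eb (u :: ss)) ++ nseq k.+1 None in
  exists m',
  runs (pick_bit (size ss) b)
       (L m u, Some b :: B u ++ None :: w) (20 * X + 100)
       (behead (L m' (b :: u)), head None (L m' (b :: u)) :: B (b :: u) ++ None :: w).
Proof.
move=> X L.
have [l' El] := eb_left (u :: ss) (nseq m None).
have E1 : L m u = rev (B (rev r)) ++ None :: l' by rewrite /L El -map_rev revK.
case E2: (B (rev r) ++ None :: B u ++ None :: w) => [|c2 w2]; first by case: (rev r) E2.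
case E3: (eb (u :: ss) ++ B (rev r) ++ None :: B u ++ None :: w) => [|c3 w3].
  by rewrite eb_cons in E3; case: (u) E3.
have [m' Hpad] := runs_padL m (Some b) (c3 :: w3).
exists m'.
have Sz : size (eb (u :: ss)) = size u + (size (eb ss)).+1 by rewrite eb_cons size_cat /= size_map.
have Sz' : size (eb ((b :: u) :: ss)) = (size u + (size (eb ss)).+1).+1 by rewrite eb_cons size_cat /= size_map.
apply: (@runs_le _ _ (1 + ((3 * size r + 3) + ((4 * size (eb (u :: ss)) + 1) + (1 + (1 + (2 + ((3 * size (eb ((b :: u) :: ss)) + 1) + ((3 * size r + 1) + (1 + 1)))))))))).
  by rewrite Sz Sz' /X; lia.
apply: runs_seq (runs_write _ _ _ _) _.
rewrite E1; apply: (runs_seq (T1 := 3 * size r + 3) _ _); first by rewrite -(size_rev r); exact: runs_toL.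
rewrite E2 -El; apply: (runs_seq (runs_overLn (u :: ss) _ _ _)).
rewrite -E2 E3; apply: runs_seq (runs_L _ _ _) _ => /=.
apply: runs_seq (runs_write _ _ _ _) _.
apply: runs_seq Hpad _.
have E4 : Some b :: c3 :: w3 = eb ((b :: u) :: ss) ++ B (rev r) ++ None :: B u ++ None :: w.
  by rewrite -E3 !eb_cons.
rewrite E4 E2; apply: (runs_seq (runs_overRn ((b :: u) :: ss) _ _ _)).
rewrite -E2; apply: (runs_seq (T1 := 3 * size r + 1) _ _); first by rewrite -(size_rev r); exact: runs_goR.
rewrite -map_rev revK.
apply: runs_seq (runs_write _ _ _ _) _.
exact: runs_L.
Qed.

Lemma runs_pick ss s m w : exists m',
  runs (pick (size ss)) (nseq m.+1 None, eb ss ++ B s ++ None :: w)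
     (200 * (size s + size (eb ss)).+1 * (size s + size (eb ss)).+1)
     (nseq m'.+1 None, B s ++ None :: eb ss ++ B s ++ None :: w).
Proof.
set X := size s + size (eb ss).
pose L r k u := B r ++ rev (eb (u :: ss)) ++ nseq k.+1 (None : sym).
have Hloop r u k : size r + size u <= size s -> exists k',
  runs (Loop (Case skip (pick_bit (size ss) false) (pick_bit (size ss) true)))
    (behead (L r k u), head None (L r k u) :: B u ++ None :: w)
    ((20 * X + 104) * size r + 1)
    (behead (L [::] k' (rev r ++ u)), None :: B (rev r ++ u) ++ None :: w).
  elim: r u k => [|b r IH] u k le.
    exists k; rewrite muln0 /L /=; have [l' ->] := eb_left (u :: ss) (nseq k None).
    exact: runs_loop0.
  have [k1 H1] := runs_pick_bit ss u r b k w.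
  have [|k2 H2] := IH (b :: u) k1; first by move: le => /=; lia.
  exists k2; rewrite rev_cons cat_rcons.
  apply: (@runs_le _ _ ((20 * X + 100).+2 + ((20 * X + 104) * size r + 1)).+2).
    rewrite /=; lia.
  apply: runs_loopS H2 => //; apply: runs_case.
  have {}H1 : runs (pick_bit (size ss) b) (L r k u, Some b :: B u ++ None :: w) (20 * X + 100)
       (behead (L r k1 (b :: u)), head None (L r k1 (b :: u)) :: B (b :: u) ++ None :: w).
    by apply: runs_le H1; rewrite /X; move: le => /=; lia.
  by case: (b) H1.
case E: (eb ss ++ B s ++ None :: w) => [|c w']; first by case: (ss) E => [|a ss'] /=; [case: (s)|rewrite eb_cons; case: a].
have [m1 H1] := runs_padL m None (c :: w').
have [|m2 H2] := Hloop (rev s) [::] m1; first by rewrite size_rev addn0.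
exists m2.
case E2: (B s ++ None :: w) => [|c2 w2]; first by case: (s) E2.
have Sz u: size (eb (u :: ss)) = size u + (size (eb ss)).+1 by rewrite eb_cons size_cat /= size_map.
apply: (@runs_le _ _ (1 + (2 + ((3 * size (eb ([::] :: ss)) + 1) + ((3 * size s + 1) + (1 + (((20 * X + 104) * size s + 1) + (1 + (4 * size (eb (s :: ss)) + 1))))))))).
  rewrite !Sz /=; have : size s <= X by rewrite /X; lia.
  have : size (eb ss) <= X by rewrite /X; lia.
  by clear -X; clearbody X; move: (size s) (size (eb ss)) X => sa sb Y; nia.
apply: runs_seq (runs_L _ _ _) _ => /=.
apply: runs_seq H1 _.
have -> : [:: None, c & w'] = eb ([::] :: ss) ++ B s ++ None :: w by rewrite eb_cons /= E.
rewrite E2; apply: (runs_seq (runs_overRn ([::] :: ss) _ _ _)).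
rewrite -E2; apply: runs_seq (runs_goR _ _ _) _.
apply: runs_seq (runs_L _ _ _) _.
rewrite size_rev revK cats0 in H2.
rewrite -map_rev; apply: runs_seq H2 _.
apply: runs_seq (runs_R _ _ _) _.
have -> : None :: behead (L [::] m2 s) = rev (eb (s :: ss)) ++ nseq m2.+1 None.
  by rewrite /L /=; have [l' ->] := eb_left (s :: ss) (nseq m2 None).
rewrite E2 (_ : B s ++ None :: eb ss ++ c2 :: w2 = eb (s :: ss) ++ c2 :: w2); last by rewrite eb_cons -catA.
exact: (runs_overLn (s :: ss)).
Qed.

(** * A stack of codes *)

Fixpoint code_ind' (P : code -> Prop) (Hl : forall bs, P (CLeaf bs))
  (Hn : forall cs, foldr (fun c Q => P c /\ Q) True cs -> P (CNode cs)) (c : code) : P c :=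
  match c with
  | CLeaf bs => Hl bs
  | CNode cs => Hn cs ((fix f (l : seq code) : foldr (fun c Q => P c /\ Q) True l :=
      match l with [::] => I | c :: l => conj (code_ind' Hl Hn c) (f l) end) cs)
  end.

Definition isleaf (v : code) : bool := if v is CLeaf _ then true else false.
Definition body (v : code) : seq bool :=
  match v with
  | CLeaf bs => flatten [seq [:: false; b] | b <- bs] ++ [:: true; true]
  | CNode cs => flatten (map enc_code cs) ++ [:: true; true]
  end.

Lemma enc_body v : enc_code v = [:: true, false, false, isleaf v & body v].
Proof. by case: v => //= cs; do 5 f_equal; elim: cs => //= c cs ->. Qed.

Definition elems (v : code) : seq code :=
  match v with CLeaf bs => [seq CLeaf [:: b] | b <- bs] | CNode cs => cs end.
Definition chd (v : code) : code := head v (elems v).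
Definition ctl (v : code) : code :=
  match v with CLeaf bs => CLeaf (behead bs) | CNode cs => CNode (behead cs) end.
Definition ccons (a v : code) : code :=
  match v with CLeaf _ => v | CNode cs => CNode (a :: cs) end.
Definition cbcons (b : bool) (v : code) : code :=
  match v with CLeaf bs => CLeaf (b :: bs) | CNode _ => v end.
Definition cisnil (v : code) : bool := nilp (elems v).
Definition ctrue (v : code) : bool := if v is CLeaf (true :: _) then true else false.

Definition encs (st : seq code) : seq sym := eb (map enc_code st).
(* The amount of blank tape on the left grows as values are discarded. *)
Definition tp (m : nat) (st : seq code) : tape := (nseq m.+1 None, encs st ++ [:: None]).
Definition stk (p : prog) (st : seq code) (T : nat) (st' : seq code) : Prop :=
  forall m, exists m', runs p (tp m st) T (tp m' st').
Definition ssz (st : seq code) : nat := size (encs st).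
Definition csz (v : code) : nat := size (enc_code v).

Lemma encs_cons v st : encs (v :: st) = B (enc_code v) ++ None :: encs st.
Proof. exact: eb_cons. Qed.
Lemma encs_cat s1 s2 : encs (s1 ++ s2) = encs s1 ++ encs s2.
Proof. by rewrite /encs map_cat eb_cat. Qed.
Lemma ssz_cons v st : ssz (v :: st) = (csz v + ssz st).+1.
Proof. by rewrite /ssz encs_cons size_cat size_map /= addnS. Qed.
Lemma ssz_cat s1 s2 : ssz (s1 ++ s2) = ssz s1 + ssz s2.
Proof. by rewrite /ssz encs_cat size_cat. Qed.

Lemma stk_le p st T T' st' : T <= T' -> stk p st T st' -> stk p st T' st'.
Proof. by move=> le H m; have [m' Hm] := H m; exists m'; apply: runs_le Hm. Qed.
Lemma stk_seq p q s1 T1 s2 T2 s3 :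
  stk p s1 T1 s2 -> stk q s2 T2 s3 -> stk (p ;; q) s1 (T1 + T2) s3.
Proof.
move=> H1 H2 m; have [m1 {}H1] := H1 m; have [m2 {}H2] := H2 m1.
by exists m2; apply: runs_seq H1 H2.
Qed.

Lemma encs_ne st : exists c w, encs st ++ [:: None] = c :: w.
Proof. by case: (encs st) => [|c w]; do 2 eexists. Qed.

Lemma stk_del i st : i < size st ->
  stk (del i) st (20 * (ssz st).+1 * (ssz st).+1) (take i st ++ drop i.+1 st).
Proof.
move=> lti m; have [c [w Ew]] := encs_ne (drop i.+1 st).
have Est : st = take i st ++ nth (CNode [::]) st i :: drop i.+1 st.
  by rewrite -drop_nth // cat_take_drop.
set s1 := take i st in Est *; set v := nth _ st i in Est; set s2 := drop i.+1 st in Est Ew *.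
have szi : size (map enc_code s1) = i by rewrite size_map size_takel // ltnW.
have [m' H] := runs_del (map enc_code s1) (enc_code v) m c w.
exists m'; rewrite szi in H.
have -> : tp m st = (nseq m.+1 None, eb (map enc_code s1) ++ B (enc_code v) ++ None :: c :: w).
  by rewrite /tp Est encs_cat encs_cons -Ew -!catA.
have -> : tp m' (s1 ++ s2) = (nseq m'.+1 None, eb (map enc_code s1) ++ c :: w).
  by rewrite /tp encs_cat -Ew catA.
apply: runs_le H; rewrite Est ssz_cat ssz_cons /ssz /csz /encs.
by apply: leq_mul; [apply: leq_mul => //|]; lia.
Qed.

Lemma stk_pick i st : i < size st ->
  stk (pick i) st (200 * (ssz st).+1 * (ssz st).+1) (nth (CNode [::]) st i :: st).
Proof.
move=> lti m; have Est : st = take i st ++ nth (CNode [::]) st i :: drop i.+1 st.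
  by rewrite -drop_nth // cat_take_drop.
set s1 := take i st in Est; set v := nth _ st i in Est *; set s2 := drop i.+1 st in Est.
have szi : size (map enc_code s1) = i by rewrite size_map size_takel // ltnW.
have [m' H] := runs_pick (map enc_code s1) (enc_code v) m (encs s2 ++ [:: None]).
exists m'; rewrite szi in H.
have -> : tp m st = (nseq m.+1 None, eb (map enc_code s1) ++ B (enc_code v) ++ None :: encs s2 ++ [:: None]).
  by rewrite /tp Est encs_cat encs_cons -!catA.
have -> : tp m' (v :: st) = (nseq m'.+1 None, B (enc_code v) ++ None :: eb (map enc_code s1) ++ B (enc_code v) ++ None :: encs s2 ++ [:: None]).
  by rewrite /tp encs_cons {1}Est encs_cat encs_cons -!catA /= -!catA.
apply: runs_le H; rewrite Est ssz_cat ssz_cons /ssz /csz /encs.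
by apply: leq_mul; [apply: leq_mul => //|]; lia.
Qed.

Definition lit (c : code) : prog := push (rcons (B (enc_code c)) None) ;; padL.
Lemma stk_lit c st : stk (lit c) st (2 * csz c + 5) (c :: st).
Proof.
move=> m; have [a [w Ew]] := encs_ne st.
have [m' H] := runs_push (rcons (B (enc_code c)) None) m.+1 a w.
exists m'; rewrite /tp encs_cons Ew.
apply: runs_le; last by rewrite -catA /= Ew -cat_rcons; exact: H.
by rewrite size_rcons size_map /csz; lia.
Qed.

(** The cells after the four-bit header decide: the closing token [11] means an empty value, [0]
    starts a bit of a leaf, [10] opens a child. Each branch first returns the head to the start. *)
Definition ifnil (p q : prog) : prog :=
  line (nseq 4 (Mv MoveR)) ;;
  Case skip (line (nseq 4 (Mv MoveL)) ;; q)
    (goR ;; Case skip (line (nseq 5 (Mv MoveL)) ;; q) (line (nseq 5 (Mv MoveL)) ;; p)).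

Definition iftrue (p q : prog) : prog :=
  line (nseq 3 (Mv MoveR)) ;;
  Case skip (line (nseq 3 (Mv MoveL)) ;; q)
    (goR ;; Case skip
       (goR ;; Case skip (line (nseq 5 (Mv MoveL)) ;; q) (line (nseq 5 (Mv MoveL)) ;; p))
       (line (nseq 4 (Mv MoveL)) ;; q)).

Lemma body_shape v : exists b w,
  body v = if cisnil v then [:: true; true]
           else if isleaf v then [:: false, b & w] else [:: true, false & w].
Proof.
case: v => [[|b bs]|[|c cs]]; try by exists true, [::].
  by exists b; eexists.
by exists true; rewrite /= enc_body; eexists.
Qed.

Lemma runs_ifnil p q m v st T t' :
  runs (if cisnil v then p else q) (tp m (v :: st)) T t' ->
  runs (ifnil p q) (tp m (v :: st)) (T + 20) t'.
Proof.
rewrite /tp encs_cons enc_body; have [b [w ->]] := body_shape v.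
rewrite /ifnil; case: (cisnil v) => [|] H.
  apply: (@runs_le _ _ (5 + ((1 + ((6 + T).+2)).+2))); first lia.
  apply: runs_seq (runs_line _) _ => //; apply: runs_case.
  apply: runs_seq (runs_R _ _ _) _; apply: runs_case.
  by apply: runs_seq (runs_line _) _.
case: (isleaf v) H => H.
  apply: (@runs_le _ _ (5 + ((5 + T).+2))); first lia.
  apply: runs_seq (runs_line _) _ => //; apply: runs_case.
  by apply: runs_seq (runs_line _) _.
apply: (@runs_le _ _ (5 + ((1 + ((6 + T).+2)).+2))); first lia.
apply: runs_seq (runs_line _) _ => //; apply: runs_case.
apply: runs_seq (runs_R _ _ _) _; apply: runs_case.
by apply: runs_seq (runs_line _) _.
Qed.

Lemma stk_ifnil p q v st T st' :
  stk (if cisnil v then p else q) (v :: st) T st' -> stk (ifnil p q) (v :: st) (T + 20) st'.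
Proof. by move=> H m; have [m' {}H] := H m; exists m'; apply: runs_ifnil. Qed.

Lemma stk_iftrue p q v st T st' :
  stk (if ctrue v then p else q) (v :: st) T st' -> stk (iftrue p q) (v :: st) (T + 25) st'.
Proof.
move=> H m; have [m' {}H] := H m; exists m'; move: H.
rewrite /tp encs_cons enc_body /iftrue; case: v => [[|[] bs]|cs] H.
- apply: (@runs_le _ _ (4 + (1 + (5 + T).+2).+2)); first lia.
  apply: runs_seq (runs_line _) _ => //; apply: runs_case.
  apply: runs_seq (runs_R _ _ _) _; apply: runs_case.
  by apply: runs_seq (runs_line _) _.
- apply: (@runs_le _ _ (4 + (1 + (1 + (6 + T).+2).+2).+2)); first lia.
  apply: runs_seq (runs_line _) _ => //; apply: runs_case.
  apply: runs_seq (runs_R _ _ _) _; apply: runs_case.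
  apply: runs_seq (runs_R _ _ _) _; apply: runs_case.
  by apply: runs_seq (runs_line _) _.
- apply: (@runs_le _ _ (4 + (1 + (1 + (6 + T).+2).+2).+2)); first lia.
  apply: runs_seq (runs_line _) _ => //; apply: runs_case.
  apply: runs_seq (runs_R _ _ _) _; apply: runs_case.
  apply: runs_seq (runs_R _ _ _) _; apply: runs_case.
  by apply: runs_seq (runs_line _) _.
- apply: (@runs_le _ _ (4 + (4 + T).+2)); first lia.
  apply: runs_seq (runs_line _) _ => //; apply: runs_case.
  by apply: runs_seq (runs_line _) _.
Qed.

(** The header of a leaf is rewritten two cells further left, and the two cells it frees receive the
    token [0b]. *)
Definition bcons (b : bool) : prog :=
  line (nseq 3 (Mv MoveR)) ;;
  Case skip (line (nseq 3 (Mv MoveL)))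
   (line [:: Wr (Some b); Mv MoveL; Wr (Some false); Mv MoveL; Wr (Some true); Mv MoveL; Wr (Some false)] ;;
    push [:: Some true; Some false] ;; padL).

Lemma stk_bcons b v st : stk (bcons b) (v :: st) 30 (cbcons b v :: st).
Proof.
move=> m; rewrite /tp !encs_cons !enc_body /bcons.
case: v => [bs|cs]; last first.
  exists m; apply: (@runs_le _ _ (4 + (4).+2)) => //.
  by apply: runs_seq (runs_line _) _ => //; apply: runs_case; apply: runs_line.
have [m' H] := runs_push [:: Some true; Some false] m.+1 (Some false) [:: Some true, Some false, Some b & (B (body (CLeaf bs)) ++ None :: encs st) ++ [:: None]].
exists m'; apply: (@runs_le _ _ (4 + (8 + 7).+2)) => //.
by apply: runs_seq (runs_line _) _ => //; apply: runs_case; apply: runs_seq (runs_line _) _.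
Qed.

Definition move_bit (b : bool) : prog :=
  line (Wr None :: nseq 5 (Mv MoveL) ++ Wr (Some b) :: nseq 6 (Mv MoveR)).
Definition back : prog := line (nseq 5 (Mv MoveL)) ;; toL ;; overL.

(* One step of the scan for the end of the first child: the tape holds a
   unary counter of open brackets, the part [P] already moved, a gap of five
   blanks and the rest; the next two-bit token crosses the gap. *)
Definition scan : prog :=
  overR ;; Loop goR ;; line (nseq 5 (Mv MoveR)) ;;
  Case skip
    (move_bit false ;; Case skip (move_bit false) (move_bit true) ;; back)
    (move_bit true ;; Case skip
       (move_bit false ;; back ;; goL ;; Write (Some true) ;; padL)
       (move_bit true ;; back ;; line [:: Wr None; Mv MoveR])).

Definition scan_tape (m d : nat) (P : seq bool) (w : seq sym) : tape :=
  (nseq m.+1 None, B (nseq d true) ++ None :: B P ++ nseq 5 None ++ w).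

(** Nesting depth after a token: [10] opens, [11] closes, [00] and [01] leave it unchanged. *)
Definition tokd (b1 b2 : bool) (d : nat) : nat :=
  if b1 then (if b2 then d.-1 else d.+1) else d.

Lemma runs_move_bit b l w : w != [::] ->
  runs (move_bit b) (nseq 5 None ++ l, Some b :: w) 14 (nseq 5 None ++ Some b :: l, w).
Proof. by move=> ne; apply: runs_line. Qed.

Lemma runs_back l d P c w :
  runs back (nseq 5 None ++ rev (B P) ++ None :: rev (B (nseq d true)) ++ None :: l, c :: w)
     (3 * size P + 3 * d + 20)
     (None :: l, B (nseq d true) ++ None :: B P ++ nseq 5 None ++ c :: w).
Proof.
apply: (@runs_le _ _ (6 + ((3 * size P + 3) + (3 * size (nseq d true) + 4)))).
  by rewrite size_nseq; lia.
apply: runs_seq (runs_line _) _ => //.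
apply: runs_seq (runs_toL P (rev (B (nseq d true)) ++ None :: l) None _) _.
case: P => [|b P]; exact: runs_overL.
Qed.

Lemma runs_scan m d P b1 b2 c w : (b1 && b2 ==> (0 < d)) -> exists m',
  runs scan (scan_tape m d P (Some b1 :: Some b2 :: c :: w)) (10 * (size P + d) + 100)
     (scan_tape m' (tokd b1 b2 d) (P ++ [:: b1; b2]) (c :: w)).
Proof.
move=> hd; set D := B (nseq d true).
suff [m' H] : exists m', runs
  (Case skip
    (move_bit false ;; Case skip (move_bit false) (move_bit true) ;; back)
    (move_bit true ;; Case skip
       (move_bit false ;; back ;; goL ;; Write (Some true) ;; padL)
       (move_bit true ;; back ;; line [:: Wr None; Mv MoveR])))
   (nseq 5 None ++ rev (B P) ++ None :: rev D ++ nseq m.+1 None, Some b1 :: Some b2 :: c :: w)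
   (6 * (size P + d) + 80)
   (scan_tape m' (tokd b1 b2 d) (P ++ [:: b1; b2]) (c :: w)).
  exists m'; apply: (@runs_le _ _ ((3 * size (nseq d true) + 2) + ((3 * size P + 1) + (6 + (6 * (size P + d) + 80))))).
    by rewrite size_nseq; lia.
  apply: runs_seq (runs_overR _ _ _) _.
  apply: runs_seq (runs_goR P _ (nseq 4 None ++ _)) _.
  by apply: runs_seq (runs_line _) _.
have EP : [:: Some b2, Some b1 & rev (B P) ++ None :: rev D ++ nseq m.+1 None] =
   rev (B (P ++ [:: b1; b2])) ++ None :: rev D ++ nseq m.+1 None.
  by rewrite map_cat rev_cat.
have szP : size (P ++ [:: b1; b2]) = size P + 2 by rewrite size_cat.
have Hb := runs_back (nseq m None) d (P ++ [:: b1; b2]) c w.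
rewrite szP -/D -[None :: nseq m None]/(nseq m.+1 None) -EP in Hb.
case: b1 b2 hd EP Hb szP => [] [] /= hd EP Hb szP.
- exists m.+1; apply: (@runs_le _ _ ((14 + ((14 + ((3 * (size P + 2) + 3 * d + 20) + 3)).+2)).+2)); first lia.
  apply: runs_case; apply: runs_seq (runs_move_bit _ _ _) _ => //.
  apply: runs_case; apply: runs_seq (runs_move_bit _ _ _) _ => //.
  apply: runs_seq Hb _; rewrite /D; case: (d) hd => // d' _.
  by apply: (runs_line (ops := [:: Wr None; Mv MoveR])); case: (d').
- have [m' Hp] := runs_padL m (Some true) (D ++ None :: B (P ++ [:: true; false]) ++ nseq 5 None ++ c :: w).
  exists m'; apply: (@runs_le _ _ ((14 + ((14 + ((3 * (size P + 2) + 3 * d + 20) + (1 + (1 + 2)))).+2)).+2)); first lia.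
  apply: runs_case; apply: runs_seq (runs_move_bit _ _ _) _ => //.
  apply: runs_case; apply: runs_seq (runs_move_bit _ _ _) _ => //.
  apply: runs_seq Hb _.
  case E: (D ++ _) => [|c2 w2]; first by case: (D) E.
  apply: runs_seq (runs_Lc _ _ _ _) _; rewrite -E.
  by apply: runs_seq (runs_write _ _ _ _) _.
- exists m; apply: (@runs_le _ _ ((14 + ((14).+2 + (3 * (size P + 2) + 3 * d + 20))).+2)); first lia.
  apply: runs_case; apply: runs_seq (runs_move_bit _ _ _) _ => //.
  by apply: (@runs_seq _ _ _ 16 _ _ _ _ Hb); apply: runs_case; apply: runs_move_bit.
- exists m; apply: (@runs_le _ _ ((14 + ((14).+2 + (3 * (size P + 2) + 3 * d + 20))).+2)); first lia.
  apply: runs_case; apply: runs_seq (runs_move_bit _ _ _) _ => //.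
  by apply: (@runs_seq _ _ _ 16 _ _ _ _ Hb); apply: runs_case; apply: runs_move_bit.
Qed.

Section ScanLoop.
Variables (X : nat) (Fin : nat -> tape).
(** A bound on the rest of the loop, in continuation style: knowing it for a later position, one
    gets it for an earlier one by prepending a token or a whole code. This fits the recursion on
    codes. *)
Definition scans (d : nat) (P : seq bool) (w : seq sym) (n : nat) : Prop :=
  forall m, exists m', runs (Loop scan) (scan_tape m d P w) n (Fin m').

Lemma scans_le d P w n n' : n <= n' -> scans d P w n -> scans d P w n'.
Proof. by move=> le H m; have [m' Hm] := H m; exists m'; apply: runs_le Hm. Qed.

Lemma scans_tok d P b1 b2 w n : 0 < d -> w != [::] -> size P + d <= X ->
  scans (tokd b1 b2 d) (P ++ [:: b1; b2]) w n ->
  scans d P (Some b1 :: Some b2 :: w) (n + (10 * X + 102)).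
Proof.
move=> d0; case: w => // c w _ le H m.
have [|m1 H1] := @runs_scan m d P b1 b2 c w; first by rewrite d0 implybT.
have [m2 H2] := H m1; exists m2.
apply: (@runs_le _ _ ((10 * (size P + d) + 100) + n).+2); first lia.
by apply: runs_loopS H1 H2; case: (d) d0.
Qed.

Definition mid (c : code) : seq bool := false :: isleaf c :: take (size (body c) - 2) (body c).
Lemma enc_mid c : enc_code c = true :: false :: mid c ++ [:: true; true].
Proof.
rewrite enc_body /mid; do 4 f_equal; case: c => [bs|cs] /=;
by rewrite size_cat /= addnK take_size_cat.
Qed.

(** Inside a code the depth never drops below its initial value, so the counter stays nonempty and
    the loop cannot stop early. The factor 2 allows both the moved prefix and the counter to grow by
    [size (mid c)]. *)
Lemma scans_mid c d P w n : 0 < d -> w != [::] -> size P + d + 2 * size (mid c) <= X ->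
  scans d (P ++ mid c) w n -> scans d P (B (mid c) ++ w) (n + size (mid c) * (10 * X + 102)).
Proof.
pose C := 10 * X + 102; rewrite -/C.
have ne2 (s : seq bool) (w' : seq sym) : w' != [::] -> B s ++ w' != [::] by case: s.
elim/code_ind': c d P w n => [bs|cs IH] d P w n d0 ne le H.
  have Em : mid (CLeaf bs) = [:: false; true] ++ flatten [seq [:: false; b] | b <- bs].
    by rewrite /mid /= size_cat addnK take_size_cat.
  rewrite Em in le H *; set fl := flatten _ in le H *.
  suff {le} Hf P' : size P' + d + 2 * size fl <= X ->
      scans d (P' ++ fl) w n -> scans d P' (B fl ++ w) (n + size fl * C).
    apply: (@scans_le _ _ _ (n + size fl * C + C)); first by rewrite size_cat /=; lia.
    move: le; rewrite size_cat /= => le.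
    apply: scans_tok => //; [exact: ne2|lia|].
    by apply: Hf; [rewrite size_cat /=; lia|rewrite -catA].
  clear H Em; rewrite /fl {fl}; elim: bs P' => [|b bs IHb] P' le H.
    by move: H; rewrite cats0 /= mul0n addn0.
  apply: (@scans_le _ _ _ (n + size (flatten [seq [:: false; b] | b <- bs]) * C + C)); first by rewrite /=; lia.
  move: le; rewrite /= => le.
  apply: scans_tok => //; [exact: ne2|lia|].
  by apply: IHb; [rewrite size_cat /=; lia|rewrite -catA].
have Em : mid (CNode cs) = [:: false; false] ++ flatten (map enc_code cs).
  by rewrite /mid /= size_cat addnK take_size_cat.
rewrite Em in le H *; set fl := flatten _ in le H *.
suff {le} Hf P' : size P' + d + 2 * size fl <= X ->
    scans d (P' ++ fl) w n -> scans d P' (B fl ++ w) (n + size fl * C).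
  apply: (@scans_le _ _ _ (n + size fl * C + C)); first by rewrite size_cat /=; lia.
  move: le; rewrite size_cat /= => le.
  apply: scans_tok => //; [exact: ne2|lia|].
  by apply: Hf; [rewrite size_cat /=; lia|rewrite -catA].
clear H Em; rewrite /fl {fl}; elim: cs IH P' => [|c cs IHcs] IH P' le H.
  by move: H; rewrite cats0 /= mul0n addn0.
case: IH => IHc {}/IHcs IHcs; move: (mid c) (enc_mid c) IHc => M EM IHc.
set fl := flatten (map _ cs) in IHcs.
have E : flatten (map enc_code (c :: cs)) = [:: true, false & M ++ [:: true, true & fl]].
  by rewrite /= EM /= -catA.
have sE : size (flatten (map enc_code (c :: cs))) = size M + size fl + 4.
  by rewrite E /= size_cat /=; lia.
rewrite sE in le *; rewrite E in H *.
have -> : B [:: true, false & M ++ [:: true, true & fl]] ++ w =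
    [:: Some true, Some false & B M ++ [:: Some true, Some true & B fl ++ w]].
  by rewrite /= map_cat -catA.
apply: (@scans_le _ _ _ (n + size fl * C + C + size M * C + C)).
  by move: (C) => D; nia.
apply: scans_tok => //; [by apply: (ne2)|lia|].
apply: IHc => //; [rewrite size_cat /=; lia|].
apply: scans_tok => //; [exact: ne2|rewrite !size_cat /=; lia|].
apply: IHcs; first by rewrite !size_cat /=; lia.
by move: H; rewrite -!catA.
Qed.
End ScanLoop.

(** The gap of five blanks consists of the erased four-bit header and one margin cell; once the
    first child has crossed it, it has just the room for a separator and the header of the remaining
    node. One [scan] precedes the loop because the counter starts empty, which is also the exit
    condition. *)
Definition split_node : prog :=
  line [:: Wr None; Mv MoveR; Wr None; Mv MoveR; Wr None; Mv MoveR; Wr None; Mv MoveR] ;;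
  line (nseq 5 (Mv MoveL)) ;; goL ;; padL ;; scan ;; Loop scan ;;
  goR ;; Loop goR ;;
  line [:: Mv MoveR; Wr (Some true); Mv MoveR; Wr (Some false); Mv MoveR; Wr (Some false);
           Mv MoveR; Wr (Some false); Mv MoveL; Mv MoveL; Mv MoveL; Mv MoveL] ;; toL.

(** Header and first token, six cells, are erased; in their place go a one-bit leaf, a separator and
    a fresh header for the remaining bits. *)
Definition split_leaf (b : bool) : prog :=
  line [:: Wr None; Mv MoveL; Wr None; Mv MoveL; Wr None; Mv MoveL; Wr None; Mv MoveL;
           Wr None; Mv MoveL; Wr None; Mv MoveR; Mv MoveR; Mv MoveR; Mv MoveR; Mv MoveR; Mv MoveR] ;;
  push (B [:: true; false; false; true; false; b; true; true] ++ None ::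
        B [:: true; false; false; true]) ;; padL.

Definition split : prog :=
  line (nseq 3 (Mv MoveR)) ;;
  Case skip (line (nseq 3 (Mv MoveL)) ;; split_node)
    (line (nseq 2 (Mv MoveR)) ;; Case skip (split_leaf false) (split_leaf true)).

Lemma runs_split_node c cs st m : exists m',
  runs split_node (tp m (CNode (c :: cs) :: st))
   (1000 * (csz c).+1 * (csz c).+1) (tp m' (c :: CNode cs :: st)).
Proof.
set w := B (flatten (map enc_code cs) ++ [:: true; true]) ++ None :: encs st ++ [:: None].
have Ew : exists x y, w = x :: y.
  by rewrite /w; case E: (flatten _ ++ _) => [|x y]; [case: (flatten _) E|do 2 eexists].
pose X := 2 * csz c.
pose Fin k := scan_tape k 0 (enc_code c) w.
have Ec := enc_mid c.
have szc : csz c = size (mid c) + 4 by rewrite /csz Ec /= size_cat /=; lia.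
have Hend k : runs (goR ;; Loop goR ;;
  line [:: Mv MoveR; Wr (Some true); Mv MoveR; Wr (Some false); Mv MoveR; Wr (Some false);
           Mv MoveR; Wr (Some false); Mv MoveL; Mv MoveL; Mv MoveL; Mv MoveL] ;; toL)
  (Fin k) (6 * csz c + 18) (tp k.+1 (c :: CNode cs :: st)).
  apply: (@runs_le _ _ (1 + ((3 * csz c + 1) + (13 + (3 * csz c + 3))))); first lia.
  apply: runs_seq (runs_R _ _ _) _.
  apply: runs_seq (runs_goR (enc_code c) _ (nseq 4 None ++ w)) _.
  apply: runs_seq (runs_line _) _ => //.
  have -> : tp k.+1 (c :: CNode cs :: st) = (None :: nseq k.+1 None,
     B (enc_code c) ++ [:: None, Some true, Some false, Some false, Some false & w]).
    by rewrite /tp !encs_cons [enc_code (CNode _)]enc_body /= -!catA /w /body /= map_cat -catA.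
  exact: (runs_toL (enc_code c) (nseq k.+1 None) None).
have [x [y Exy]] := Ew.
have C1 : scans Fin 1 [:: true; false] (B (mid c) ++ Some true :: Some true :: w)
   (1 + (10 * X + 102) + size (mid c) * (10 * X + 102)).
  apply: (scans_mid (X := X)) => //; first by rewrite /X szc /=; lia.
  apply: (scans_tok (X := X)) => //; first by rewrite Exy.
    by rewrite /X szc /=; lia.
  have -> : ([:: true; false] ++ mid c) ++ [:: true; true] = enc_code c by rewrite Ec.
  by move=> k; exists k; exact: runs_loop0.
have [c2 [w2 Ecw]] : exists c2 w2, B (mid c) ++ Some true :: Some true :: w = c2 :: w2.
  by case: (mid c) => [|? ?]; do 2 eexists.
have [m1 H1] := runs_padL m.-1 None (nseq 5 (None : sym) ++ B (enc_code c) ++ w).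
have [|m2 H2] := @runs_scan m1 0 [::] true false c2 w2; first by [].
have [m3 H3] := C1 m2.
exists m3.+1.
apply: (@runs_le _ _ (9 + (6 + (1 + (2 + (100 + ((1 + (10 * X + 102) + size (mid c) * (10 * X + 102)) + (6 * csz c + 18)))))))).
  by rewrite /X szc; move: (size (mid c)) => s; nia.
have -> : tp m (CNode (c :: cs) :: st) = (nseq m.+1 None,
   [:: Some true, Some false, Some false, Some false & B (enc_code c) ++ w]).
  by rewrite /tp encs_cons enc_body /w /body /= -!catA !map_cat -!catA.
apply: runs_seq (runs_line _) _; first by rewrite Ec.
apply: runs_seq (runs_line _) _; first by rewrite Ec.
have HL := runs_L (nseq m None) None (nseq 4 (None : sym) ++ B (enc_code c) ++ w).
apply: (@runs_seq _ _ _ _ (nseq m.-1 None, None :: nseq 5 None ++ B (enc_code c) ++ w)).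
  by move: HL; rewrite Ec; case: (m) => [|k] HL; exact: HL.
apply: runs_seq H1 _.
apply: (@runs_seq _ _ _ _ (scan_tape m2 1 [:: true; false] (c2 :: w2))).
  by move: H2; rewrite -Ecw /scan_tape Ec /= map_cat -catA.
rewrite -Ecw; exact: runs_seq H3 (Hend _).
Qed.

Lemma stk_split v st : ~~ cisnil v ->
  stk split (v :: st) (2000 * (ssz (v :: st)).+1 * (ssz (v :: st)).+1) (chd v :: ctl v :: st).
Proof.
move=> nv m; case: v nv => [[|b bs]|[|c cs]] // _.
  pose w := B (flatten [seq [:: false; b] | b <- bs] ++ [:: true; true]) ++ None :: encs st ++ [:: None].
  have Ew : w = head None w :: behead w by rewrite /w; case: (flatten _ ++ _).
  have [m' H] := runs_push (B [:: true; false; false; true; false; b; true; true] ++ None ::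
        B [:: true; false; false; true]) (6 + m.+1) (head None w) (behead w).
  rewrite -Ew in H; exists m'.
  have -> : tp m (CLeaf (b :: bs) :: st) = (nseq m.+1 None,
    [:: Some true, Some false, Some false, Some true, Some false, Some b & w]).
    by rewrite /tp encs_cons enc_body /w /= -catA.
  apply: (@runs_le _ _ (4 + (3 + (18 + (2 * 13 + 3)).+2).+2)).
    by rewrite ssz_cons /csz /=; lia.
  apply: runs_seq (runs_line _) _ => //; apply: runs_case.
  apply: runs_seq (runs_line _) _ => //; apply: runs_case.
  have Hb : runs (split_leaf b) (line_act (nseq 2 (Mv MoveR)) (line_act (nseq 3 (Mv MoveR)) (nseq m.+1 None, [:: Some true, Some false, Some false, Some true, Some false, Some b & w]))) (18 + (2 * 13 + 3)) (tp m' (chd (CLeaf (b :: bs)) :: ctl (CLeaf (b :: bs)) :: st)).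
    apply: runs_seq (runs_line _) _; first by rewrite Ew.
    have -> : tp m' (chd (CLeaf (b :: bs)) :: ctl (CLeaf (b :: bs)) :: st) =
      (nseq m'.+1 None, (B [:: true; false; false; true; false; b; true; true] ++ None ::
        B [:: true; false; false; true]) ++ w).
      by rewrite /tp !encs_cons !enc_body /w /= -catA.
    exact: H.
  by move: Hb; case: (b).
have [m' H] := runs_split_node c cs st m.
exists m'; apply: (@runs_le _ _ (4 + (4 + 1000 * (csz c).+1 * (csz c).+1).+2)).
  rewrite !ssz_cons; have : csz c <= csz (CNode (c :: cs)).
    by rewrite /csz [in leqRHS]enc_body /= !size_cat; lia.
  by move: (csz c) (csz (CNode _)) (ssz st) => a d e; nia.
have Em : exists w, tp m (CNode (c :: cs) :: st) = (nseq m.+1 None,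
    [:: Some true, Some false, Some false, Some false & w]).
  by rewrite /tp encs_cons enc_body /=; eexists.
have [w Ew] := Em; rewrite Ew.
apply: runs_seq (runs_line _) _ => //; apply: runs_case.
apply: runs_seq (runs_line _) _ => //.
by move: H; rewrite Ew.
Qed.

(** The header of the node is erased and the top word is shifted five cells right, over its
    separator and the four header cells, so that it lands directly before the other children; the
    header is then written in front. *)
Definition cons_node : prog :=
  line [:: Wr None; Mv MoveL; Wr None; Mv MoveL; Wr None; Mv MoveL; Wr None; Mv MoveL] ;;
  shift ;; Loop goR ;; shift ;; Loop goR ;; shift ;; Loop goR ;; shift ;; Loop goR ;; shift ;;
  push (B [:: true; false; false; false]) ;; padL.

Definition cons : prog :=
  overR ;; line (nseq 3 (Mv MoveR)) ;;
  Case skip cons_node (line (nseq 3 (Mv MoveL)) ;; overL ;; del 0).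

Lemma stk_cons a v st :
  stk cons (a :: v :: st) (1000 * (ssz (a :: v :: st)).+1 * (ssz (a :: v :: st)).+1)
      (ccons a v :: st).
Proof.
move=> m; rewrite !ssz_cons.
set A := enc_code a; set bd := B (body v) ++ None :: encs st ++ [:: None].
have [x [y Exy]] : exists x y, bd = x :: y.
  by rewrite /bd; case: (body v) => [|? ?]; do 2 eexists.
have Et : tp m (a :: v :: st) = (nseq m.+1 None, B A ++ None :: [:: Some true, Some false, Some false, Some (isleaf v) & bd]).
  by rewrite /tp !encs_cons (enc_body v) /bd -!catA /= -?catA.
rewrite Et; case: v @bd x y Exy Et => [bs|cs] bd x y Exy Et.
  have [m' H] := runs_del [::] A m (Some true) [:: Some false, Some false, Some true & bd].
  exists m'; apply: (@runs_le _ _ ((3 * csz a + 2) + (4 + (4 + ((3 * csz a + 4) + 20 * (size A).+1 * 1)).+2))).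
    by rewrite -/(csz a); move: (csz a) (csz _) (ssz st) => sa d e; nia.
  apply: runs_seq (runs_overR _ _ _) _.
  apply: runs_seq (runs_line _) _; first by [].
  apply: runs_case; apply: runs_seq (runs_line _) _ => //.
  apply: runs_seq (runs_overL A (nseq m None) _ _) _.
  have -> : tp m' (ccons a (CLeaf bs) :: st) = (nseq m'.+1 None, [:: Some true, Some false, Some false, Some true & bd]).
    by rewrite /tp encs_cons enc_body /bd /= -catA.
  exact: H.
have [m' H] := runs_push (B [:: true; false; false; false]) (m.+1 + 5) (head None (B A ++ bd)) (behead (B A ++ bd)).
have EA : B A ++ bd = head None (B A ++ bd) :: behead (B A ++ bd) by rewrite Exy; case: (A).
rewrite -EA in H.
exists m'; apply: (@runs_le _ _ ((3 * csz a + 2) + (4 + (9 + ((10 * csz a + 4) + ((3 * csz a + 1) + ((10 * csz a + 4) + ((3 * csz a + 1) + ((10 * csz a + 4) + ((3 * csz a + 1) + ((10 * csz a + 4) + ((3 * csz a + 1) + ((10 * csz a + 4) + 11))))))))))).+2)).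
  by move: (csz a) (csz _) (ssz st) => sa d e; nia.
apply: runs_seq (runs_overR _ _ _) _.
apply: runs_seq (runs_line _) _; first by [].
apply: runs_case; apply: runs_seq (runs_line _) _; first by [].
apply: runs_seq (runs_shift A (nseq m None) (nseq 4 None ++ bd)) _.
apply: runs_seq (runs_goR A _ (nseq 3 None ++ bd)) _.
apply: runs_seq (runs_shift A (nseq m.+1 None) (nseq 3 None ++ bd)) _.
apply: runs_seq (runs_goR A _ (nseq 2 None ++ bd)) _.
apply: runs_seq (runs_shift A (nseq m.+2 None) (nseq 2 None ++ bd)) _.
apply: runs_seq (runs_goR A _ (nseq 1 None ++ bd)) _.
apply: runs_seq (runs_shift A (nseq m.+3 None) (nseq 1 None ++ bd)) _.
apply: runs_seq (runs_goR A _ bd) _.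
apply: runs_seq (runs_shift A (nseq m.+4 None) bd) _.
have -> : tp m' (ccons a (CNode cs) :: st) = (nseq m'.+1 None, B [:: true; false; false; false] ++ B A ++ bd).
  by rewrite /tp encs_cons enc_body /bd /body /= ?map_cat -!catA ?map_cat -?catA /= ?map_cat -?catA.
by move: H; rewrite (_ : m.+1 + 5 = m.+4.+2) //; lia.
Qed.

(** * Expressions and their compilation *)

(* [EWeak] drops the innermost binding and [EClo n] keeps only the [n]
   innermost ones: this makes the value of a subroutine independent of the
   environment of its call. Folds run over the elements of a node or over the
   bits of a leaf. *)
Inductive expr :=
| EVar of nat
| ELit of code
| EHd of expr
| ETl of expr
| EBc of bool & expr
| ECons of expr & expr
| EIfNil of expr & expr & expr
| EIfT of expr & expr & expr
| ELet of nat & expr & expr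
| EFold of nat & nat & expr & expr & expr
| EWeak of expr
| EClo of nat & expr.

Notation nilc := (CNode [::]).
Definition env := seq (nat * code).
Fixpoint lookup (r : env) (x : nat) : code :=
  match r with [::] => nilc | (y, v) :: r => if eqn y x then v else lookup r x end.

Fixpoint eval (e : expr) (r : env) : code :=
  match e with
  | EVar x => lookup r x
  | ELit c => c
  | EHd e => chd (eval e r)
  | ETl e => ctl (eval e r)
  | EBc b e => cbcons b (eval e r)
  | ECons a e => ccons (eval a r) (eval e r)
  | EIfNil e p q => if cisnil (eval e r) then eval p r else eval q r
  | EIfT e p q => if ctrue (eval e r) then eval p r else eval q r
  | ELet x a e => eval e ((x, eval a r) :: r)
  | EFold x y l i s =>
      foldl (fun st u => eval s ((y, st) :: (x, u) :: r)) (eval i r) (elems (eval l r))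
  | EWeak e => eval e (behead r)
  | EClo n e => eval e (take n r)
  end.

Fixpoint fold_cost (C : code -> code -> nat) (S : code -> code -> code) (us : seq code) (st : code) : nat :=
  match us with [::] => 0 | u :: us => C st u + 60 + fold_cost C S us (S st u) end.

(* Bounds both the number of stack operations and the sizes of all
   intermediate values. *)
Fixpoint cost (e : expr) (r : env) : nat :=
  match e with
  | EVar x => (csz (lookup r x)).+1
  | ELit c => (csz c).+1
  | EHd e | ETl e | EBc _ e => cost e r + 20
  | ECons a e => cost a r + cost e r + 20
  | EIfNil e p q => cost e r + 20 + (if cisnil (eval e r) then cost p r else cost q r)
  | EIfT e p q => cost e r + 20 + (if ctrue (eval e r) then cost p r else cost q r)
  | ELet x a e => cost a r + 20 + cost e ((x, eval a r) :: r)
  | EFold x y l i s =>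
      cost i r + 2 * cost l r + 60 +
      fold_cost (fun st u => cost s ((y, st) :: (x, u) :: r))
        (fun st u => eval s ((y, st) :: (x, u) :: r)) (elems (eval l r)) (eval i r)
  | EWeak e => cost e (behead r)
  | EClo n e => cost e (take n r)
  end.

Lemma csz_node cs : csz (CNode cs) = 6 + sumn (map csz cs).
Proof.
rewrite /csz enc_body /= size_cat size_flatten /shape -map_comp.
by rewrite (eq_map (_ : _ =1 csz)) //=; lia.
Qed.
Lemma csz_leaf bs : csz (CLeaf bs) = 6 + 2 * size bs.
Proof.
rewrite /csz enc_body /= size_cat size_flatten /shape -map_comp /=.
by elim: bs => //= b bs; lia.
Qed.
Lemma csz_ge6 v : 6 <= csz v.
Proof. by case: v => x; rewrite ?csz_node ?csz_leaf; lia. Qed.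
(** The 6 is the header and closing token that a bit acquires when it becomes a one-bit leaf. On an
    empty value, head and tail are both the value itself. *)
Lemma csz_hd_tl v : csz (chd v) + csz (ctl v) <= csz v + (if cisnil v then csz v else 6).
Proof.
case: v => [[|b bs]|[|c cs]] //=; rewrite /chd /= ?csz_leaf ?csz_node /= ?csz_leaf ?csz_node; lia.
Qed.
Lemma csz_hd v : csz (chd v) <= csz v.
Proof. by case: v => [[|b bs]|[|c cs]] //=; rewrite /chd /= ?csz_leaf ?csz_node /=; lia. Qed.
Lemma csz_tl v : csz (ctl v) <= csz v.
Proof. by case: v => [[|b bs]|[|c cs]] //=; rewrite ?csz_leaf ?csz_node /=; lia. Qed.
Lemma csz_cons a v : csz (ccons a v) <= csz a + csz v.
Proof. by case: v => [bs|cs] //=; rewrite ?csz_node /=; lia. Qed.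
Lemma csz_bcons b v : csz (cbcons b v) <= csz v + 2.
Proof. by case: v => [bs|cs] //=; rewrite ?csz_leaf /=; lia. Qed.
Lemma elems_tl v : elems (ctl v) = behead (elems v).
Proof. by case: v => [[|b bs]|[|c cs]]. Qed.
Lemma cisnil_tl v : cisnil v -> ctl v = v.
Proof. by case: v => [[|b bs]|[|c cs]]. Qed.

Lemma fold_cost_bound (C : code -> code -> nat) S us st :
  (forall st u, csz (S st u) < C st u) ->
  csz (foldl S st us) <= csz st + fold_cost C S us st.
Proof.
move=> H; elim: us st => [|u us IH] st /=; first by rewrite addn0.
by apply: leq_trans (IH _) _; have := H st u; lia.
Qed.

Lemma csz_eval e r : csz (eval e r) < cost e r.
Proof.
elim: e r => //= [e IH|e IH|b e IH|a IHa e IHe|e IH p IHp q IHq|e IH p IHp q IHq|x a IHa e IHe|x y l IHl i IHi s IHs] r.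
- by have := IH r; have := csz_hd (eval e r); lia.
- by have := IH r; have := csz_tl (eval e r); lia.
- by have := IH r; have := csz_bcons b (eval e r); lia.
- by have := IHa r; have := IHe r; have := csz_cons (eval a r) (eval e r); lia.
- by case: ifP => _; [have := IHp r|have := IHq r]; lia.
- by case: ifP => _; [have := IHp r|have := IHq r]; lia.
- by have := IHe ((x, eval a r) :: r); lia.
- set C := (fun st u => cost s _); set S := (fun st u => eval s _).
  have H := @fold_cost_bound C S (elems (eval l r)) (eval i r) (fun st u => IHs _).
  by have := IHi r; lia.
Qed.

(** Compile-time image of an environment: for each variable the depth of its value in the stack.
    After [k] further values have been pushed it becomes [shiftl k lay]. *)
Definition layout := seq (nat * nat).
Fixpoint look (lay : layout) (x : nat) : option nat :=
  match lay with [::] => None | (y, d) :: lay => if eqn y x then Some d else look lay x end.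
Definition shiftl (k : nat) (lay : layout) : layout := [seq (p.1, k + p.2) | p <- lay].

Fixpoint compile (e : expr) (lay : layout) : prog :=
  match e with
  | EVar x => match look lay x with Some d => pick d | None => lit nilc end
  | ELit c => lit c
  | EHd e => compile e lay ;; ifnil skip (split ;; del 1)
  | ETl e => compile e lay ;; ifnil skip (split ;; del 0)
  | EBc b e => compile e lay ;; bcons b
  | ECons a e => compile e lay ;; compile a (shiftl 1 lay) ;; cons
  | EIfNil e p q => compile e lay ;; ifnil (del 0 ;; compile p lay) (del 0 ;; compile q lay)
  | EIfT e p q => compile e lay ;; iftrue (del 0 ;; compile p lay) (del 0 ;; compile q lay)
  | ELet x a e => compile a lay ;; compile e ((x, 0) :: shiftl 1 lay) ;; del 1
  | EFold x y l i s =>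
      compile i lay ;; compile l (shiftl 1 lay) ;; ifnil goL skip ;;
      Loop (split ;; compile s ((y, 2) :: (x, 0) :: shiftl 3 lay) ;;
            del 3 ;; del 1 ;; pick 1 ;; del 2 ;; ifnil goL skip) ;;
      goR ;; del 0
  | EWeak e => compile e (behead lay)
  | EClo n e => compile e (take n lay)
  end.

(** The environment equals the one read off the layout position by position, rather than merely
    having the same lookups, so that [EWeak] and [EClo] can truncate both lists in parallel. *)
Definition compat (r : env) (lay : layout) (st : seq code) : Prop :=
  r = [seq (p.1, nth nilc st p.2) | p <- lay] /\ all (fun p => p.2 < size st) lay.

Lemma compat_shift r lay s st : compat r lay st -> compat r (shiftl (size s) lay) (s ++ st).
Proof.
case=> -> H; split.
  rewrite /shiftl -map_comp; apply: eq_map => p /=.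
  by rewrite nth_cat ltnNge leq_addr /= addKn.
rewrite all_map; apply: sub_all H => p /=.
by rewrite size_cat ltn_add2l.
Qed.

Lemma compat_look r lay st x d : compat r lay st -> look lay x = Some d ->
  d < size st /\ nth nilc st d = lookup r x.
Proof.
case=> -> {r}; elim: lay => //= [[y d'] lay IH] /= /andP[lt H].
by case: eqnP => [_ [<-]|_]; last exact: IH.
Qed.
Lemma compat_lookN r lay st x : compat r lay st -> look lay x = None -> lookup r x = nilc.
Proof. by case=> -> {r}; elim: lay => //= [[y d'] lay IH] /= /andP[lt H]; case: eqnP => // _; exact: IH. Qed.

Section CompileCorrect.
Variable K : nat.
Hypothesis K30 : 30 <= K.
Hypothesis Hdel : forall s1 v s2 X, ssz (s1 ++ v :: s2) < X ->
  stk (del (size s1)) (s1 ++ v :: s2) (K * X * X) (s1 ++ s2).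
Hypothesis Hpick : forall i st X, i < size st -> ssz st < X ->
  stk (pick i) st (K * X * X) (nth nilc st i :: st).
Hypothesis Hlit : forall c st X, csz c < X -> stk (lit c) st (K * X * X) (c :: st).
Hypothesis Hsplit : forall v st X, ~~ cisnil v -> ssz (v :: st) < X ->
  stk split (v :: st) (K * X * X) (chd v :: ctl v :: st).
Hypothesis Hcons : forall a v st X, ssz (a :: v :: st) < X ->
  stk cons (a :: v :: st) (K * X * X) (ccons a v :: st).

(** [Loop] tests only for a blank, so [ifnil goL skip] translates the emptiness of the list to be
    folded: the head steps onto the margin when nothing is left and otherwise stays on the first
    symbol. *)
Definition tpL (m : nat) (st : seq code) : tape := (nseq m None, None :: encs st ++ [:: None]).
Definition chk (m : nat) (v : code) (st : seq code) : tape :=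
  if cisnil v then tpL m (v :: st) else tp m (v :: st).

Lemma runs_chk m v st : runs (ifnil goL skip) (tp m (v :: st)) 21 (chk m v st).
Proof.
apply: (runs_ifnil (T := 1)); rewrite /chk.
have [c [w E]] := encs_ne (v :: st).
by case: ifP => _; rewrite /tp /tpL E; [exact: (runs_L (nseq m.+1 None))|exact: runs_skip].
Qed.

Variables (x y : nat) (s : expr) (r : env) (lay : layout) (st : seq code) (X : nat).
Hypothesis Hs : forall r lay st, compat r lay st -> ssz st + cost s r < X ->
  stk (compile s lay) st (cost s r * (K * X * X)) (eval s r :: st).
Hypothesis Hlay : compat r lay st.

Let C := fun st u => cost s ((y, st) :: (x, u) :: r).
Let S := fun st u => eval s ((y, st) :: (x, u) :: r).
Definition fold_body : prog :=
  split ;; compile s ((y, 2) :: (x, 0) :: shiftl 3 lay) ;;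
  del 3 ;; del 1 ;; pick 1 ;; del 2 ;; ifnil goL skip.

(** There is no swap: the remaining list is copied above the new state and its old copy deleted. For
    a moment both copies are present, which accounts for [2 * csz lv] here and for the doubled
    [cost l r] of a fold. *)
Lemma runs_fold_body m lv sv : ~~ cisnil lv ->
  ssz st + 2 * csz lv + csz sv + C sv (chd lv) + 30 <= X -> exists m',
  runs fold_body (tp m (lv :: sv :: st)) ((C sv (chd lv) + 6) * (K * X * X))
    (chk m' (ctl lv) (S sv (chd lv) :: st)).
Proof.
move=> nl; set u := chd lv; move=> leX; set t := ctl lv; set res := S sv u.
have Q30 : 30 <= K * X * X by have : 0 < X; [lia|nia].
have lt_res : csz res < C sv u by exact: csz_eval.
have szut : csz u + csz t <= csz lv + 6 by have := csz_hd_tl lv; rewrite (negbTE nl).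
have szt : csz t <= csz lv by exact: csz_tl.
have szu : csz u <= csz lv by exact: csz_hd.
have H1 : stk split [:: lv, sv & st] (K * X * X) [:: u, t, sv & st].
  by apply: Hsplit; rewrite // !ssz_cons; lia.
have H2 : stk (compile s ((y, 2) :: (x, 0) :: shiftl 3 lay)) [:: u, t, sv & st]
    (C sv u * (K * X * X)) [:: res, u, t, sv & st].
  apply: Hs; last by rewrite !ssz_cons; move: leX; rewrite /C; lia.
  have [Er Ha] := compat_shift [:: u; t; sv] Hlay; split; first by rewrite /= {1}Er.
  by rewrite /=.
have H3 : stk (del 3) [:: res, u, t, sv & st] (K * X * X) [:: res, u, t & st].
  by apply: (@Hdel [:: res; u; t]); rewrite !ssz_cons; lia.
have H4 : stk (del 1) [:: res, u, t & st] (K * X * X) [:: res, t & st].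
  by apply: (@Hdel [:: res]); rewrite !ssz_cons; lia.
have H5 : stk (pick 1) [:: res, t & st] (K * X * X) [:: t, res, t & st].
  by have := @Hpick 1 [:: res, t & st] X; rewrite /=; apply=> //; rewrite !ssz_cons; lia.
have H6 : stk (del 2) [:: t, res, t & st] (K * X * X) [:: t, res & st].
  by apply: (@Hdel [:: t; res]); rewrite !ssz_cons; lia.
have [m1 R1] := H1 m; have [m2 R2] := H2 m1; have [m3 R3] := H3 m2.
have [m4 R4] := H4 m3; have [m5 R5] := H5 m4; have [m6 R6] := H6 m5.
exists m6; apply: runs_le (runs_seq R1 (runs_seq R2 (runs_seq R3 (runs_seq R4 (runs_seq R5 (runs_seq R6 (runs_chk _ _ _))))))).
by rewrite -/u; move: (C sv u) (K * X * X) Q30 => c Q; nia.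
Qed.

Lemma runs_fold_loop us : forall lv sv m, elems lv = us ->
  ssz st + 2 * csz lv + csz sv + fold_cost C S us sv + 30 <= X -> exists m' lv',
  [/\ csz lv' <= csz lv, cisnil lv' & runs (Loop fold_body) (chk m lv (sv :: st))
    (fold_cost C S us sv * (K * X * X) + 1) (tpL m' (lv' :: foldl S sv us :: st))].
Proof.
elim: us => [|u us IH] lv sv m Elv leX /=.
  have nl : cisnil lv by rewrite /cisnil Elv.
  exists m, lv; split=> //; rewrite /chk nl; exact: runs_loop0.
have nl : ~~ cisnil lv by rewrite /cisnil Elv.
have Eu : chd lv = u by rewrite /chd Elv.
move: leX => /= leX.
have [|m1 R1] := @runs_fold_body m lv sv nl; first by rewrite Eu; lia.
have lt_res : csz (S sv u) < C sv u by exact: csz_eval.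
have szt : csz (ctl lv) <= csz lv by exact: csz_tl.
have [||m2 [lv' [lle nl' R2]]] := IH (ctl lv) (S sv u) m1.
- by rewrite elems_tl Elv.
- by lia.
rewrite Eu in R1.
exists m2, lv'; split=> //; first by lia.
rewrite {1}/chk (negbTE nl); apply: runs_le (runs_loopS _ R1 R2); last first.
- by rewrite /cur /tp encs_cons enc_body.
have Q30 : 30 <= K * X * X by have : 0 < X; [lia|nia].
by move: (fold_cost _ _ _ _) (C sv u) (K * X * X) Q30 => f c Q; nia.
Qed.
End CompileCorrect.

(** [X] exceeds the present stack plus all cost still to be spent. As values are smaller than their
    cost, every stack met on the way is below [X]; each primitive then takes at most [K * X * X]
    steps, and [cost e r] pays for their number. *)
Theorem compile_ok : exists K, forall e r lay st X, compat r lay st -> ssz st + cost e r < X ->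
  stk (compile e lay) st (cost e r * (K * X * X)) (eval e r :: st).
Proof.
(* The largest constant among the primitives, that of [split]. *)
pose K := 2000; exists K.
have Hdel s1 v s2 X : ssz (s1 ++ v :: s2) < X ->
    stk (del (size s1)) (s1 ++ v :: s2) (K * X * X) (s1 ++ s2).
  have lt : size s1 < size (s1 ++ v :: s2) by rewrite size_cat /=; lia.
  move=> lX; have := stk_del lt; rewrite take_size_cat // drop_cat ltnNge leqnSn /= subSnn /= drop0.
  by apply: stk_le; rewrite !leq_mul.
have Hpick i st X : i < size st -> ssz st < X -> stk (pick i) st (K * X * X) (nth nilc st i :: st).
  by move=> lt lX; apply: stk_le (stk_pick lt); rewrite !leq_mul.
have Hlit c st X : csz c < X -> stk (lit c) st (K * X * X) (c :: st).
  by move=> lX; apply: stk_le (stk_lit c st); rewrite /K; nia.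
have Hsplit v st X : ~~ cisnil v -> ssz (v :: st) < X ->
    stk split (v :: st) (K * X * X) (chd v :: ctl v :: st).
  by move=> nv lX; apply: stk_le (stk_split st nv); rewrite !leq_mul.
have Hcons a v st X : ssz (a :: v :: st) < X ->
    stk cons (a :: v :: st) (K * X * X) (ccons a v :: st).
  by move=> lX; apply: stk_le (stk_cons a v st); rewrite !leq_mul.
have K30 : 30 <= K by [].
(* [K] is made abstract to keep its numeral out of the nonlinear arithmetic; only [30 <= K] is
   kept. *)
move: (K) K30 Hdel Hpick Hlit Hsplit Hcons => {}K K30 Hdel Hpick Hlit Hsplit Hcons.
have Hdel0 v st X : ssz (v :: st) < X -> stk (del 0) (v :: st) (K * X * X) st.
  by move=> lX; apply: (@Hdel [::]).
have Hdel1 w v st X : ssz (w :: v :: st) < X -> stk (del 1) (w :: v :: st) (K * X * X) (w :: st).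
  by move=> lX; apply: (@Hdel [:: w]).
have Q30 X : 0 < X -> 30 <= K * X * X by nia.
elim=> [x|c|e IH|e IH|b e IH|a IHa e IHe|e IH p IHp q IHq|e IH p IHp q IHq|x a IHa e IHe
       |x y l IHl i IHi s IHs|e IH|n e IH] r lay st X Hc ltX /=.
- case El : (look lay x) => [d|].
    have [ltd En] := compat_look Hc El; rewrite -En.
    by apply: stk_le (Hpick _ _ X ltd _); [exact: leq_pmull|move: ltX => /=; lia].
  rewrite (compat_lookN Hc El); apply: stk_le (Hlit nilc st X _); first exact: leq_pmull.
  by move: ltX => /=; rewrite (compat_lookN Hc El); lia.
- by apply: stk_le (Hlit c st X _); [exact: leq_pmull|move: ltX => /=; lia].
- move: ltX => /= ltX; have szv := csz_eval e r; have := Q30 X => {}Q30.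
  have H1 : stk (compile e lay) st (cost e r * (K * X * X)) (eval e r :: st) by apply: IH => //; lia.
  apply: (stk_le _ (stk_seq H1 (stk_ifnil (T := 2 * (K * X * X)) _))).
    by have : 30 <= K * X * X by [apply: Q30; lia]; move: (K * X * X) => Q; nia.
  case: ifPn => nv.
    have -> : chd (eval e r) = eval e r by move: nv; rewrite /cisnil /chd; case: (elems _).
    move=> m; exists m; have [c [w E]] := encs_ne (eval e r :: st); rewrite /tp E.
    by apply: runs_le (runs_skip _ _ _); have : 30 <= K * X * X by [apply: Q30; lia]; lia.
  have szut := csz_hd_tl (eval e r); rewrite (negbTE nv) in szut.
  apply: stk_le (stk_seq (Hsplit _ _ X nv _) (Hdel1 _ _ _ X _)); rewrite ?ssz_cons; lia.
- move: ltX => /= ltX; have szv := csz_eval e r; have := Q30 X => {}Q30.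
  have H1 : stk (compile e lay) st (cost e r * (K * X * X)) (eval e r :: st) by apply: IH => //; lia.
  apply: (stk_le _ (stk_seq H1 (stk_ifnil (T := 2 * (K * X * X)) _))).
    by have : 30 <= K * X * X by [apply: Q30; lia]; move: (K * X * X) => Q; nia.
  case: ifPn => nv.
    rewrite (cisnil_tl nv).
    move=> m; exists m; have [c [w E]] := encs_ne (eval e r :: st); rewrite /tp E.
    by apply: runs_le (runs_skip _ _ _); have : 30 <= K * X * X by [apply: Q30; lia]; lia.
  have szut := csz_hd_tl (eval e r); rewrite (negbTE nv) in szut.
  apply: stk_le (stk_seq (Hsplit _ _ X nv _) (Hdel0 _ _ X _)); rewrite ?ssz_cons; lia.
- move: ltX => /= ltX.
  have H1 : stk (compile e lay) st (cost e r * (K * X * X)) (eval e r :: st) by apply: IH => //; lia.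
  apply: stk_le (stk_seq H1 (stk_bcons b _ st)).
  by have : 30 <= K * X * X by [apply: Q30; lia]; move: (K * X * X) => Q; nia.
- move: ltX => /= ltX; have sza := csz_eval a r; have sze := csz_eval e r.
  have H1 : stk (compile e lay) st (cost e r * (K * X * X)) (eval e r :: st) by apply: IHe => //; lia.
  have H2 : stk (compile a (shiftl 1 lay)) (eval e r :: st) (cost a r * (K * X * X)) (eval a r :: eval e r :: st).
    by apply: IHa; [exact: (compat_shift [:: _])|rewrite ssz_cons; lia].
  apply: stk_le (stk_seq H1 (stk_seq H2 (Hcons _ _ _ X _))).
    by move: (K * X * X) => Q; nia.
  by rewrite !ssz_cons; lia.
- move: ltX => /= ltX; have szv := csz_eval e r.
  have H1 : stk (compile e lay) st (cost e r * (K * X * X)) (eval e r :: st) by apply: IH => //; lia.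
  have H2 : stk (del 0) (eval e r :: st) (K * X * X) st by apply: Hdel0; rewrite ssz_cons; lia.
  have : 30 <= K * X * X by [apply: Q30; lia]; move=> Q.
  case E: (cisnil _) ltX => /= ltX.
  + apply: (stk_le _ (stk_seq H1 (stk_ifnil (T := K * X * X + cost p r * (K * X * X)) _))).
      by move: (K * X * X) Q => Q; nia.
    by rewrite E; apply: stk_seq H2 (IHp _ _ _ X Hc _); lia.
  + apply: (stk_le _ (stk_seq H1 (stk_ifnil (T := K * X * X + cost q r * (K * X * X)) _))).
      by move: (K * X * X) Q => Q; nia.
    by rewrite E; apply: stk_seq H2 (IHq _ _ _ X Hc _); lia.
- move: ltX => /= ltX; have szv := csz_eval e r.
  have H1 : stk (compile e lay) st (cost e r * (K * X * X)) (eval e r :: st) by apply: IH => //; lia.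
  have H2 : stk (del 0) (eval e r :: st) (K * X * X) st by apply: Hdel0; rewrite ssz_cons; lia.
  have : 30 <= K * X * X by [apply: Q30; lia]; move=> Q.
  case E: (ctrue _) ltX => /= ltX.
  + apply: (stk_le _ (stk_seq H1 (stk_iftrue (T := K * X * X + cost p r * (K * X * X)) _))).
      by move: (K * X * X) Q => Q; nia.
    by rewrite E; apply: stk_seq H2 (IHp _ _ _ X Hc _); lia.
  + apply: (stk_le _ (stk_seq H1 (stk_iftrue (T := K * X * X + cost q r * (K * X * X)) _))).
      by move: (K * X * X) Q => Q; nia.
    by rewrite E; apply: stk_seq H2 (IHq _ _ _ X Hc _); lia.
- move: ltX => /= ltX; have sza := csz_eval a r; have sze := csz_eval e ((x, eval a r) :: r).
  have H1 : stk (compile a lay) st (cost a r * (K * X * X)) (eval a r :: st) by apply: IHa => //; lia.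
  have H2 : stk (compile e ((x, 0) :: shiftl 1 lay)) (eval a r :: st)
     (cost e ((x, eval a r) :: r) * (K * X * X)) (eval e ((x, eval a r) :: r) :: eval a r :: st).
    apply: IHe; last by rewrite ssz_cons; lia.
    by have [Er Ha] := compat_shift [:: eval a r] Hc; split; [rewrite /= {2}Er|].
  apply: stk_le (stk_seq H1 (stk_seq H2 (Hdel1 _ _ _ X _))).
    by move: (K * X * X) => Q; nia.
  by rewrite !ssz_cons; lia.
- move: ltX => /=; set C := (fun st u => cost s _); set S := (fun st u => eval s _) => ltX.
  have szi := csz_eval i r; have szl := csz_eval l r.
  have szf := @fold_cost_bound C S (elems (eval l r)) (eval i r) (fun st u => csz_eval _ _).
  have H1 : stk (compile i lay) st (cost i r * (K * X * X)) (eval i r :: st) by apply: IHi => //; lia.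
  have H2 : stk (compile l (shiftl 1 lay)) (eval i r :: st) (cost l r * (K * X * X)) (eval l r :: eval i r :: st).
    by apply: IHl; [exact: (compat_shift [:: _])|rewrite ssz_cons; lia].
  move=> m; have [m1 R1] := H1 m; have [m2 R2] := H2 m1.
  have R3 := runs_chk m2 (eval l r) (eval i r :: st).
  have [|m4 [lv' [szlv nlv R4]]] := @runs_fold_loop K K30 Hdel Hpick Hsplit x y s r lay st X
     (fun r lay st => IHs r lay st X) Hc (elems (eval l r)) (eval l r) (eval i r) m2 erefl.
    by rewrite -/C -/S; lia.
  have R5 : runs goR (tpL m4 (lv' :: foldl S (eval i r) (elems (eval l r)) :: st)) 1
     (tp m4 (lv' :: foldl S (eval i r) (elems (eval l r)) :: st)) by exact: runs_R.
  have [|m6 R6] := @Hdel0 lv' (foldl S (eval i r) (elems (eval l r)) :: st) X _ m4.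
    by rewrite !ssz_cons; lia.
  exists m6; apply: runs_le (runs_seq R1 (runs_seq R2 (runs_seq R3 (runs_seq R4 (runs_seq R5 R6))))).
  rewrite -/C -/S; have : 30 <= K * X * X by [apply: Q30; lia].
  by move: (fold_cost _ _ _ _) (K * X * X) (cost l r) (cost i r) => f Q a b; nia.
- apply: IH ltX; case: Hc => -> Ha.
  by case: (lay) Ha => [|p l] //= /andP[_ Ha]; split.
- apply: IH ltX; case: Hc => -> Ha; rewrite -map_take; split=> //.
  by apply/allP=> p /mem_take; exact: (allP Ha).
Qed.

(** The input tape holds the bare word. Two blanks are added behind it, the separator and the end of
    the stack, and the preceding [goL ;; goR] supplies the margin. *)
Definition norm : prog :=
  Loop goR ;; line [:: Wr None; Mv MoveR; Wr None; Mv MoveL] ;; toL.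

Lemma runs_loopR s l : runs (Loop goR) (l, B s) (3 * size s + 1) (rev (B s) ++ l, [::]).
Proof.
elim: s l => [|b s IH] l /=; first exact: runs_loop0.
rewrite rev_cons cat_rcons; apply: runs_le (runs_loopS _ (runs_R _ _ _) (IH _)) => //; lia.
Qed.

Lemma runs_norm v : runs (goL ;; goR ;; norm) ([::], B (enc_code v)) (6 * csz v + 20) (tp 0 [:: v]).
Proof.
have Et : ([:: None], B (enc_code v) ++ [:: None; None]) = tp 0 [:: v].
  by rewrite /tp encs_cons -catA.
apply: (@runs_le _ _ (1 + (1 + ((3 * csz v + 1) + (5 + (3 * csz v + 3)))))); first lia.
have [b [w Ew]] : exists b w, B (enc_code v) = b :: w by rewrite enc_body; do 2 eexists.
rewrite {1}Ew; apply: runs_seq (runs_L _ _ _) _.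
apply: runs_seq (runs_R _ _ _) _; rewrite -Ew.
apply: runs_seq (runs_loopR _ _) _.
apply: runs_seq (runs_line _) _ => //.
rewrite -Et; exact: (runs_toL (enc_code v) [::]).
Qed.

Definition main_prog (e : expr) : prog := (goL ;; goR ;; norm) ;; compile e [:: (0, 0)].

(** The result lies on top of the stack and is followed by a blank, where [read_word] stops, so the
    input still lying beneath it does not have to be erased. The cube is the number of primitives
    times the square of the size. *)
Theorem main_progP : exists K, forall e v,
  tm_computes_within (tm_of_prog (main_prog e)) (enc_code v) (enc_code (eval e [:: (0, v)]))
    (K * (cost e [:: (0, v)] + csz v + 2) ^ 3).
Proof.
have [K HK] := compile_ok; exists (K + 30) => e v.
set c := cost e _; set X := c + csz v + 2.
have [||m [n len Hn]] := HK e [:: (0, v)] [:: (0, 0)] [:: v] X _ _ 0.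
- by [].
- by rewrite ssz_cons /ssz /encs /eb /= -/c /X; lia.
have [n1 len1 Hn1] := runs_norm v.
have ne : enc_code v != [::] by rewrite enc_body.
have [] := tm_of_progP (p := main_prog e) ne (ExSeq Hn1 Hn) (y := enc_code (eval e [:: (0, v)])).
  rewrite encs_cons -catA; set w := enc_code (eval _ _); set z := _ ++ [:: None].
  have -> : head None (B w ++ z) :: behead (B w ++ z) = B w ++ z by rewrite /w enc_body.
  by rewrite /z /=; elim: (w) => //= b w' ->.
move=> t [let' H]; exists t; split=> //; apply: leq_trans let' _.
rewrite -/c in len; rewrite /expn /=.
have : n1 + n <= 6 * csz v + 20 + c * (K * X * X) by lia.
have hX : 6 * csz v + 20 + 2 <= 30 * X by rewrite /X; lia.
have cX : c <= X by rewrite /X; lia.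
have X1 : 1 <= X by rewrite /X; lia.
clearbody c X; move=> H1.
have : c * (K * X * X) <= K * (X * (X * X)) by nia.
have : 30 * X <= 30 * (X * (X * X)) by nia.
by rewrite mulnDl; lia.
Qed.

(** * Polynomial cost *)

(** The base is at least 2, so that constant factors and summands are absorbed by the exponent. *)
Definition poly (T : Type) (m f : T -> nat) : Prop := exists c, forall x, f x <= (m x + 2) ^ c.

Lemma exp_mono a b n : a <= b -> a ^ n <= b ^ n.
Proof. by case: n => // n; rewrite leq_exp2r. Qed.

Section Poly.
Variables (T : Type) (m : T -> nat).
Implicit Types f g : T -> nat.

Lemma poly_le f g : (forall x, f x <= g x) -> poly m g -> poly m f.
Proof. by move=> H [c Hc]; exists c => x; apply: leq_trans (H x) (Hc x). Qed.

Lemma poly_const n : poly m (fun=> n).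
Proof.
exists n => x; apply: leq_trans (ltnW (ltn_expl n (ltnSn 1))) _.
by apply: exp_mono; lia.
Qed.

Lemma poly_id : poly m m.
Proof. by exists 1 => x; rewrite expn1; lia. Qed.

Lemma poly_mul f g : poly m f -> poly m g -> poly m (fun x => f x * g x).
Proof. by move=> [c Hc] [d Hd]; exists (c + d) => x; rewrite expnD leq_mul. Qed.

Lemma poly_add f g : poly m f -> poly m g -> poly m (fun x => f x + g x).
Proof.
move=> [c Hc] [d Hd]; exists (c + d).+1 => x; have := Hc x; have := Hd x.
rewrite expnS expnD; have: 0 < (m x + 2) ^ c by rewrite expn_gt0; lia.
have: 0 < (m x + 2) ^ d by rewrite expn_gt0; lia.
move: (_ ^ c) (_ ^ d) => a b; nia.
Qed.

Lemma poly_exp f n : poly m f -> poly m (fun x => f x ^ n).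
Proof.
by move=> [c Hc]; exists (c * n) => x; rewrite expnM exp_mono.
Qed.

Lemma poly_comp f g : (exists c, forall x, f x <= (g x + 2) ^ c) -> poly m g -> poly m f.
Proof.
move=> [c Hc] Hg; apply: (@poly_le _ (fun x => (g x + 2) ^ c)) => //.
by apply: poly_exp; apply: poly_add => //; exact: poly_const.
Qed.
End Poly.

Definition esz (r : env) : nat := sumn [seq csz p.2 | p <- r].
Definition polye (e : expr) : Prop := poly esz (cost e).

Lemma csz_lookup r x : csz (lookup r x) <= esz r + 6.
Proof. by elim: r => [|[y v] r IH] //=; rewrite /esz /= -/(esz r); case: ifP => _; lia. Qed.

Lemma esz_take n r : esz (take n r) <= esz r.
Proof. by elim: r n => [|p r IH] [|n] //=; rewrite /esz /= leq_add2l; exact: IH. Qed.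
Lemma esz_behead r : esz (behead r) <= esz r.
Proof. by case: r => //= p r; exact: leq_addl. Qed.

Lemma polye_var x : polye (EVar x).
Proof.
apply: (@poly_le _ _ _ (fun r => esz r + 7)) => [r|]; first by have := csz_lookup r x => /=; lia.
by apply: poly_add; [exact: poly_id|exact: poly_const].
Qed.
Lemma polye_lit c : polye (ELit c).
Proof. exact: poly_const. Qed.
Lemma polye_hd e : polye e -> polye (EHd e).
Proof. by move=> H; apply: poly_add => //; exact: poly_const. Qed.
Lemma polye_tl e : polye e -> polye (ETl e).
Proof. by move=> H; apply: poly_add => //; exact: poly_const. Qed.
Lemma polye_bc b e : polye e -> polye (EBc b e).
Proof. by move=> H; apply: poly_add => //; exact: poly_const. Qed.
Lemma polye_cons a e : polye a -> polye e -> polye (ECons a e).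
Proof. by move=> Ha He; apply: poly_add; [exact: poly_add|exact: poly_const]. Qed.
Lemma polye_ifnil e p q : polye e -> polye p -> polye q -> polye (EIfNil e p q).
Proof.
move=> He Hp Hq; apply: (@poly_le _ _ _ (fun r => cost e r + 20 + (cost p r + cost q r))).
  by move=> r /=; case: ifP => _; lia.
by apply: poly_add; apply: poly_add => //; exact: poly_const.
Qed.
Lemma polye_ift e p q : polye e -> polye p -> polye q -> polye (EIfT e p q).
Proof.
move=> He Hp Hq; apply: (@poly_le _ _ _ (fun r => cost e r + 20 + (cost p r + cost q r))).
  by move=> r /=; case: ifP => _; lia.
by apply: poly_add; apply: poly_add => //; exact: poly_const.
Qed.

Lemma poly_csz e : polye e -> poly esz (fun r => csz (eval e r)).
Proof. by apply: poly_le => r; apply: ltnW; exact: csz_eval. Qed.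

Lemma polye_let x a e : polye a -> polye e -> polye (ELet x a e).
Proof.
move=> Ha [c Hc]; apply: poly_add; first by apply: poly_add => //; exact: poly_const.
apply: (@poly_comp _ _ _ (fun r => csz (eval a r) + esz r)); first by exists c => r; exact: Hc.
by apply: poly_add; [exact: poly_csz|exact: poly_id].
Qed.
Lemma polye_weak e : polye e -> polye (EWeak e).
Proof.
move=> [c Hc]; exists c => r /=; apply: leq_trans (Hc _) _.
by rewrite exp_mono // leq_add2r esz_behead.
Qed.
Lemma polye_clo n e : polye e -> polye (EClo n e).
Proof.
move=> [c Hc]; exists c => r /=; apply: leq_trans (Hc _) _.
by rewrite exp_mono // leq_add2r esz_take.
Qed.

Lemma size_elems v : size (elems v) <= csz v.
Proof.
case: v => [bs|cs] /=; rewrite ?size_map ?csz_leaf ?csz_node; first by lia.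
by elim: cs => //= c cs; have := csz_ge6 c; lia.
Qed.

(* An element of a leaf is a one-bit leaf, hence the maximum with 8. *)
Lemma csz_foldl_step (P : code -> Prop) (S : code -> code -> code) v st k :
  P st -> (forall st u, P st -> csz u <= csz v -> P (S st u) /\ csz (S st u) <= csz st + k) ->
  forall t, P (foldl S st (take t (elems v))) /\
    csz (foldl S st (take t (elems v))) <= csz st + csz v * k.
Proof.
move=> Pst HS t.
have Hall : forall us, (forall us1 u us2, us = us1 ++ u :: us2 -> csz u <= csz v) ->
   P (foldl S st us) /\ csz (foldl S st us) <= csz st + size us * k.
  elim/last_ind => [|us u IH] Hus; first by split=> //; rewrite addn0.
  have [|HP Hk] := IH; first by move=> us1 w us2 E; apply: (Hus us1 w (rcons us2 u)); rewrite E rcons_cat.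
  have lu : csz u <= csz v by apply: (Hus us u [::]); rewrite cats1.
  have [HP' Hk'] := HS _ u HP lu.
  by rewrite foldl_rcons size_rcons; split=> //; lia.
have Hel us1 u us2 : elems v = us1 ++ u :: us2 -> csz u <= csz v.
  case: v {HS Hall} => [bs|cs] /=.
    elim: bs us1 => [|b bs IH] [|w us1] //= [].
      by move=> <- _; rewrite !csz_leaf /=; lia.
    by move=> _ /IH; rewrite !csz_leaf /=; lia.
  move=> ->; rewrite csz_node map_cat sumn_cat /=; lia.
have [|HP Hk] := Hall (take t (elems v)).
  move=> us1 u us2 E; apply: (Hel us1 u (us2 ++ drop t (elems v))).
  by rewrite -[LHS](cat_take_drop t) E -catA.
split=> //; apply: leq_trans Hk _; rewrite leq_add2l leq_mul2r.
by rewrite size_take; have := size_elems v; case: ifP; lia.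
Qed.

Lemma fold_cost_le (C : code -> code -> nat) S us st k :
  (forall t, C (foldl S st (take t us)) (nth nilc us t) <= k) ->
  fold_cost C S us st <= size us * (k + 60).
Proof.
elim: us st => //= u us IH st H.
have := H 0 => /=; have := IH (S st u) (fun t => H t.+1); lia.
Qed.

Lemma csz_nth_elems v t : csz (nth nilc (elems v) t) <= csz v.
Proof.
case: v => [bs|cs] /=.
  case: (ltnP t (size bs)) => H; first by rewrite (nth_map false) // !csz_leaf /=; lia.
  by rewrite nth_default ?size_map // csz_node csz_leaf /=; lia.
rewrite csz_node; elim: cs t => [|c cs IH] [|t] //=; rewrite ?csz_node /=; try lia.
by apply: leq_trans (IH t) _; lia.
Qed.

(** The number of steps is at most the size of the list, so only the size of the states after each
    prefix has to be controlled; the cost of a step is polynomial in it. Without this hypothesis a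
    state could double at each step. *)
Lemma polye_fold_bound x y l i s : polye l -> polye i -> polye s ->
  (exists c, forall r t, csz (foldl (fun st u => eval s ((y, st) :: (x, u) :: r)) (eval i r)
      (take t (elems (eval l r)))) <= (esz r + 2) ^ c) ->
  polye (EFold x y l i s).
Proof.
move=> Hl Hi [c Hc] [d Hd].
pose k r := ((esz r + 2) ^ d + csz (eval l r) + esz r + 2) ^ c.
have Hk : poly esz k.
  apply: poly_exp; apply: poly_add; last exact: poly_const.
  apply: poly_add; last exact: poly_id.
  by apply: poly_add; [exists d|exact: poly_csz].
apply: (@poly_le _ _ _ (fun r => cost i r + 2 * cost l r + 60 + csz (eval l r) * (k r + 60))).
  move=> r /=; rewrite leq_add2l.
  apply: leq_trans (@fold_cost_le _ _ _ _ (k r) _) _; last by rewrite leq_mul2r size_elems orbT.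
  move=> t; apply: leq_trans (Hc _) _; apply: exp_mono; rewrite leq_add2r /esz /= -/(esz r).
  by have := Hd r t; have := csz_nth_elems (eval l r) t; lia.
apply: poly_add.
  apply: poly_add; last exact: poly_const.
  by apply: poly_add => //; apply: poly_mul => //; exact: poly_const.
apply: poly_mul; first exact: poly_csz.
by apply: poly_add => //; exact: poly_const.
Qed.

(** The usual way to control the states: each step adds an amount depending on the element and the
    environment but not on the state. The invariant [P] serves steps that grow this slowly on states
    of one shape only. *)
Lemma polye_fold_inv (P : code -> Prop) x y l i s : polye l -> polye i -> polye s ->
  (forall r, P (eval i r)) ->
  (exists c, forall r v u, P v ->
     let v' := eval s ((y, v) :: (x, u) :: r) in
     P v' /\ csz v' <= csz v + (csz u + esz r + 2) ^ c) ->
  polye (EFold x y l i s).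
Proof.
move=> Hl Hi Hs P0 [c Hc]; apply: polye_fold_bound => //.
suff [d Hd] : poly esz (fun r => csz (eval i r) + csz (eval l r) * (csz (eval l r) + esz r + 2) ^ c).
  exists d => r t; apply: leq_trans (Hd r).
  have [||_ //] := @csz_foldl_step P (fun st u => eval s ((y, st) :: (x, u) :: r)) (eval l r) (eval i r) ((csz (eval l r) + esz r + 2) ^ c) _ _ t; first exact: P0.
  move=> st u Pst le; have [P' H'] := Hc r st u Pst; split=> //.
  by apply: leq_trans H' _; rewrite leq_add2l exp_mono //; lia.
apply: poly_add; first exact: poly_csz.
apply: poly_mul; first exact: poly_csz.
apply: poly_exp; apply: poly_add; last exact: poly_const.
by apply: poly_add; [exact: poly_csz|exact: poly_id].
Qed.

Lemma polye_fold_add x y l i s c : polye l -> polye i -> polye s ->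
  (forall r v u, csz (eval s ((y, v) :: (x, u) :: r)) <= csz v + (csz u + esz r + 2) ^ c) ->
  polye (EFold x y l i s).
Proof.
move=> Hl Hi Hs H; apply: (polye_fold_inv (P := fun=> True)) => //.
by exists c => r v u _; split.
Qed.

(** Parameters are the variables 0, 1, and so on. They are bound from the last to the first, each
    [EWeak] hiding a parameter already bound so that every argument is evaluated in the environment
    of the caller. *)
Definition ECall1 (F a : expr) : expr := ELet 0 a (EClo 1 F).
Definition ECall2 (F a b : expr) : expr := ELet 1 b (ELet 0 (EWeak a) (EClo 2 F)).
Definition ECall3 (F a b c : expr) : expr :=
  ELet 2 c (ELet 1 (EWeak b) (ELet 0 (EWeak (EWeak a)) (EClo 3 F))).
Definition ECall4 (F a b c d : expr) : expr :=
  ELet 3 d (ELet 2 (EWeak c) (ELet 1 (EWeak (EWeak b)) (ELet 0 (EWeak (EWeak (EWeak a))) (EClo 4 F)))).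
Definition ECall5 (F a b c d e : expr) : expr :=
  ELet 4 e (ELet 3 (EWeak d) (ELet 2 (EWeak (EWeak c)) (ELet 1 (EWeak (EWeak (EWeak b)))
   (ELet 0 (EWeak (EWeak (EWeak (EWeak a)))) (EClo 5 F))))).

Lemma eval_call1 F a r : eval (ECall1 F a) r = eval F [:: (0, eval a r)].
Proof. by rewrite /= take0. Qed.
Lemma eval_call2 F a b r : eval (ECall2 F a b) r = eval F [:: (0, eval a r); (1, eval b r)].
Proof. by rewrite /= take0. Qed.
Lemma eval_call3 F a b c r :
  eval (ECall3 F a b c) r = eval F [:: (0, eval a r); (1, eval b r); (2, eval c r)].
Proof. by rewrite /= take0. Qed.
Lemma eval_call4 F a b c d r : eval (ECall4 F a b c d) r =
  eval F [:: (0, eval a r); (1, eval b r); (2, eval c r); (3, eval d r)].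
Proof. by rewrite /= take0. Qed.
Lemma eval_call5 F a b c d e r : eval (ECall5 F a b c d e) r =
  eval F [:: (0, eval a r); (1, eval b r); (2, eval c r); (3, eval d r); (4, eval e r)].
Proof. by rewrite /= take0. Qed.

Create HintDb pe.
#[export] Hint Resolve polye_var polye_lit polye_hd polye_tl polye_bc polye_cons polye_ifnil
  polye_ift polye_let polye_weak polye_clo : pe.

Lemma polye_call1 F a : polye F -> polye a -> polye (ECall1 F a).
Proof. rewrite /ECall1; auto 20 with pe. Qed.
Lemma polye_call2 F a b : polye F -> polye a -> polye b -> polye (ECall2 F a b).
Proof. rewrite /ECall2; auto 20 with pe. Qed.
Lemma polye_call3 F a b c : polye F -> polye a -> polye b -> polye c -> polye (ECall3 F a b c).
Proof. rewrite /ECall3; auto 20 with pe. Qed.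
Lemma polye_call4 F a b c d : polye F -> polye a -> polye b -> polye c -> polye d ->
  polye (ECall4 F a b c d).
Proof. rewrite /ECall4; auto 20 with pe. Qed.
Lemma polye_call5 F a b c d e : polye F -> polye a -> polye b -> polye c -> polye d -> polye e ->
  polye (ECall5 F a b c d e).
Proof. rewrite /ECall5; auto 20 with pe. Qed.
#[export] Hint Resolve polye_call1 polye_call2 polye_call3 polye_call4 polye_call5 : pe.

(** * Lists, numbers and circuits in the expression language *)

(* Locking keeps [rewrite] from unfolding the subroutines. *)
Fact expr_key : unit. Proof. exact: tt. Qed.
Definition lock_e (e : expr) : expr := locked_with expr_key e.
Lemma lock_eE e : lock_e e = e. Proof. exact: unlock. Qed.

Arguments eval : simpl never.
Arguments cost : simpl never.
Notation V := EVar.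
Notation ENil := (ELit nilc).
Notation cT := (CLeaf [:: true]).
Notation cF := (CLeaf [::]).
Notation ET := (ELit cT).
Notation EF := (ELit cF).
Definition EFst (e : expr) : expr := EHd e.
Definition ESnd (e : expr) : expr := EHd (ETl e).
Definition EThd (e : expr) : expr := EHd (ETl (ETl e)).
Definition EPair (a b : expr) : expr := ECons a (ECons b ENil).
Definition ETriple (a b c : expr) : expr := ECons a (EPair b c).

Lemma eval_var x r : eval (V x) r = lookup r x. Proof. by []. Qed.
Lemma eval_lit c r : eval (ELit c) r = c. Proof. by []. Qed.
Lemma eval_hd e r : eval (EHd e) r = chd (eval e r). Proof. by []. Qed.
Lemma eval_tl e r : eval (ETl e) r = ctl (eval e r). Proof. by []. Qed.
Lemma eval_bc b e r : eval (EBc b e) r = cbcons b (eval e r). Proof. by []. Qed.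
Lemma eval_cons a e r : eval (ECons a e) r = ccons (eval a r) (eval e r). Proof. by []. Qed.
Lemma eval_ifnil e p q r :
  eval (EIfNil e p q) r = if cisnil (eval e r) then eval p r else eval q r. Proof. by []. Qed.
Lemma eval_ift e p q r :
  eval (EIfT e p q) r = if ctrue (eval e r) then eval p r else eval q r. Proof. by []. Qed.
Lemma eval_let x a e r : eval (ELet x a e) r = eval e ((x, eval a r) :: r). Proof. by []. Qed.
Lemma eval_weak e p r : eval (EWeak e) (p :: r) = eval e r. Proof. by []. Qed.
Lemma eval_fst e r : eval (EFst e) r = chd (eval e r). Proof. by []. Qed.
Lemma eval_snd e r : eval (ESnd e) r = chd (ctl (eval e r)). Proof. by []. Qed.
Lemma eval_thd e r : eval (EThd e) r = chd (ctl (ctl (eval e r))). Proof. by []. Qed.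
Lemma eval_pair a b r : eval (EPair a b) r = CNode [:: eval a r; eval b r]. Proof. by []. Qed.
Lemma eval_triple a b c r : eval (ETriple a b c) r = CNode [:: eval a r; eval b r; eval c r].
Proof. by []. Qed.
Definition evalE := (eval_var, eval_lit, eval_hd, eval_tl, eval_bc, eval_cons, eval_ifnil,
  eval_ift, eval_let, eval_weak, eval_fst, eval_snd, eval_thd, eval_pair, eval_triple, eval_call1,
  eval_call2, eval_call3, eval_call4, eval_call5).
Lemma eval_fold x y l i s r : eval (EFold x y l i s) r =
  foldl (fun st u => eval s ((y, st) :: (x, u) :: r)) (eval i r) (elems (eval l r)).
Proof. by []. Qed.

Lemma polye_fst e : polye e -> polye (EFst e). Proof. exact: polye_hd. Qed.
Lemma polye_snd e : polye e -> polye (ESnd e). Proof. rewrite /ESnd; auto with pe. Qed.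
Lemma polye_thd e : polye e -> polye (EThd e). Proof. rewrite /EThd; auto with pe. Qed.
Lemma polye_pair a b : polye a -> polye b -> polye (EPair a b). Proof. rewrite /EPair; auto with pe. Qed.
Lemma polye_triple a b c : polye a -> polye b -> polye c -> polye (ETriple a b c).
Proof. rewrite /ETriple /EPair; auto with pe. Qed.
#[export] Hint Resolve polye_fst polye_snd polye_thd polye_pair polye_triple : pe.

Lemma csz_hd_tl6 v : csz (chd v) + csz (ctl v) <= csz v + 6.
Proof.
have := csz_hd_tl v; case: ifP => // nv _.
by case: v nv => [[|b bs]|[|c cs]] //= _; rewrite /chd /= ?csz_leaf ?csz_node /=; lia.
Qed.

Lemma csz_nodeS a l : csz (CNode (a :: l)) = csz a + csz (CNode l).
Proof. by rewrite !csz_node /=; lia. Qed.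

Lemma affine_bound k n : k * n + k <= (n + 2) ^ k.+1.
Proof.
have H : k <= (n + 2) ^ k.
  by apply: leq_trans (ltnW (ltn_expl k (ltnSn 1))) _; apply: exp_mono; lia.
by rewrite expnS; move: (_ ^ k) H => p H; nia.
Qed.

Lemma polye_fold_aff k x y l i s : polye l -> polye i -> polye s ->
  (forall r v u, csz (eval s ((y, v) :: (x, u) :: r)) <= csz v + k * (csz u + esz r) + k) ->
  polye (EFold x y l i s).
Proof.
move=> Hl Hi Hs H; apply: (polye_fold_add (c := k.+1)) => // r v u.
by apply: leq_trans (H r v u) _; rewrite -addnA leq_add2l affine_bound.
Qed.

(** * Lists, selection by a binary index, and arithmetic on binary words *)

Definition rev_e : expr := EFold 10 11 (V 0) ENil (ECons (V 10) (V 11)).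
Lemma foldl_ccons a l : foldl (fun st u => ccons u st) (CNode a) l = CNode (catrev l a).
Proof. by elim: l a => //= u l IH a. Qed.
Lemma eval_rev v r : eval rev_e ((0, v) :: r) = CNode (rev (elems v)).
Proof. exact: (foldl_ccons [::]). Qed.
Lemma polye_rev : polye rev_e.
Proof.
apply: (polye_fold_aff (k := 1)); auto with pe.
by move=> r v u; rewrite !evalE /=; have := csz_cons u v; lia.
Qed.
#[export] Hint Resolve polye_rev : pe.

Definition map_e (x : nat) (F l : expr) : expr :=
  EFold x 99 (ECall1 rev_e l) ENil (ECons (EWeak F) (V 99)).
Lemma eval_map x F l r :
  eval (map_e x F l) r = CNode [seq eval F ((x, u) :: r) | u <- elems (eval l r)].
Proof.
rewrite /map_e eval_fold !evalE eval_rev /= foldl_rev.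
by elim: (elems _) => //= u us ->.
Qed.
Lemma polye_map x F l : polye F -> polye l -> polye (map_e x F l).
Proof.
move=> HF Hl; have [c Hc] := HF; apply: (polye_fold_add (c := c)); auto with pe.
move=> r v u; rewrite !evalE /=; apply: leq_trans (csz_cons _ _) _.
rewrite addnC leq_add2l; apply: leq_trans (ltnW (csz_eval _ _)) (leq_trans (Hc _) _).
by rewrite /esz.
Qed.

#[export] Hint Resolve polye_map : pe.

Definition filter_e (F l : expr) : expr :=
  EFold 98 99 (ECall1 rev_e l) ENil (EIfT (EWeak F) (ECons (V 98) (V 99)) (V 99)).
Lemma eval_filter F l r :
  eval (filter_e F l) r = CNode [seq u <- elems (eval l r) | ctrue (eval F ((98, u) :: r))].
Proof.
rewrite /filter_e eval_fold !evalE eval_rev /= foldl_rev.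
elim: (elems _) => //= u us ->; rewrite !evalE.
by case: ifP => // _; rewrite !evalE.
Qed.
Lemma polye_filter F l : polye F -> polye l -> polye (filter_e F l).
Proof.
move=> HF Hl; apply: (polye_fold_aff (k := 1)); auto with pe.
move=> r v u; rewrite !evalE; case: ifP => _; rewrite /=; last lia.
by have := csz_cons u v; lia.
Qed.
#[export] Hint Resolve polye_filter : pe.

(** Reversing twice turns a leaf into the node of its one-bit elements; this matters because [ECons]
    onto a leaf does nothing. *)
Definition cat_e : expr :=
  EFold 10 11 (ECall1 rev_e (V 0)) (ECall1 rev_e (ECall1 rev_e (V 1))) (ECons (V 10) (V 11)).
Lemma eval_cat a b r : eval cat_e ((0, a) :: (1, b) :: r) = CNode (elems a ++ elems b).
Proof.
rewrite /cat_e eval_fold !evalE !eval_rev /= revK.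
by rewrite (foldl_ccons (elems b)) catrevE revK.
Qed.
Lemma polye_cat : polye cat_e.
Proof.
apply: (polye_fold_aff (k := 1)); auto with pe.
by move=> r v u; rewrite !evalE /=; have := csz_cons u v; lia.
Qed.
#[export] Hint Resolve polye_cat : pe.

(** Elements at even and at odd positions. To select by a binary index, its lowest bit chooses one
    half and the other bits select within it; decoding the index to unary, which could take
    exponential time, is avoided. *)
Fixpoint eo (T : Type) (l : seq T) : seq T * seq T :=
  match l with [::] => ([::], [::]) | u :: l => (u :: (eo l).2, (eo l).1) end.
Lemma nth_eo (T : Type) (d : T) l j :
  nth d (eo l).1 j = nth d l j.*2 /\ nth d (eo l).2 j = nth d l j.*2.+1.
Proof.
elim: l j => [|u l IH] j /=; first by rewrite !nth_nil.
by split; [case: j => //= j; case: (IH j)|case: (IH j)].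
Qed.

Definition eo_e : expr :=
  EFold 10 11 (ECall1 rev_e (V 0)) (ELit (CNode [:: nilc; nilc]))
    (EPair (ECons (V 10) (ESnd (V 11))) (EFst (V 11))).
Lemma eval_eo v r :
  eval eo_e ((0, v) :: r) = CNode [:: CNode (eo (elems v)).1; CNode (eo (elems v)).2].
Proof.
rewrite /eo_e eval_fold !evalE eval_rev /= foldl_rev.
by elim: (elems v) => //= u us ->.
Qed.
Lemma polye_eo : polye eo_e.
Proof.
apply: (polye_fold_aff (k := 20)); auto 10 with pe.
move=> r v u; rewrite !evalE /= csz_node /=.
have := csz_cons u (chd (ctl v)); have := csz_hd_tl6 v; have := csz_hd (ctl v).
by have := csz_ge6 u; lia.
Qed.
#[export] Hint Resolve polye_eo : pe.

Definition tb (v : code) : seq bool := map ctrue (elems v).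
Lemma tb_leaf bs : tb (CLeaf bs) = bs.
Proof. by rewrite /tb /= -map_comp -[RHS]map_id; apply: eq_map => -[]. Qed.

Definition nth_step : expr :=
  EIfT (V 10) (ESnd (ECall1 eo_e (V 11))) (EFst (ECall1 eo_e (V 11))).
Definition nth_e : expr := lock_e
 (ELet 3 (EFold 10 11 (V 1) (ECall1 rev_e (ECall1 rev_e (V 0))) nth_step)
   (EIfNil (V 3) (V 2) (EHd (V 3)))).

Lemma nth_foldl_eo (T : Type) (d : T) bs l j :
  nth d (foldl (fun l (b : bool) => if b then (eo l).2 else (eo l).1) l bs) j
  = nth d l (j * 2 ^ size bs + nat_of_bits bs).
Proof.
elim: bs l j => [|b bs IH] l j /=; first by rewrite muln1 addn0.
rewrite IH expnS; case: b; rewrite ?(nth_eo _ _ _).1 ?(nth_eo _ _ _).2; congr nth;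
  rewrite -/(nat_of_bits bs) /=; lia.
Qed.

Lemma eval_nth l i d r :
  eval nth_e ((0, l) :: (1, i) :: (2, d) :: r) = nth d (elems l) (nat_of_bits (tb i)).
Proof.
rewrite /nth_e lock_eE eval_let; set w := eval (EFold _ _ _ _ _) _.
have Ew : w = CNode (foldl (fun l (b : bool) => if b then (eo l).2 else (eo l).1) (elems l) (tb i)).
  rewrite /w eval_fold !evalE !eval_rev /= revK /tb.
  elim: (elems i) (elems l) => //= u us IH s; rewrite /nth_step !evalE !eval_eo /=.
  by rewrite -IH; case: ifP.
have := nth_foldl_eo d (tb i) (elems l) 0; rewrite mul0n add0n => <-.
by rewrite Ew !evalE /=; case: (foldl _ _ _).
Qed.

Lemma sumn_eo l : sumn (map csz (eo l).1) + sumn (map csz (eo l).2) = sumn (map csz l).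
Proof. by elim: l => //= u l <-; lia. Qed.

Lemma polye_nth : polye nth_e.
Proof.
suff H : polye (EFold 10 11 (V 1) (ECall1 rev_e (ECall1 rev_e (V 0))) nth_step).
  by rewrite /nth_e lock_eE; auto 10 with pe.
(* On nodes the state only shrinks; on a leaf each bit would become a code of eight symbols, hence
   the invariant. *)
apply: (polye_fold_inv (P := fun v => ~~ isleaf v)); rewrite /nth_step; auto 10 with pe.
  by move=> r; rewrite !evalE !eval_rev.
exists 1 => r v u Pv; rewrite !evalE !eval_eo.
case: v Pv => // cs _ /=; have := sumn_eo cs.
by case: ifP => _; rewrite /= !csz_node; split=> //; lia.
Qed.
#[export] Hint Resolve polye_nth : pe.

(** Any fuel that is at least the number gives the same bits, so the recursive call with leftover
    fuel is again a [bin]. *)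
Lemma binE n : bin n.+1 = odd n.+1 :: bin (n.+1)./2.
Proof.
have H f g m : m <= f -> m <= g -> bin_aux f m = bin_aux g m.
  elim: f g m => [|f IH] [|g] [|m] //= lf lg; congr (_ :: _).
  by apply: IH; rewrite /= ?uphalfE; lia.
rewrite /bin /=; congr (_ :: _); apply: H => //; lia.
Qed.

Arguments bin : simpl never.
Fixpoint incb (c : bool) (s : seq bool) : seq bool :=
  match s with
  | [::] => if c then [:: true] else [::]
  | b :: s => (b (+) c) :: incb (b && c) s
  end.
Lemma incb0 s : incb false s = s.
Proof. by elim: s => //= b s IH; rewrite addbF andbF IH. Qed.
Lemma bin_inc n : incb true (bin n) = bin n.+1.
Proof.
elim/ltn_ind: n => -[|n] IH //; rewrite [RHS]binE [in LHS]binE.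
case E: (odd n.+1); rewrite [incb _ _]/=.
  by rewrite IH; [congr (_ :: bin _)|]; move: E => /=; lia.
by rewrite incb0; congr (_ :: bin _); move: E => /=; lia.
Qed.

Definition lrev_e : expr := EFold 10 11 (V 0) (ELit (CLeaf [::])) (EIfT (V 10) (EBc true (V 11)) (EBc false (V 11))).
Lemma eval_lrev v r : eval lrev_e ((0, v) :: r) = CLeaf (rev (tb v)).
Proof.
rewrite /lrev_e eval_fold !evalE /= /tb.
suff H us s : foldl (fun st u => eval (EIfT (V 10) (EBc true (V 11)) (EBc false (V 11))) ((11, st) :: (10, u) :: (0, v) :: r)) (CLeaf s) us
   = CLeaf (catrev (map ctrue us) s) by rewrite H.
elim: us s => //= u us IH s; rewrite !evalE /=.
by case: ifP => _; rewrite IH.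
Qed.
Lemma polye_lrev : polye lrev_e.
Proof.
apply: (polye_fold_aff (k := 2)); auto with pe.
by move=> r v u; rewrite !evalE /=; case: ifP => _; [have := csz_bcons true v|have := csz_bcons false v]; lia.
Qed.
#[export] Hint Resolve polye_lrev : pe.

(** The state is a leaf whose first bit is the carry and whose other bits are the output so far,
    reversed. It starts as a lone carry 1; at the end the carry becomes the top bit if set and is
    dropped otherwise. *)
Definition inc_step : expr :=
  EIfT (V 11)
    (EIfT (V 10) (EBc true (EBc false (ETl (V 11)))) (EBc false (EBc true (ETl (V 11)))))
    (EIfT (V 10) (EBc false (EBc true (ETl (V 11)))) (EBc false (EBc false (ETl (V 11))))).
Definition inc_e : expr := lock_e
 (ELet 1 (EFold 10 11 (V 0) ET inc_step)
    (ECall1 lrev_e (EIfT (V 1) (V 1) (ETl (V 1))))).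

Lemma eval_inc v r : eval inc_e ((0, v) :: r) = CLeaf (incb true (tb v)).
Proof.
rewrite /inc_e lock_eE !evalE eval_lrev eval_fold !evalE /=.
rewrite {2}/tb; set S := fun st u => _.
have HS c s u : S (CLeaf (c :: s)) u = CLeaf ((ctrue u && c) :: (ctrue u (+) c) :: s).
  by rewrite /S /inc_step !evalE /=; case: c; case: (ctrue u).
suff H us c s : (fun w => rev (tb (if ctrue w then w else ctl w))) (foldl S (CLeaf (c :: s)) us)
    = rev s ++ incb c (map ctrue us).
  by congr CLeaf; exact: H.
elim: us c s => [|u us IH] c s.
  rewrite /=; case: c => /=; rewrite tb_leaf ?cats0 //.
  by rewrite rev_cons cats1.
by rewrite [foldl _ _ (_ :: _)]/= HS IH rev_cons -cats1 -catA.
Qed.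
Lemma polye_inc : polye inc_e.
Proof.
suff H : polye (EFold 10 11 (V 0) ET inc_step) by rewrite /inc_e lock_eE; auto 10 with pe.
apply: (polye_fold_aff (k := 4)); rewrite /inc_step; auto 20 with pe.
move=> r v u; rewrite !evalE /=; have Hv := csz_tl v.
have Hb b b' : csz (cbcons b (cbcons b' (ctl v))) <= csz v + 4.
  by have := csz_bcons b (cbcons b' (ctl v)); have := csz_bcons b' (ctl v); lia.
by case: ifP => _; case: ifP => _; (apply: leq_trans (Hb _ _) _); lia.
Qed.
#[export] Hint Resolve polye_inc : pe.
Lemma eval_inc_nat n r : eval inc_e ((0, code_nat n) :: r) = code_nat n.+1.
Proof. by rewrite eval_inc tb_leaf bin_inc. Qed.
Lemma csz_inc v r : csz (eval inc_e ((0, v) :: r)) <= csz v + 2.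
Proof.
have Hs c s : size (incb c s) <= (size s).+1.
  by elim: s c => [|b s IH] [] //=; rewrite ltnS.
rewrite eval_inc csz_leaf; have := Hs true (tb v); rewrite size_map.
suff : 6 + 2 * size (elems v) <= csz v by lia.
case: v => [bs|cs] /=; rewrite ?csz_leaf ?csz_node ?size_map //.
by elim: cs => //= c cs; have := csz_ge6 c; lia.
Qed.

(* Head: the number following the range; tail: the range, reversed. *)
Definition range_step : expr :=
  ECons (ECall1 inc_e (EHd (V 11))) (ECons (EHd (V 11)) (ETl (V 11))).
Definition range_e : expr := EFold 10 11 (V 1) (ECons (V 0) ENil) range_step.
Lemma eval_range b l r : eval range_e ((0, code_nat b) :: (1, l) :: r) =
  CNode (code_nat (b + size (elems l)) :: rev (map code_nat (iota b (size (elems l))))).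
Proof.
rewrite /range_e eval_fold !evalE /=.
elim/last_ind: (elems l) => [|us u IH] /=; first by rewrite addn0.
rewrite foldl_rcons IH -[LHS]/(CNode (eval inc_e [:: (0, code_nat (b + size us))] ::
  code_nat (b + size us) :: rev [seq code_nat i | i <- iota b (size us)])).
by rewrite eval_inc_nat size_rcons -[in iota _ _.+1]addn1 iotaD map_cat rev_cat /= addnS.
Qed.
(** A step adds a copy of the counter, which is part of the state, so the additive criterion does
    not apply. Instead the counter is bounded separately: it gains at most two symbols per step. *)
Lemma polye_range : polye range_e.
Proof.
apply: polye_fold_bound; rewrite /range_step; auto 20 with pe.
pose A r := csz (lookup r 0); pose L r := csz (lookup r 1).
suff [c Hc] : poly esz (fun r => (L r + 1) * (A r + 2 * L r + 20) + 10).
  exists c => r t; apply: leq_trans (Hc r); rewrite !evalE.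
  have szt : size (take t (elems (lookup r 1))) <= L r.
    by rewrite size_take; have := size_elems (lookup r 1); rewrite /L; case: ifP; lia.
  move: (take t _) szt => us szt; set S := fun st u => _.
  suff [h [tl [-> H1 H2]]] : exists h tl, [/\ foldl S (ccons (lookup r 0) nilc) us = CNode (h :: tl),
      csz h <= A r + 2 * size us & csz (CNode (h :: tl)) <= (size us + 1) * (A r + 2 * size us + 20)].
    by apply: leq_trans H2 _; nia.
  elim/last_ind: us {szt} => [|us u [h [tl [E H1 H2]]]].
    by exists (lookup r 0), [::]; split=> //; rewrite ?csz_node /= -/(A r); lia.
  rewrite foldl_rcons size_rcons E.
  exists (eval inc_e [:: (0, h)]), (h :: tl); split; first by rewrite /S !evalE.
    by have := csz_inc h [::]; lia.
  have H3 := csz_inc h [::]; rewrite csz_nodeS.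
  move: (csz (CNode _)) (csz h) (csz (eval _ _)) (A r) (size us) H1 H2 H3 => sg a b k n H1 H2 H3; nia.
have HL : poly esz L by apply: (@poly_le _ _ _ (fun r => esz r + 6)) => [r|]; [exact: csz_lookup|apply: poly_add; [exact: poly_id|exact: poly_const]].
have HA : poly esz A by apply: (@poly_le _ _ _ (fun r => esz r + 6)) => [r|]; [exact: csz_lookup|apply: poly_add; [exact: poly_id|exact: poly_const]].
apply: poly_add; last exact: poly_const.
apply: poly_mul; first by apply: poly_add => //; exact: poly_const.
apply: poly_add; last exact: poly_const.
by apply: poly_add => //; apply: poly_mul => //; exact: poly_const.
Qed.
#[export] Hint Resolve polye_range : pe.

Lemma csz_fst_snd v : csz (chd v) + csz (chd (ctl v)) <= csz v + 6.
Proof. by have := csz_hd_tl6 v; have := csz_hd (ctl v); lia. Qed.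

Definition zip_step : expr :=
  EPair (ETl (EFst (V 11))) (ECons (EPair (V 10) (EHd (EFst (V 11)))) (ESnd (V 11))).
Definition zip_e : expr := lock_e
 (ECall1 rev_e (ESnd (EFold 10 11 (V 0) (EPair (V 1) ENil) zip_step))).
Lemma eval_zip X ys r : size (elems X) <= size ys ->
  eval zip_e ((0, X) :: (1, CNode ys) :: r) =
  CNode [seq CNode [:: p.1; p.2] | p <- zip (elems X) ys].
Proof.
rewrite /zip_e lock_eE !evalE eval_rev eval_fold !evalE /= => le.
set S := (X in foldl X _ _).
suff H us zs acc : size us <= size zs -> foldl S (CNode [:: CNode zs; CNode acc]) us =
   CNode [:: CNode (drop (size us) zs); CNode (catrev [seq CNode [:: p.1; p.2] | p <- zip us zs] acc)].
  by rewrite H //= catrevE cats0 revK.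
elim: us zs acc => [|u us IH] [|z zs] acc //=; first by rewrite ltnS => /IH ->.
Qed.
Lemma polye_zip : polye zip_e.
Proof.
suff H : polye (EFold 10 11 (V 0) (EPair (V 1) ENil) zip_step) by rewrite /zip_e lock_eE; auto 10 with pe.
apply: (polye_fold_aff (k := 40)); rewrite /zip_step; auto 20 with pe.
move=> r v u; rewrite !evalE /= !csz_nodeS csz_node /=.
have := csz_cons (CNode [:: u; chd (chd v)]) (chd (ctl v)); rewrite !csz_nodeS csz_node /=.
have := csz_fst_snd v; have := csz_hd_tl6 (chd v); have := csz_ge6 u; lia.
Qed.
#[export] Hint Resolve polye_zip : pe.

Definition split_step : expr :=
  EPair (ETl (EFst (V 11))) (ECons (EHd (EFst (V 11))) (ESnd (V 11))).
Definition split_e : expr := lock_e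
 (ELet 2 (EFold 10 11 (V 0) (EPair (V 1) ENil) split_step)
    (EPair (ECall1 rev_e (ESnd (V 2))) (EFst (V 2)))).
Lemma eval_split n ls r : size (elems n) <= size ls ->
  eval split_e ((0, n) :: (1, CNode ls) :: r) =
  CNode [:: CNode (take (size (elems n)) ls); CNode (drop (size (elems n)) ls)].
Proof.
rewrite /split_e lock_eE !evalE eval_rev eval_fold !evalE /= => le.
set S := (X in foldl X _ _).
suff H us zs acc : size us <= size zs -> foldl S (CNode [:: CNode zs; CNode acc]) us =
   CNode [:: CNode (drop (size us) zs); CNode (catrev (take (size us) zs) acc)].
  by rewrite H //= catrevE cats0 revK.
elim: us zs acc => [|u us IH] [|z zs] acc //=; first by rewrite ltnS => /IH ->.
Qed.
(** Beyond the end of a leaf, [chd] returns the empty leaf, which reads as false: a short binary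
    number is thereby padded with zeros. The padding differs from a false bit as a code, so only
    [tb w] is stated. *)
Lemma eval_split_leaf n bs r : exists w,
  eval split_e ((0, n) :: (1, CLeaf bs) :: r) = CNode [:: w; CLeaf (drop (size (elems n)) bs)] /\
  tb w = mkseq (nth false bs) (size (elems n)).
Proof.
rewrite /split_e lock_eE !evalE eval_rev eval_fold !evalE /=.
set S := (X in foldl X _ _).
suff H us zs acc : exists acc', foldl S (CNode [:: CLeaf zs; CNode acc]) us =
   CNode [:: CLeaf (drop (size us) zs); CNode acc'] /\
   map ctrue acc' = catrev (mkseq (nth false zs) (size us)) (map ctrue acc).
  have [acc' [-> /= E]] := H (elems n) bs [::].
  eexists; split; first by [].
  by rewrite /tb /= map_rev E catrevE cats0 revK.
elim: us zs acc => [|u us IH] zs acc /=; first by exists acc; rewrite drop0.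
have HS : S (CNode [:: CLeaf zs; CNode acc]) u = CNode [:: CLeaf (behead zs); CNode (chd (CLeaf zs) :: acc)] by [].
rewrite HS; have [acc' [-> E]] := IH (behead zs) (chd (CLeaf zs) :: acc).
exists acc'; split; first by case: (zs) => // ? ?; rewrite /= ?drop_nil.
have E0 : ctrue (chd (CLeaf zs)) = nth false zs 0 by case: (zs) => [|[]].
have E1 : mkseq (nth false (behead zs)) (size us) = [seq nth false zs i | i <- iota 1 (size us)].
  rewrite -[1]addn0 iotaDl -map_comp; apply: eq_map => i /=.
  by case: (zs) => //=; rewrite !nth_nil.
by rewrite E E1 [map _ (_ :: acc)]/= E0.
Qed.
Lemma polye_split : polye split_e.
Proof.
suff H : polye (EFold 10 11 (V 0) (EPair (V 1) ENil) split_step) by rewrite /split_e lock_eE; auto 10 with pe.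
apply: (polye_fold_aff (k := 40)); rewrite /split_step; auto 20 with pe.
move=> r v u; rewrite !evalE /= !csz_nodeS csz_node /=.
have := csz_cons (chd (chd v)) (chd (ctl v)).
have := csz_fst_snd v; have := csz_hd_tl6 (chd v); have := csz_ge6 u; lia.
Qed.
#[export] Hint Resolve polye_split : pe.

Definition uadd_e : expr := EFold 10 11 (V 0) (V 1) (EBc true (V 11)).
Lemma eval_uadd a m r :
  eval uadd_e ((0, a) :: (1, code_unary m) :: r) = code_unary (size (elems a) + m).
Proof.
rewrite /uadd_e eval_fold !evalE /=; elim: (elems a) m => //= u us IH m.
by have := IH m.+1; rewrite addnS.
Qed.
Lemma polye_uadd : polye uadd_e.
Proof.
apply: (polye_fold_aff (k := 2)); auto with pe.
by move=> r v u; rewrite !evalE /=; have := csz_bcons true v; lia.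
Qed.
#[export] Hint Resolve polye_uadd : pe.

Lemma nat_of_bits_cons b s : nat_of_bits (b :: s) = b + (nat_of_bits s).*2.
Proof. by []. Qed.
Lemma nat_of_bits_bin n : nat_of_bits (bin n) = n.
Proof.
elim/ltn_ind: n => -[|n] IH //; rewrite binE nat_of_bits_cons IH; last by lia.
exact: odd_double_half.
Qed.
Arguments nat_of_bits : simpl never.

Definition stripb : seq bool -> seq bool :=
  foldr (fun b acc => if b then true :: acc else if acc is [::] then [::] else false :: acc) [::].
Lemma bin_nat_of_bits s : bin (nat_of_bits s) = stripb s.
Proof.
have nz s' : (stripb s' == [::]) = (nat_of_bits s' == 0).
  elim: s' => // b s' IH; rewrite nat_of_bits_cons -/(stripb _) [stripb _]/= -/(stripb s').
  case: b => //=; rewrite add0n double_eq0 -IH; by case: (stripb s').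
elim: s => // b s IH; rewrite nat_of_bits_cons [stripb _]/= -/(stripb s) -IH.
have E m : 0 < m -> bin m = odd m :: bin m./2 by case: m => // m _; rewrite binE.
case: b; first by rewrite E // oddD odd_double /=; congr (_ :: bin _); lia.
case: (posnP (nat_of_bits s)) => [->|pos] //.
rewrite add0n E ?double_gt0 // odd_double doubleK.
by case Eb : (bin _) => //; have := nat_of_bits_bin (nat_of_bits s); rewrite Eb => E0; rewrite -E0 in pos.
Qed.

Definition strip_step : expr := EIfT (V 10) (EBc true (V 11)) (EIfNil (V 11) (V 11) (EBc false (V 11))).
Definition strip_e : expr := EFold 10 11 (ECall1 rev_e (V 0)) (ELit (CLeaf [::])) strip_step.
Lemma eval_strip v r : eval strip_e ((0, v) :: r) = code_nat (nat_of_bits (tb v)).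
Proof.
rewrite /code_nat bin_nat_of_bits /strip_e eval_fold !evalE eval_rev /= foldl_rev /tb.
elim: (elems v) => //= u us ->; rewrite /strip_step !evalE /=.
by case: ifP => // _; rewrite -/(stripb _); case: (stripb _).
Qed.
Lemma polye_strip : polye strip_e.
Proof.
apply: (polye_fold_aff (k := 2)); rewrite /strip_step; auto 10 with pe.
move=> r v u; rewrite !evalE /=; have := csz_bcons true v; have := csz_bcons false v.
by case: ifP => _; [lia|case: ifP => _; lia].
Qed.
#[export] Hint Resolve polye_strip : pe.

Definition eq_step : expr :=
  EPair (EIfNil (ESnd (V 11)) EF
          (EIfT (V 10) (EIfT (EHd (ESnd (V 11))) (EIfT (EFst (V 11)) ET EF) EF)
                       (EIfT (EHd (ESnd (V 11))) EF (EIfT (EFst (V 11)) ET EF))))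
    (ETl (ESnd (V 11))).
Definition eq_e : expr := lock_e
 (ELet 2 (EFold 10 11 (V 0) (EPair ET (V 1)) eq_step)
    (EIfNil (ESnd (V 2)) (EIfT (EFst (V 2)) ET EF) EF)).
Definition cb (b : bool) : code := if b then cT else cF.
Lemma ctrue_cb b : ctrue (cb b) = b. Proof. by case: b. Qed.
Lemma eval_eq a b r : eval eq_e ((0, a) :: (1, b) :: r) = cb (tb a == tb b).
Proof.
rewrite /eq_e lock_eE !evalE eval_fold !evalE /=; set S := (X in foldl X _ _).
have HS f w u : S (CNode [:: cb f; w]) u =
    CNode [:: cb [&& f, ~~ nilp (elems w) & ctrue u == head false (tb w)]; ctl w].
  rewrite /S /eq_step !evalE /= /chd /=; congr (CNode [:: _; _]).
  rewrite /cisnil /tb; case: (elems w) => [|w0 ws]; first by case: f.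
  by rewrite /= ctrue_cb; case: f; case: (ctrue u); case: (ctrue w0).
suff H us f w : exists w', foldl S (CNode [:: cb f; w]) us =
     CNode [:: cb (f && (map ctrue us == take (size us) (tb w)) && (size us <= size (tb w))); w'] /\
     elems w' = drop (size us) (elems w).
  have [w' [E1 E2]] := H (elems a) true b; rewrite -[CLeaf [:: true]]/(cb true) E1.
  rewrite {E1} /chd /= /cisnil E2 /nilp size_drop -/(tb a).
  have -> : size (elems a) = size (tb a) by rewrite size_map.
  have -> : size (elems b) = size (tb b) by rewrite size_map.
  case: (ltngtP (size (tb a)) (size (tb b))) => Hs.
  - rewrite subn_eq0 leqNgt Hs /=; case: eqP => // E; by rewrite E ltnn in Hs.
  - rewrite andbF (_ : (_ - _ == 0) = true) /=; last by lia.
    by case: eqP => // E; rewrite E ltnn in Hs.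
  - by rewrite Hs subnn eqxx take_size ?andbT; case: (_ == _).
elim: us f w => [|u us IH] f w.
  by exists w; rewrite take0 drop0 eqxx !andbT.
rewrite [foldl _ _ _]/= HS; have [w' [-> E]] := IH [&& f, ~~ nilp (elems w) & ctrue u == head false (tb w)] (ctl w).
exists w'; split; last by rewrite E elems_tl; case: (elems w) => //=; rewrite drop_nil.
congr (CNode [:: cb _; _]); rewrite /tb elems_tl; case: (elems w) => [|w0 ws] /=.
  by rewrite !andbF.
by rewrite eqseq_cons ltnS -!andbA.
Qed.
Lemma polye_eq : polye eq_e.
Proof.
suff H : polye (EFold 10 11 (V 0) (EPair ET (V 1)) eq_step) by rewrite /eq_e lock_eE; auto 20 with pe.
apply: (polye_fold_aff (k := 30)); rewrite /eq_step; auto 40 with pe.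
move=> r v u; rewrite !evalE /= !csz_nodeS csz_node /=.
have Ht := csz_tl (chd (ctl v)); have := csz_fst_snd v; have := csz_ge6 (chd v).
have := csz_ge6 u; set w := if _ then _ else _.
have : csz w <= 8 by rewrite /w; repeat case: ifP => _ //; rewrite csz_leaf.
lia.
Qed.
#[export] Hint Resolve polye_eq : pe.

(** The tags 0, 1, 2, 3 are the leaves with bits none, [1], [01], [11]: emptiness of the tag and of
    its tail single out constants and negations, and the first bit separates disjunction from
    conjunction. *)
Definition gval_e : expr := lock_e
 (ELet 2 (EHd (V 0)) (ELet 3 (ETl (V 0)) (ELet 4 (ECall3 nth_e (V 1) (EHd (V 3)) EF)
   (EIfNil (V 2) (EIfT (EHd (V 3)) ET EF)
    (EIfNil (ETl (V 2)) (EIfT (V 4) EF ET)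
     (ELet 5 (ECall3 nth_e (V 1) (ESnd (V 3)) EF)
      (EIfT (V 2) (EIfT (V 4) ET (EIfT (V 5) ET EF)) (EIfT (V 4) (EIfT (V 5) ET EF) EF)))))))).

Lemma tb_cb bs : map ctrue (map cb bs) = bs.
Proof. by rewrite -map_comp -[RHS]map_id; apply: eq_map => b; exact: ctrue_cb. Qed.
Lemma ctrue_nth l j : ctrue (nth cF l j) = nth false (map ctrue l) j.
Proof.
case: (ltnP j (size l)) => H; first by rewrite (nth_map cF).
by rewrite !nth_default ?size_map.
Qed.
Lemma tb_nat n : nat_of_bits (tb (code_nat n)) = n.
Proof. by rewrite tb_leaf nat_of_bits_bin. Qed.

Lemma code_natE : (code_nat 0 = CLeaf [::]) * (code_nat 1 = CLeaf [:: true]) *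
  (code_nat 2 = CLeaf [:: false; true]) * (code_nat 3 = CLeaf [:: true; true]).
Proof. by []. Qed.

Lemma eval_gval g vs r : eval gval_e ((0, code_gate g) :: (1, vs) :: r) = cb (eval_gate (tb vs) g).
Proof.
rewrite /gval_e lock_eE !evalE [lookup _ _]/=.
case: g => [b|i|i j|i j]; rewrite [code_gate _]/= !code_natE /= /chd /= ?eval_nth ?tb_nat ?ctrue_nth -?/(tb vs).
- by case: b.
- by case: (nth _ _ _).
- by case: (nth _ _ i); case: (nth _ _ j).
- by case: (nth _ _ i); case: (nth _ _ j).
Qed.
Lemma polye_gval : polye gval_e.
Proof. rewrite /gval_e lock_eE; auto 60 with pe. Qed.
#[export] Hint Resolve polye_gval : pe.

Definition evalc_step : expr := ECall2 cat_e (V 11) (ECons (ECall2 gval_e (V 10) (V 11)) ENil).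
Definition evalc_e : expr := lock_e
 (ELet 2 (EFold 10 11 (ESnd (V 0)) (ECall1 rev_e (ECall1 rev_e (V 1))) evalc_step)
    (map_e 10 (EIfT (ECall3 nth_e (V 2) (V 10) EF) ET EF) (EThd (V 0)))).
Lemma eval_evalc C ins r : eval evalc_e ((0, code_circuit C) :: (1, ins) :: r) =
  CNode [seq cb b | b <- circ_eval C (tb ins)].
Proof.
rewrite /evalc_e lock_eE eval_let eval_map !evalE [lookup _ 0]/=.
set w := eval (EFold _ _ _ _ _) _.
have Ew : tb w = foldl (fun vs g => rcons vs (eval_gate vs g)) (tb ins) (cgates C).
  rewrite /w eval_fold !evalE !eval_rev /= revK /chd /=.
  have : tb ins = tb (CNode (elems ins)) by [].
  move: (CNode (elems ins)) (tb ins) => st vs ->.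
  elim: (cgates C) st => //= g gs IH st; rewrite IH; congr foldl.
  rewrite /evalc_step !evalE eval_cat /= eval_gval.
  by rewrite -cats1 /tb /= map_cat /= ctrue_cb.
rewrite /circ_eval -Ew /= -map_comp /chd /= -map_comp; congr CNode.
apply: eq_map => o /=; rewrite !evalE eval_nth /= tb_nat ctrue_nth -/(tb w).
by case: (nth _ _ _).
Qed.
Lemma polye_evalc : polye evalc_e.
Proof.
suff H : polye (EFold 10 11 (ESnd (V 0)) (ECall1 rev_e (ECall1 rev_e (V 1))) evalc_step).
  by rewrite /evalc_e lock_eE; auto 20 with pe.
apply: (polye_fold_inv (P := fun v => ~~ isleaf v)); rewrite /evalc_step; auto 20 with pe.
  by move=> r; rewrite !evalE !eval_rev.
exists 3 => r v u Pv; rewrite !evalE !eval_cat /=; split=> //.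
case: v Pv => // cs _; rewrite !csz_node map_cat sumn_cat /=.
set g := eval _ _; have : csz g <= 8.
  by rewrite /g /gval_e lock_eE !evalE; repeat case: ifP => _; rewrite csz_leaf.
have : 8 <= (csz u + esz r + 2) ^ 3 by apply: leq_trans (exp_mono 3 (_ : 2 <= _)) => //; lia.
by move: (_ ^ 3) => p; lia.
Qed.
#[export] Hint Resolve polye_evalc : pe.
(** The bound does not mention the input, so a fold that feeds its state through a fixed circuit
    keeps it of constant size. *)
Lemma csz_evalc C ins r : csz (eval evalc_e ((0, code_circuit C) :: (1, ins) :: r)) <= 6 + 8 * size (couts C).
Proof.
rewrite eval_evalc csz_node /circ_eval -!map_comp.
by elim: (couts C) => //= o os; rewrite /cb; case: (nth _ _ _); rewrite !csz_leaf /=; lia.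
Qed.

(** * Circuits built from circuits *)

Definition run (W : seq bool) (gs : seq gate) : seq bool :=
  foldl (fun vs g => rcons vs (eval_gate vs g)) W gs.
Lemma run_cat W g1 g2 : run W (g1 ++ g2) = run (run W g1) g2.
Proof. exact: foldl_cat. Qed.
Lemma run_rcons W gs g : run W (rcons gs g) = rcons (run W gs) (eval_gate (run W gs) g).
Proof. by rewrite /run foldl_rcons. Qed.
Lemma size_run W gs : size (run W gs) = size W + size gs.
Proof. by elim/last_ind: gs => [|gs g IH]; rewrite ?addn0 // run_rcons !size_rcons IH addnS. Qed.
Lemma nth_run W gs i : i < size W -> nth false (run W gs) i = nth false W i.
Proof.
move=> lt; elim/last_ind: gs => [|gs g IH] //; rewrite run_rcons nth_rcons size_run IH.
by rewrite ifT //; lia.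
Qed.
Lemma circ_evalE C inp : circ_eval C inp = map (nth false (run inp (cgates C))) (couts C).
Proof. by []. Qed.

(** That the named wires already exist is part of the statement: this makes it stable when further
    gates are appended. *)
Definition reads (W : seq bool) (names : seq nat) (bits : seq bool) : Prop :=
  all (fun i => i < size W) names /\ map (nth false W) names = bits.

Lemma reads_run W gs names bits : reads W names bits -> reads (run W gs) names bits.
Proof.
case=> Ha <-; split; first by apply: sub_all Ha => i; rewrite size_run; lia.
by apply/eq_in_map => i /(allP Ha) lt; rewrite nth_run.
Qed.
Lemma reads_cat W n1 b1 n2 b2 : reads W n1 b1 -> reads W n2 b2 -> reads W (n1 ++ n2) (b1 ++ b2).
Proof. by move=> [H1 <-] [H2 <-]; split; rewrite ?all_cat ?H1 ?map_cat. Qed.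
Lemma reads_size W n b : reads W n b -> size n = size b.
Proof. by case=> _ <-; rewrite size_map. Qed.
Lemma reads_take W n b k : reads W n b -> reads W (take k n) (take k b).
Proof.
case=> H <-; rewrite -map_take; split=> //; apply/allP => i /mem_take; exact: (allP H).
Qed.
Lemma reads_drop W n b k : reads W n b -> reads W (drop k n) (drop k b).
Proof.
case=> H <-; rewrite -map_drop; split=> //; apply/allP => i /mem_drop; exact: (allP H).
Qed.
Lemma reads_iota W a k : a + k <= size W -> reads W (iota a k) (take k (drop a W)).
Proof.
move=> le; split; first by apply/allP => i; rewrite mem_iota; lia.
apply: (@eq_from_nth _ false) => [|i]; first by rewrite size_map size_iota size_take size_drop; case: ifP; lia.
rewrite size_map size_iota => lt.
by rewrite (nth_map 0) ?size_iota // nth_iota // nth_take // nth_drop.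
Qed.
Lemma reads_nseq W a b k : reads W [:: a] [:: b] -> reads W (nseq k a) (nseq k b).
Proof. by case=> /= /andP[lt _] [E]; split; [rewrite all_nseq lt orbT|rewrite map_nseq E]. Qed.

Definition ren (T : seq nat) (F : nat) (g : gate) : gate :=
  match g with
  | GConst b => GConst b
  | GNot i => GNot (nth F T i)
  | GAnd i j => GAnd (nth F T i) (nth F T j)
  | GOr i j => GOr (nth F T i) (nth F T j)
  end.
Definition emb_tab (b : nat) (C : circuit) (ins : seq nat) : seq nat := ins ++ iota b (size (cgates C)).
Definition emb (b : nat) (C : circuit) (ins : seq nat) (F : nat) : seq gate :=
  map (ren (emb_tab b C ins) F) (cgates C).
Definition emb_outs (b : nat) (C : circuit) (ins : seq nat) (F : nat) : seq nat :=
  map (nth F (emb_tab b C ins)) (couts C).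
Lemma size_emb b C ins F : size (emb b C ins F) = size (cgates C).
Proof. exact: size_map. Qed.
Lemma size_emb_outs b C ins F : size (emb_outs b C ins F) = size (couts C).
Proof. exact: size_map. Qed.

(* Wires that do not exist yet read as [false] both in [C] and in its copy,
   so renaming is sound even for gates that refer to later wires. *)
Lemma reads_emb W b C ins F inp : size W = b -> reads W [:: F] [:: false] -> reads W ins inp ->
  reads (run W (emb b C ins F)) (emb_outs b C ins F) (circ_eval C inp).
Proof.
move=> szW [/= /andP[ltF _] [EF']] [Hins Einp].
set T := emb_tab b C ins; set n := size ins.
have szi : size inp = n by rewrite -Einp size_map.
have HT i : nth F T i = if i < n then nth F ins i else if i < n + size (cgates C) then b + (i - n) else F.
  rewrite /T /emb_tab nth_cat -/n; case: ifP => // Hi.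
  case: ifP => Hj; first by rewrite nth_iota //; lia.
  by rewrite nth_default // size_iota; lia.
have Hin i : i < n -> nth F ins i < b by move=> lt; rewrite -szW; apply: (allP Hins); exact: mem_nth.
have HTb i : nth F T i < b + size (cgates C).
  by rewrite HT; case: ifP => [/Hin|Hi]; [lia|case: ifP => Hj; lia].
(* The invariant holds after every prefix of the gates and for every name [i], including wires not
   yet or never computed; the latter are sent to [F]. *)
have key g1 g2 : cgates C = g1 ++ g2 -> forall i,
    nth false (run W (map (ren T F) g1)) (nth F T i) = nth false (run inp g1) i.
  elim/last_ind: g1 g2 => [|g1 g IH] g2 E i.
    rewrite /= HT; case: ifP => Hi; first by rewrite -Einp (nth_map F).
    rewrite [RHS]nth_default ?szi; last by lia.
    by case: ifP => _ //; rewrite nth_default //; lia.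
  have {}IH := IH (g :: g2); rewrite -cat_rcons in IH; have {}IH := IH E.
  have Eg : eval_gate (run W (map (ren T F) g1)) (ren T F g) = eval_gate (run inp g1) g.
    by case: (g) => //= *; rewrite ?IH.
  rewrite map_rcons !run_rcons !nth_rcons !size_run size_map szi szW Eg IH.
  have szg : size g1 < size (cgates C) by rewrite E size_cat size_rcons; lia.
  rewrite HT; case: (ltnP i n) => Hi.
    by have ltb := Hin i Hi; rewrite !ifT //; lia.
  case: (ltnP i (n + size (cgates C))) => Hj.
    have -> : (b + (i - n) < b + size g1) = (i < n + size g1) by lia.
    by have -> : (b + (i - n) == b + size g1) = (i == n + size g1) by lia.
  have -> : (F < b + size g1) by lia.
  have [-> ->] : (i < n + size g1) = false /\ (i == n + size g1) = false by lia.
  by rewrite nth_default // size_run szi; lia.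
have [szR HR] : size (run W (emb b C ins F)) = b + size (cgates C) /\
  (forall i, nth false (run W (emb b C ins F)) (nth F T i) = nth false (run inp (cgates C)) i).
  by rewrite size_run size_emb szW; split=> //; apply: (key _ [::]); rewrite cats0.
split; first by rewrite all_map szR; apply/allP => o _ /=; exact: HTb.
by rewrite circ_evalE -map_comp; apply: eq_map => o /=; exact: HR.
Qed.

Definition bulk (mk : nat -> nat -> gate) (X Y : seq nat) : seq gate :=
  [seq mk p.1 p.2 | p <- zip X Y].

Lemma reads_bulk (op : bool -> bool -> bool) mk W b X Y xs ys :
  (forall V i j, eval_gate V (mk i j) = op (nth false V i) (nth false V j)) ->
  size W = b -> reads W X xs -> reads W Y ys -> size X = size Y ->
  reads (run W (bulk mk X Y)) (iota b (size X)) [seq op p.1 p.2 | p <- zip xs ys].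
Proof.
move=> Hop szW [HX EX] [HY EY] sXY.
suff E : run W (bulk mk X Y) = W ++ [seq op p.1 p.2 | p <- zip xs ys].
  have szz : size [seq op p.1 p.2 | p <- zip xs ys] = size X.
    by rewrite size_map size_zip -EX -EY !size_map -sXY minnn.
  have := @reads_iota (run W (bulk mk X Y)) b (size X).
  rewrite E drop_cat szW ltnn subnn drop0 size_cat szz szW leqnn => /(_ isT).
  by rewrite -{2}szz take_size.
rewrite -{}EX -{}EY /bulk.
have Hz : all (fun p => (p.1 < size W) && (p.2 < size W)) (zip X Y).
  elim: X Y HX HY {sXY} => [|x X IH] [|y Y] //= /andP[-> HX] /andP[-> HY]; exact: IH.
have -> : zip [seq nth false W i | i <- X] [seq nth false W i | i <- Y] =
  [seq (nth false W p.1, nth false W p.2) | p <- zip X Y].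
  by elim: X Y {HX HY sXY Hz} => [|x X IH] [|y Y] //=; rewrite IH.
rewrite -map_comp; elim/last_ind: (zip X Y) Hz => [|z p IH]; first by rewrite cats0.
rewrite all_rcons => /andP[/andP[l1 l2] /IH E].
rewrite !map_rcons run_rcons {}E Hop !nth_cat l1 l2 /=.
by rewrite -!cats1 catA.
Qed.

Definition mux_gates (b f nf : nat) (X Y : seq nat) : seq gate :=
  bulk GAnd X (nseq (size X) f) ++ bulk GAnd Y (nseq (size Y) nf) ++
  bulk GOr (iota b (size X)) (iota (b + size X) (size Y)).
Definition mux_outs (b : nat) (X Y : seq nat) : seq nat := iota (b + size X + size Y) (size X).

Lemma size_bulk mk X Y : size X = size Y -> size (bulk mk X Y) = size X.
Proof. by move=> E; rewrite size_map size_zip E minnn. Qed.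

Lemma reads_mux W b f nf X Y (v : bool) xs ys : size W = b -> size X = size Y ->
  reads W [:: f] [:: v] -> reads W [:: nf] [:: ~~ v] -> reads W X xs -> reads W Y ys ->
  reads (run W (mux_gates b f nf X Y)) (mux_outs b X Y) (if v then xs else ys).
Proof.
move=> szW sXY Hf Hnf HX HY; rewrite /mux_gates !run_cat.
set W1 := run W _; set W2 := run W1 _.
have sX : size X = size xs := reads_size HX.
have sY : size Y = size ys := reads_size HY.
have s1 : size W1 = b + size X by rewrite size_run szW size_bulk ?size_nseq.
have s2 : size W2 = b + size X + size Y by rewrite size_run s1 size_bulk ?size_nseq.
have H1 : reads W1 (iota b (size X)) [seq p.1 && p.2 | p <- zip xs (nseq (size X) v)].
  by apply: reads_bulk => //; [exact: reads_nseq|rewrite size_nseq].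
have H2 : reads W2 (iota (b + size X) (size Y)) [seq p.1 && p.2 | p <- zip ys (nseq (size Y) (~~ v))].
  apply: reads_bulk => //; [exact: reads_run|by apply: reads_nseq; exact: reads_run|by rewrite size_nseq].
have H1' : reads W2 (iota b (size X)) [seq p.1 && p.2 | p <- zip xs (nseq (size X) v)] by apply: reads_run.
have := @reads_bulk orb GOr W2 _ _ _ _ _ (fun _ _ _ => erefl) s2 H1' H2.
rewrite !size_iota => /(_ sXY).
suff -> : [seq p.1 || p.2 | p <- zip [seq p.1 && p.2 | p <- zip xs (nseq (size X) v)]
   [seq p.1 && p.2 | p <- zip ys (nseq (size Y) (~~ v))]] = if v then xs else ys by [].
rewrite sX sY; have {sXY HX HY H1 H2 H1'} : size xs = size ys by rewrite -sX -sY.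
elim: xs ys {sX sY} => [|x xs IH] [|y ys] //=; first by case: (v).
by move=> [/IH ->]; case: (v); rewrite ?andbT ?andbF ?orbF ?orbT.
Qed.

(** Shannon expansion: the first input chooses between the circuits for its two values. The size is
    exponential in [m], which is harmless because [m] will depend on [k] only. *)
Lemma table_circuit m p (f : seq bool -> seq bool) : (forall x, size x = m -> size (f x) = p) ->
  exists C, [/\ cin C = m, size (couts C) = p & forall x, size x = m -> circ_eval C x = f x].
Proof.
elim: m f => [|m IH] f Hf.
  exists (Circuit 0 [seq GConst b | b <- f [::]] (iota 0 p)); split=> //=; first exact: size_iota.
  case=> // _; rewrite circ_evalE /=.
  have -> : run [::] [seq GConst b | b <- f [::]] = f [::].
    by elim/last_ind: (f [::]) => // s b E; rewrite map_rcons run_rcons E.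
  by rewrite -(Hf [::] erefl) map_nth_iota0 // take_size.
have [|C0 [ci0 co0 E0]] := IH (fun x => f (false :: x)); first by move=> x sx; apply: Hf; rewrite /= sx.
have [|C1 [ci1 co1 E1]] := IH (fun x => f (true :: x)); first by move=> x sx; apply: Hf; rewrite /= sx.
(* Wires [0] to [m] are inputs, [m.+1] is constant false and [m.+2] the negated first input; the
   first copy starts at [m.+3]. *)
pose g1 := emb m.+3 C0 (iota 1 m) m.+1; pose o0 := emb_outs m.+3 C0 (iota 1 m) m.+1.
pose b1 := m.+3 + size g1.
pose g2 := emb b1 C1 (iota 1 m) m.+1; pose o1 := emb_outs b1 C1 (iota 1 m) m.+1.
pose b2 := b1 + size g2.
exists (Circuit m.+1 ([:: GConst false; GNot 0] ++ g1 ++ g2 ++ mux_gates b2 0 m.+2 o1 o0) (mux_outs b2 o1 o0)).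
split=> //=; first by rewrite size_iota size_emb_outs.
move=> [|v x] //= [sx]; rewrite circ_evalE /= -[run _ _]/(run (run (v :: x) [:: GConst false; GNot 0]) (g1 ++ g2 ++ mux_gates b2 0 m.+2 o1 o0)).
have -> : run (v :: x) [:: GConst false; GNot 0] = v :: x ++ [:: false; ~~ v].
  by rewrite /run /= -!cats1 -catA.
set W := v :: _; have szW : size W = m.+3 by rewrite /W /= size_cat sx addn2.
have HF : reads W [:: m.+1] [:: false].
  by split; rewrite ?szW /= ?andbT // /W /= nth_cat sx ltnn subnn.
have Hn : reads W [:: m.+2] [:: ~~ v].
  by split; rewrite ?szW /= ?andbT // /W /= nth_cat sx ltnNge leqnSn subSnn.
have Hv : reads W [:: 0] [:: v] by split; rewrite ?szW.
have Hx : reads W (iota 1 m) x.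
  have := @reads_iota W 1 m; rewrite szW /W /= drop0 take_size_cat //; apply; lia.
rewrite (run_cat W g1) (run_cat _ g2); set W1 := run W g1; set W2 := run W1 g2.
have s1 : size W1 = b1 by rewrite size_run szW.
have s2 : size W2 = b2 by rewrite size_run s1.
have R0 : reads W1 o0 (f (false :: x)) by rewrite -E0 //; apply: reads_emb.
have R1 : reads W2 o1 (f (true :: x)) by rewrite -E1 //; apply: reads_emb => //; exact: reads_run.
have [_ ->] : reads (run W2 (mux_gates b2 0 m.+2 o1 o0)) (mux_outs b2 o1 o0)
    (if v then f (true :: x) else f (false :: x)).
  apply: reads_mux => //; try by do 2 apply: reads_run.
    by rewrite !size_emb_outs co0 co1.
  exact: reads_run.
by case: (v).
Qed.

(** * Programs that build circuits *)

Definition cnats (l : seq nat) : code := CNode (map code_nat l).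
(** State of a circuit under construction: the next free wire and the gates emitted so far. *)
Definition cst (b : nat) (gs : seq gate) : code := CNode [:: code_nat b; CNode (map code_gate gs)].

Lemma nth_cnats F T i : nth (code_nat F) (map code_nat T) i = code_nat (nth F T i).
Proof.
case: (ltnP i (size T)) => H; first by rewrite (nth_map F).
by rewrite !nth_default ?size_map.
Qed.
Lemma eval_nth_nat T i F r :
  eval nth_e ((0, cnats T) :: (1, code_nat i) :: (2, code_nat F) :: r) = code_nat (nth F T i).
Proof. by rewrite eval_nth tb_nat nth_cnats. Qed.

Definition nths_e : expr := lock_e (map_e 10 (ECall3 nth_e (V 1) (V 10) (V 2)) (V 0)).
Lemma eval_nths l T F r : eval nths_e ((0, cnats l) :: (1, cnats T) :: (2, code_nat F) :: r) =
  cnats (map (nth F T) l).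
Proof.
rewrite /nths_e lock_eE eval_map !evalE /= /cnats -!map_comp; congr CNode.
by apply: eq_map => i /=; rewrite !evalE eval_nth_nat.
Qed.
Lemma polye_nths : polye nths_e.
Proof. by rewrite /nths_e lock_eE; auto 20 with pe. Qed.
#[export] Hint Resolve polye_nths : pe.

Definition ren_e : expr := lock_e
  (EIfNil (EHd (V 0)) (V 0)
    (ECons (EHd (V 0)) (ECall3 nths_e (ETl (V 0)) (V 1) (V 2)))).
Lemma eval_ren g T F r : eval ren_e ((0, code_gate g) :: (1, cnats T) :: (2, code_nat F) :: r) =
  code_gate (ren T F g).
Proof.
rewrite /ren_e lock_eE !evalE [lookup _ 0]/=; case: g => [b|i|i j|i j] //.
- exact: (congr1 (ccons (code_nat 1)) (eval_nths [:: i] T F [::])).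
- exact: (congr1 (ccons (code_nat 2)) (eval_nths [:: i; j] T F [::])).
- exact: (congr1 (ccons (code_nat 3)) (eval_nths [:: i; j] T F [::])).
Qed.
Lemma polye_ren : polye ren_e.
Proof. by rewrite /ren_e lock_eE; auto 20 with pe. Qed.
#[export] Hint Resolve polye_ren : pe.

Definition rens_e : expr := lock_e (map_e 10 (ECall3 ren_e (V 10) (V 1) (V 2)) (V 0)).
Lemma eval_rens gs T F r :
  eval rens_e ((0, CNode (map code_gate gs)) :: (1, cnats T) :: (2, code_nat F) :: r) =
  CNode (map code_gate (map (ren T F) gs)).
Proof.
rewrite /rens_e lock_eE eval_map !evalE /= -!map_comp; congr CNode.
by apply: eq_map => g /=; rewrite !evalE eval_ren.
Qed.
Lemma polye_rens : polye rens_e.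
Proof. by rewrite /rens_e lock_eE; auto 20 with pe. Qed.
#[export] Hint Resolve polye_rens : pe.

Definition emit_e : expr := lock_e
  (ELet 2 (ECall2 range_e (EFst (V 0)) (V 1))
    (EPair (EPair (EHd (V 2)) (ECall2 cat_e (ESnd (V 0)) (V 1))) (ECall1 rev_e (ETl (V 2))))).
Lemma eval_emit b gs hs r :
  eval emit_e ((0, cst b gs) :: (1, CNode (map code_gate hs)) :: r) =
  CNode [:: cst (b + size hs) (gs ++ hs); cnats (iota b (size hs))].
Proof.
rewrite /emit_e lock_eE !evalE /= [chd (cst _ _)]/= eval_range eval_cat eval_rev /=.
by rewrite /chd /= size_map revK /cst map_cat.
Qed.
Lemma polye_emit : polye emit_e.
Proof. by rewrite /emit_e lock_eE; auto 20 with pe. Qed.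
#[export] Hint Resolve polye_emit : pe.

Definition emb_e : expr := lock_e
  (ELet 4 (ECall2 cat_e (V 2) (ECall1 rev_e (ETl (ECall2 range_e (EFst (V 0)) (ESnd (V 1))))))
  (ELet 5 (ECall2 emit_e (V 0) (ECall3 rens_e (ESnd (V 1)) (V 4) (V 3)))
    (EPair (EFst (V 5)) (ECall3 nths_e (EThd (V 1)) (V 4) (V 3))))).
Lemma eval_emb b gs C ins F r :
  eval emb_e ((0, cst b gs) :: (1, code_circuit C) :: (2, cnats ins) :: (3, code_nat F) :: r) =
  CNode [:: cst (b + size (cgates C)) (gs ++ emb b C ins F); cnats (emb_outs b C ins F)].
Proof.
rewrite /emb_e lock_eE !evalE [lookup _ 0]/= [lookup _ 1]/= [lookup _ 2]/=.
have -> : chd (ctl (code_circuit C)) = CNode (map code_gate (cgates C)) by [].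
have -> : chd (ctl (ctl (code_circuit C))) = cnats (couts C) by [].
have -> : chd (cst b gs) = code_nat b by [].
rewrite eval_range eval_rev eval_cat [elems (cnats _)]/= /= revK size_map -map_cat.
by rewrite -/(emb_tab b C ins) -/(cnats (emb_tab b C ins)) eval_rens eval_nths eval_emit size_map.
Qed.
Lemma polye_emb : polye emb_e.
Proof. by rewrite /emb_e lock_eE; auto 30 with pe. Qed.
#[export] Hint Resolve polye_emb : pe.

Definition bulk_e : expr := lock_e
  (ECall2 emit_e (V 0) (map_e 10 (ECons (V 1) (V 10)) (ECall2 zip_e (V 2) (V 3)))).
Lemma eval_bulk b gs tag mk X Y r :
  (forall i j, code_gate (mk i j) = CNode [:: code_nat tag; code_nat i; code_nat j]) ->
  size X = size Y ->
  eval bulk_e ((0, cst b gs) :: (1, code_nat tag) :: (2, cnats X) :: (3, cnats Y) :: r) =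
  CNode [:: cst (b + size X) (gs ++ bulk mk X Y); cnats (iota b (size X))].
Proof.
move=> Hmk sXY; rewrite /bulk_e lock_eE !evalE eval_map !evalE [lookup _ 2]/= [lookup _ 3]/= eval_zip.
  rewrite [elems (cnats _)]/=; set l := map _ _.
  have -> : l = map code_gate (bulk mk X Y).
    rewrite /l /bulk; elim: X Y {sXY l} => [|x X IH] [|y Y] //=.
    by rewrite -IH Hmk.
  by rewrite eval_emit size_bulk.
by rewrite /= !size_map sXY.
Qed.
Lemma polye_bulk : polye bulk_e.
Proof. by rewrite /bulk_e lock_eE; auto 30 with pe. Qed.
#[export] Hint Resolve polye_bulk : pe.

Definition mux_e : expr := lock_e
  (ELet 5 (ECall4 bulk_e (V 0) (ELit (code_nat 2)) (V 3) (map_e 10 (V 1) (V 3)))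
  (ELet 6 (ECall4 bulk_e (EFst (V 5)) (ELit (code_nat 2)) (V 4) (map_e 10 (V 2) (V 4)))
    (ECall4 bulk_e (EFst (V 6)) (ELit (code_nat 3)) (ESnd (V 5)) (ESnd (V 6))))).
Lemma eval_mux b gs f nf X Y r : size X = size Y ->
  eval mux_e ((0, cst b gs) :: (1, code_nat f) :: (2, code_nat nf) :: (3, cnats X) :: (4, cnats Y) :: r) =
  CNode [:: cst (b + size X + size Y + size X) (gs ++ mux_gates b f nf X Y); cnats (mux_outs b X Y)].
Proof.
move=> sXY; rewrite /mux_e lock_eE !evalE !eval_map !evalE.
have E c l : [seq code_nat c | _ <- map code_nat l] = map code_nat (nseq (size l) c).
  by elim: l => //= _ l ->.
rewrite /= !E -!/(cnats _) (@eval_bulk _ _ _ GAnd) ?size_nseq // /chd /= -!/(cnats _).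
rewrite (@eval_bulk _ _ _ GAnd) ?size_nseq // /chd /=.
rewrite (@eval_bulk _ _ _ GOr) ?size_iota //.
by rewrite /mux_gates /mux_outs -!catA.
Qed.
Lemma polye_mux : polye mux_e.
Proof. by rewrite /mux_e lock_eE; auto 40 with pe. Qed.
#[export] Hint Resolve polye_mux : pe.

(** * Reductions from programs *)

Definition cost_on (T : Type) (P : T -> Prop) (cd : T -> code) (e : expr) : Prop :=
  exists c, forall x, P x -> cost e [:: (0, cd x)] <= (csz (cd x) + 2) ^ c.

Lemma polye_cost_on (T : Type) (P : T -> Prop) (cd : T -> code) e : polye e -> cost_on P cd e.
Proof. by move=> [c Hc]; exists c => x _; apply: leq_trans (Hc _) _; rewrite /esz /= addn0. Qed.

Lemma main_prog_time (T : Type) (P : T -> Prop) (cd : T -> code) e : cost_on P cd e ->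
  exists c0, forall c x, c0 <= c -> P x ->
    tm_computes_within (tm_of_prog (main_prog e)) (enc_code (cd x))
      (enc_code (eval e [:: (0, cd x)])) (polybound c (size (enc_code (cd x)))).
Proof.
move=> [c1 Hc1]; have [K HK] := main_progP.
have [d Hd] : poly (@id nat) (fun n => K * ((n + 2) ^ c1 + n + 2) ^ 3).
  apply: poly_mul; first exact: poly_const.
  apply: poly_exp; apply: poly_add; last exact: poly_const.
  by apply: poly_add; [exists c1|exact: poly_id].
(* The exponent doubles because [n + 2 <= n ^ 2] for the size [n >= 6] of a code, which turns a
   power of [n + 2] into a power of [n]. *)
exists (2 * d) => c x lec Px; have [t [let' Ht]] := HK e (cd x); exists t; split=> //.
apply: leq_trans let' _; rewrite -/(csz (cd x)); have le1 := Hc1 x Px.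
have := Hd (csz (cd x)); have ge6 := csz_ge6 (cd x); move: (csz (cd x)) le1 ge6 => n le1 ge6 Hn.
apply: leq_trans (leq_trans _ Hn) _; first by rewrite leq_mul2l exp_mono ?orbT // !leq_add2r.
rewrite /polybound; apply: leq_trans (leq_addr _ _).
apply: leq_trans (exp_mono d (_ : _ <= n ^ 2)) _; first by rewrite -mulnn; nia.
by rewrite -expnM leq_pexp2l //; lia.
Qed.

(** The programs act on codes, while the maps of a reduction act on instances and solutions. It
    suffices that the computed codes are codes of suitable objects; the maps then arise by choice,
    with [J0] and [s0] as values on invalid arguments. *)
Lemma reduction (A B : search_problem) (J0 : sp_inst B) (s0 : sp_sol A) (ef eg : expr) :
  cost_on (@sp_valid A) (@sp_code A) ef -> polye eg ->
  (forall I : sp_inst A, sp_valid I -> exists J : sp_inst B,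
    [/\ sp_valid J, eval ef [:: (0, sp_code I)] = sp_code J &
      forall s : sp_sol B, sp_is_sol J s -> exists s' : sp_sol A, sp_is_sol I s' /\
        eval eg [:: (0, CNode [:: sp_code I; sp_sol_code s])] = sp_sol_code s']) ->
  poly_reduces A B.
Proof.
move=> Hf Hg H.
pose P (I : sp_inst A) (J : sp_inst B) := sp_valid I ->
  [/\ sp_valid J, eval ef [:: (0, sp_code I)] = sp_code J &
      forall s : sp_sol B, sp_is_sol J s -> exists s' : sp_sol A, sp_is_sol I s' /\
        eval eg [:: (0, CNode [:: sp_code I; sp_sol_code s])] = sp_sol_code s'].
have [|f Hff] := @functional_choice _ _ P.
  move=> I; have [vI|nvI] := classic (sp_valid I); last by exists J0.
  by have [J HJ] := H I vI; exists J.
pose Q (Is : sp_inst A * sp_sol B) (s' : sp_sol A) := sp_valid Is.1 -> sp_is_sol (f Is.1) Is.2 ->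
  sp_is_sol Is.1 s' /\ eval eg [:: (0, CNode [:: sp_code Is.1; sp_sol_code Is.2])] = sp_sol_code s'.
have [|g Hgg] := @functional_choice _ _ Q.
  case=> I s; have [vI|nvI] := classic (sp_valid I); last by exists s0.
  have [sI|nsI] := classic (sp_is_sol (f I) s); last by exists s0.
  by have [_ _ /(_ s sI) [s' Hs']] := Hff I vI; exists s'.
have [cf Hcf] := main_prog_time Hf.
have [cg Hcg] := main_prog_time (polye_cost_on (fun=> True)
  (fun Is : sp_inst A * sp_sol B => CNode [:: sp_code Is.1; sp_sol_code Is.2]) Hg).
exists f, (fun I s => g (I, s)), (tm_of_prog (main_prog ef)), (tm_of_prog (main_prog eg)), (cf + cg).
move=> I vI x; have [vf Ef Hs] := Hff I vI; split=> //.
  by rewrite -Ef; apply: Hcf => //; exact: leq_addr.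
move=> s sI xs; have [sol Eg] := Hgg (I, s) vI sI; split=> //.
by rewrite -Eg; apply: (Hcg _ (I, s)) => //; exact: leq_addl.
Qed.

(** * Binary notation *)

Lemma size_bits_of w x : size (bits_of w x) = w.
Proof. by rewrite size_map size_iota. Qed.
Lemma bits_of_cat a b x : bits_of (a + b) x = bits_of a x ++ bits_of b (x %/ 2 ^ a).
Proof.
rewrite /bits_of iotaD map_cat -[0 + a]addn0 iotaDl -map_comp; congr (_ ++ _).
by apply: eq_map => i /=; rewrite expnD divnMA.
Qed.
Lemma bits_ofS w x : bits_of w.+1 x = odd x :: bits_of w x./2.
Proof. by rewrite -add1n bits_of_cat /bits_of /= divn1 divn2. Qed.
Lemma nat_of_bits_cat s1 s2 : nat_of_bits (s1 ++ s2) = nat_of_bits s1 + 2 ^ size s1 * nat_of_bits s2.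
Proof.
elim: s1 => [|b s1 IH]; first by rewrite mul1n.
by rewrite cat_cons !nat_of_bits_cons IH /= expnS; lia.
Qed.
Lemma nat_of_bits_lt s : nat_of_bits s < 2 ^ size s.
Proof. by elim: s => // b s IH; rewrite nat_of_bits_cons /= expnS; case: b; lia. Qed.
Lemma nat_of_bits_of w x : nat_of_bits (bits_of w x) = x %% 2 ^ w.
Proof.
elim: w x => [|w IH] x; first by rewrite modn1.
rewrite bits_ofS nat_of_bits_cons IH expnS.
have lt : x./2 %% 2 ^ w < 2 ^ w by rewrite ltn_mod expn_gt0.
have E : x = x./2 %/ 2 ^ w * (2 * 2 ^ w) + (odd x + (x./2 %% 2 ^ w).*2).
  have := divn_eq x./2 (2 ^ w); have := odd_double_half x; move: (x./2) => h; nia.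
rewrite [in RHS]E modnMDl [RHS]modn_small //.
by move: lt; set a := x./2 %% _; clearbody a; case: (odd x); lia.
Qed.
Lemma bits_of_nat s : bits_of (size s) (nat_of_bits s) = s.
Proof.
elim: s => // b s IH; rewrite [size _]/= bits_ofS nat_of_bits_cons.
by rewrite halfD odd_double oddb /= doubleK oddD odd_double addbF oddb andbF /= add0n; case: b; rewrite /= ?IH.
Qed.
Lemma bits_of_mod w x : bits_of w (x %% 2 ^ w) = bits_of w x.
Proof. by have := bits_of_nat (bits_of w x); rewrite size_bits_of nat_of_bits_of. Qed.
Lemma bits_of_small w x : x < 2 ^ w -> nat_of_bits (bits_of w x) = x.
Proof. by move=> lt; rewrite nat_of_bits_of modn_small. Qed.

Lemma nth_bin x i : nth false (bin x) i = odd (x %/ 2 ^ i).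
Proof.
elim: i x => [|i IH] [|x] //; rewrite ?div0n ?divn1 ?nth_nil ?binE //=.
by rewrite IH expnS divnMA divn2.
Qed.
Lemma mkseq_bin w x : mkseq (nth false (bin x)) w = bits_of w x.
Proof. by apply: eq_map => i; rewrite nth_bin. Qed.
Lemma drop_bin n x : drop n (bin x) = bin (x %/ 2 ^ n).
Proof.
elim: n x => [|n IH] x; first by rewrite drop0 divn1.
by case: x => [|x]; rewrite ?div0n // binE /= IH expnS divnMA divn2.
Qed.
Lemma nilp_bin x : nilp (bin x) = (x == 0).
Proof. by case: x => // x; rewrite binE. Qed.
Lemma bin_inj : injective bin.
Proof. exact: can_inj nat_of_bits_bin. Qed.

Lemma width_lt m : m < 2 ^ width m.
Proof. exact: up_logP. Qed.
Lemma width_min m k : m < 2 ^ k -> width m <= k.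
Proof. exact: up_log_min. Qed.
Lemma width_mul m j : 0 < m -> width (m * 2 ^ j) = j + width m.
Proof.
move=> m0; apply/eqP; rewrite eqn_leq; apply/andP; split.
  by apply: width_min; rewrite expnD mulnC ltn_pmul2l ?expn_gt0 // width_lt.
have := width_lt (m * 2 ^ j); set a := width _ => Ha.
have ja : j <= a.
  rewrite leqNgt; apply/negP => lt; have : 2 ^ a <= 2 ^ j by rewrite leq_exp2l // ltnW.
  by nia.
rewrite -(subnKC ja) leq_add2l; apply: width_min.
by move: Ha; rewrite -{1}(subnKC ja) expnD mulnC ltn_pmul2l ?expn_gt0.
Qed.
Lemma up_log_mul k n : 0 < k -> up_log 2 (k * 2 ^ n) = n + up_log 2 k.
Proof.
move=> k0; apply/eqP; rewrite eqn_leq; apply/andP; split.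
  by apply: up_log_min => //; rewrite expnD mulnC leq_pmul2l ?expn_gt0 // up_logP.
have := @up_logP 2 (k * 2 ^ n) isT; set a := up_log _ _ => Ha.
have ja : n <= a.
  rewrite leqNgt; apply/negP => lt; have : 2 ^ a < 2 ^ n by rewrite ltn_exp2l.
  by nia.
rewrite -(subnKC ja) leq_add2l; apply: up_log_min => //.
by move: Ha; rewrite -{1}(subnKC ja) expnD mulnC leq_pmul2l ?expn_gt0.
Qed.
(** A factor [2 ^ n] contributes exactly [n] bits, so words for vertices and indices split into
    parts of length [n] and a top part whose width depends on [k] only. *)
Lemma vwidthE k n : 0 < k -> vwidth k n = n + up_log 2 k.
Proof.
move=> k0; rewrite /vwidth /width /nverts prednK ?up_log_mul //.
by rewrite muln_gt0 k0 expn_gt0.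
Qed.
Lemma ewidthE k n : 1 < k -> width (max_edge_index k n) = n + n + width 'C(k, 2).
Proof. by move=> k1; rewrite /max_edge_index width_mul ?bin_gt0 // mul2n addnn. Qed.

(** * From collisions to bad 2-colourings *)

Lemma zip_nseq (op : bool -> bool -> bool) v xs n : size xs = n ->
  [seq op p.1 p.2 | p <- zip xs (nseq n v)] = [seq op x v | x <- xs].
Proof. by move=> <-; elim: xs => //= x xs ->. Qed.

Section CollisionEdges.
Variable C : circuit.
Let n := cin C.
Let b0 := (n + n).+1.
Let b1 := b0 + 3.
Let b2 := b1 + size (cgates C).
Let b3 := b2 + size (cgates C).
Let b4 := b3 + size (couts C).
Let o1 := emb_outs b1 C (iota 0 n) b0.
Let o2 := emb_outs b2 C (iota n n) b0.

(** Wires [b0], [b0.+1] and [b0.+2] are false, true and the negation of the top index bit.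
    Conjunction with the last one clears both outputs on the last index; the two constants become
    the top bits of the endpoints, that is, their sides. *)
Definition col_gates : seq gate :=
  (((([::] ++ [:: GConst false; GConst true; GNot (n + n)]) ++ emb b1 C (iota 0 n) b0)
   ++ emb b2 C (iota n n) b0) ++ bulk GAnd o1 (nseq (size (couts C)) b0.+2)) ++
   bulk GAnd o2 (nseq (size (couts C)) b0.+2).

(* Index (x, y, t) is mapped to the edge from C(x) on the left to C(y) on the
   right, and the last index (0, 0, 1) to the edge from 0 to 0. *)
Definition col_circuit : circuit :=
  Circuit b0 col_gates (iota b3 (size (couts C)) ++ b0 :: (iota b4 (size (couts C)) ++ [:: b0.+1])).

Lemma col_circuit_eval xb yb t : size xb = n -> size yb = n ->
  circ_eval col_circuit (xb ++ yb ++ [:: t]) =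
  [seq b && ~~ t | b <- circ_eval C xb] ++ false :: ([seq b && ~~ t | b <- circ_eval C yb] ++ [:: true]).
Proof.
move=> sx sy; rewrite circ_evalE [cgates _]/= [couts _]/= /col_gates cat0s.

set gp := [:: _; _; _]; set g1 := emb b1 _ _ _; set g2 := emb b2 _ _ _; set g3 := bulk _ o1 _; set g4 := bulk _ o2 _.
rewrite -!catA (run_cat _ gp) (run_cat _ g1) (run_cat _ g2) (run_cat _ g3).
set W0 := run _ gp; set W1 := run W0 g1; set W2 := run W1 g2; set W3 := run W2 g3; set W4 := run W3 g4.
have E0 : W0 = xb ++ yb ++ [:: t; false; true; ~~ t].
  rewrite /W0 /gp /run /= -!cats1 -!catA /=; do 6 f_equal.
  by rewrite nth_cat sx ltnNge leq_addr /= addKn nth_cat sy ltnn subnn.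
have s0 : size W0 = b1 by rewrite E0 !size_cat sx sy /= /b1 /b0; lia.
have s1 : size W1 = b2 by rewrite size_run s0 size_emb.
have s2 : size W2 = b3 by rewrite size_run s1 size_emb.
have so1 : size o1 = size (couts C) by exact: size_emb_outs.
have so2 : size o2 = size (couts C) by exact: size_emb_outs.
have s3 : size W3 = b4 by rewrite size_run s2 size_bulk ?size_nseq so1.
have R k v : nth false [:: t; false; true; ~~ t] k = v -> k < 4 -> reads W0 [:: n + n + k] [:: v].
  move=> Ev ltk; split; first by rewrite s0 /= andbT /b1 /b0; lia.
  rewrite /= E0 nth_cat sx ifF; last by lia.
  rewrite nth_cat sy ifF; last by lia.
  by rewrite (_ : n + n + k - n - n = k) ?Ev //; lia.
have RF : reads W0 [:: b0] [:: false] by rewrite /b0 -addn1; apply: R.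
have RT : reads W0 [:: b0.+1] [:: true] by rewrite /b0 -addn2; apply: R.
have Rn : reads W0 [:: b0.+2] [:: ~~ t] by rewrite /b0 -addn3; apply: R.
have Rx : reads W0 (iota 0 n) xb.
  by have := @reads_iota W0 0 n; rewrite s0 E0 drop0 take_size_cat //; apply; rewrite /b1 /b0; lia.
have Ry : reads W0 (iota n n) yb.
  by have := @reads_iota W0 n n; rewrite s0 E0 drop_size_cat // take_size_cat //; apply; rewrite /b1 /b0; lia.
have R1 : reads W1 o1 (circ_eval C xb) by apply: reads_emb.
have R2 : reads W2 o2 (circ_eval C yb).
  by apply: reads_emb => //; apply: reads_run.
have R3 : reads W3 (iota b3 (size (couts C))) [seq b && ~~ t | b <- circ_eval C xb].
  rewrite -so1 -(zip_nseq andb (~~ t) (n := size (couts C))); last by rewrite size_map.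
  by apply: reads_bulk; rewrite ?size_nseq //; [exact: reads_run|apply: reads_nseq; do 2 apply: reads_run].
have R4 : reads W4 (iota b4 (size (couts C))) [seq b && ~~ t | b <- circ_eval C yb].
  rewrite -{1}so2 -(zip_nseq andb (~~ t) (n := size (couts C))); last by rewrite size_map.
  by apply: reads_bulk; rewrite ?size_nseq //; [exact: reads_run|apply: reads_nseq; do 3 apply: reads_run].
have R3' := reads_run g4 R3; have RF' : reads W4 [:: b0] [:: false] by do 4 apply: reads_run.
have RT' : reads W4 [:: b0.+1] [:: true] by do 4 apply: reads_run.
by have [_ ->] := reads_cat R3' (reads_cat RF' (reads_cat R4 RT')).
Qed.
End CollisionEdges.

(** No gates: the colour is the top bit of the vertex, its side. *)
Definition col_colour (n : nat) : circuit := Circuit n.+1 [::] [:: n].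
Definition col_inst (C : circuit) : bc_inst := BCInst (cin C) (col_circuit C) (col_colour (cin C)).

Definition not_gate_e (e : expr) : expr := EPair (ELit (code_nat 1)) e.
Definition col_f_e : expr := lock_e
  (ELet 1 (EHd (V 0))
  (ELet 2 (ECall2 range_e (ELit (code_nat 0)) (V 1))
  (ELet 3 (ECall2 range_e (EHd (V 2)) (V 1))
  (ELet 4 (ECall2 emit_e (EPair (ECall1 inc_e (EHd (V 3))) ENil)
     (ETriple (ELit (code_gate (GConst false))) (ELit (code_gate (GConst true))) (not_gate_e (EHd (V 3)))))
  (ELet 5 (ECall4 emb_e (EFst (V 4)) (V 0) (ECall1 rev_e (ETl (V 2))) (EHd (ESnd (V 4))))
  (ELet 6 (ECall4 emb_e (EFst (V 5)) (V 0) (ECall1 rev_e (ETl (V 3))) (EHd (ESnd (V 4))))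
  (ELet 7 (ECall4 bulk_e (EFst (V 6)) (ELit (code_nat 2)) (ESnd (V 5)) (map_e 10 (EThd (ESnd (V 4))) (ESnd (V 5))))
  (ELet 8 (ECall4 bulk_e (EFst (V 7)) (ELit (code_nat 2)) (ESnd (V 6)) (map_e 10 (EThd (ESnd (V 4))) (ESnd (V 6))))
  (ETriple (V 1)
    (ETriple (ECall2 uadd_e (V 1) (ECall2 uadd_e (V 1) (ELit (code_unary 1))))
       (ESnd (EFst (V 8)))
       (ECall2 cat_e (ESnd (V 7)) (ECons (EHd (ESnd (V 4)))
          (ECall2 cat_e (ESnd (V 8)) (ECons (ESnd (ESnd (V 4))) ENil)))))
    (ETriple (EBc true (V 1)) ENil (ECons (EHd (V 2)) ENil))))))))))).

Lemma map_const c l : [seq code_nat c | _ <- map code_nat l] = map code_nat (nseq (size l) c).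
Proof. by elim: l => //= _ l ->. Qed.

(** Lets a long chain of bindings be evaluated one at a time with the value announced, so that terms
    do not grow. *)
Lemma eval_let_eq x a e r v w :
  eval a r = v -> eval e ((x, v) :: r) = w -> eval (ELet x a e) r = w.
Proof. by rewrite eval_let => ->. Qed.

Lemma elems_unary n : size (elems (code_unary n)) = n.
Proof. by rewrite /= !size_map size_nseq. Qed.

Lemma eval_col_f C : eval col_f_e [:: (0, code_circuit C)] = code_bc_inst (col_inst C).
Proof.
set n := cin C; pose b0 := (n + n).+1; pose b1 := b0 + 3; pose b2 := b1 + size (cgates C).
pose b3 := b2 + size (cgates C); pose b4 := b3 + size (couts C).
pose o1 := emb_outs b1 C (iota 0 n) b0; pose o2 := emb_outs b2 C (iota n n) b0.
pose gp := [:: GConst false; GConst true; GNot (n + n)].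
pose G1 := ([::] ++ gp) ++ emb b1 C (iota 0 n) b0; pose G2 := G1 ++ emb b2 C (iota n n) b0.
pose G3 := G2 ++ bulk GAnd o1 (nseq (size (couts C)) b0.+2).
have so1 : size o1 = size (couts C) by exact: size_emb_outs.
have so2 : size o2 = size (couts C) by exact: size_emb_outs.
rewrite /col_f_e lock_eE.
apply: (eval_let_eq (v := code_unary n)); first by [].
apply: (eval_let_eq (v := CNode (code_nat n :: rev (map code_nat (iota 0 n))))).
  by rewrite !evalE eval_range elems_unary.
apply: (eval_let_eq (v := CNode (code_nat (n + n) :: rev (map code_nat (iota n n))))).
  by rewrite !evalE eval_range elems_unary.
apply: (eval_let_eq (v := CNode [:: cst b1 ([::] ++ gp); cnats [:: b0; b0.+1; b0.+2]])).
  by rewrite !evalE eval_inc_nat (eval_emit b0 [::] gp).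
apply: (eval_let_eq (v := CNode [:: cst b2 G1; cnats o1])).
  rewrite !evalE [lookup _ 2]/= eval_rev [elems _]/= revK; exact: eval_emb.
apply: (eval_let_eq (v := CNode [:: cst b3 G2; cnats o2])).
  rewrite !evalE [lookup _ 3]/= eval_rev [elems _]/= revK; exact: eval_emb.
apply: (eval_let_eq (v := CNode [:: cst b4 G3; cnats (iota b3 (size (couts C)))])).
  rewrite !evalE eval_map !evalE /= map_const so1; set w := CNode _.
  by rewrite (@eval_bulk _ _ _ GAnd) ?size_nseq // so1.
apply: (eval_let_eq (v := CNode [:: cst (b4 + size (couts C)) (col_gates C); cnats (iota b4 (size (couts C)))])).
  rewrite !evalE eval_map !evalE /= map_const so2; set w := CNode _.
  by rewrite (@eval_bulk _ _ _ GAnd) ?size_nseq // so2.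
rewrite !evalE ![lookup _ _]/= !eval_uadd !elems_unary !eval_cat /code_bc_inst /code_circuit /=.
by rewrite /cnats !map_cat /= map_cat /b0 addn1 addnS.
Qed.
Lemma polye_col_f : polye col_f_e.
Proof. by rewrite /col_f_e lock_eE /not_gate_e; auto 60 with pe. Qed.

Definition coords_e : expr := lock_e
  (ELet 2 (ECall2 split_e (V 0) (V 1)) (ELet 3 (ECall2 split_e (V 0) (ESnd (V 2)))
    (ETriple (ECall1 strip_e (EFst (V 2))) (ECall1 strip_e (EFst (V 3))) (ESnd (V 3))))).
Lemma eval_coords n i r : eval coords_e ((0, code_unary n) :: (1, code_nat i) :: r) =
  CNode [:: code_nat (i %% 2 ^ n); code_nat (i %/ 2 ^ n %% 2 ^ n); code_nat (i %/ 2 ^ n %/ 2 ^ n)].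
Proof.
rewrite /coords_e lock_eE.
have [w1 [E1 B1]] := eval_split_leaf (code_unary n) (bin i) [::].
have [w2 [E2 B2]] := eval_split_leaf (code_unary n) (bin (i %/ 2 ^ n)) [::].
rewrite elems_unary mkseq_bin drop_bin in E1 B1; rewrite elems_unary mkseq_bin drop_bin in E2 B2.
apply: (eval_let_eq (v := CNode [:: w1; code_nat (i %/ 2 ^ n)])); first by rewrite !evalE.
apply: (eval_let_eq (v := CNode [:: w2; code_nat (i %/ 2 ^ n %/ 2 ^ n)])); first by rewrite !evalE.
by rewrite !evalE !eval_strip [chd _]/= [chd (lookup _ 3)]/= /chd /= B1 B2 !nat_of_bits_of.
Qed.
Lemma polye_coords : polye coords_e.
Proof. by rewrite /coords_e lock_eE; auto 30 with pe. Qed.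
#[export] Hint Resolve polye_coords : pe.

Definition col_g_e : expr := lock_e
  (ELet 1 (EHd (EHd (V 0)))
  (ELet 2 (ECall2 coords_e (V 1) (ESnd (ESnd (V 0))))
  (ELet 3 (ECall2 coords_e (V 1) (EThd (ESnd (V 0))))
  (EIfNil (EThd (V 2))
    (EIfNil (EThd (V 3))
      (EIfT (ECall2 eq_e (EFst (V 2)) (EFst (V 3)))
        (ETriple (ELit (code_nat 1)) (ESnd (V 2)) (ESnd (V 3)))
        (ETriple (ELit (code_nat 1)) (EFst (V 2)) (EFst (V 3))))
      (EPair (ELit (code_nat 0)) (EFst (V 2))))
    (EPair (ELit (code_nat 0)) (EFst (V 3))))))).
Lemma polye_col_g : polye col_g_e.
Proof. by rewrite /col_g_e lock_eE; auto 40 with pe. Qed.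

(** Equal edges have equal left ends and equal right ends. If the [x] parts differ they collide; if
    they agree, the [y] parts differ and collide. Compared with the last edge, whose left end is 0,
    the other [x] part is a zero. *)
Definition col_g (n i j : nat) : col_sol :=
  if i %/ 2 ^ n %/ 2 ^ n == 0 then
    if j %/ 2 ^ n %/ 2 ^ n == 0 then
      if i %% 2 ^ n == j %% 2 ^ n then ColPair (i %/ 2 ^ n %% 2 ^ n) (j %/ 2 ^ n %% 2 ^ n)
      else ColPair (i %% 2 ^ n) (j %% 2 ^ n)
    else ColZero (i %% 2 ^ n)
  else ColZero (j %% 2 ^ n).

Lemma cisnil_nat n : cisnil (code_nat n) = (n == 0).
Proof. by rewrite /cisnil /= /nilp size_map -/(nilp _) nilp_bin. Qed.
Lemma tb_nat_eq i j : (tb (code_nat i) == tb (code_nat j)) = (i == j).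
Proof. by rewrite !tb_leaf (inj_eq bin_inj). Qed.

Lemma eval_col_g C i j :
  eval col_g_e [:: (0, CNode [:: code_circuit C; code_bc_sol (BCDup i j)])] =
  code_col_sol (col_g (cin C) i j).
Proof.
rewrite /col_g_e lock_eE.
apply: (eval_let_eq (v := code_unary (cin C))); first by [].
apply: eval_let_eq; first by rewrite !evalE; exact: eval_coords.
apply: eval_let_eq; first by rewrite !evalE; exact: eval_coords.
rewrite !evalE ![lookup _ _]/= eval_eq /chd ![head _ _]/= ctrue_cb tb_nat_eq !cisnil_nat /col_g.
by case: ifP => // _; case: ifP => // _; case: ifP.
Qed.

Lemma nat_of_bits_and0 s : nat_of_bits [seq b && false | b <- s] = 0.
Proof. by elim: s => //= b s IH; rewrite nat_of_bits_cons IH andbF. Qed.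
Lemma map_andbT s : [seq b && true | b <- s] = s.
Proof. by rewrite -[RHS]map_id; apply: eq_map => b; rewrite andbT. Qed.

Lemma circ_apply_lt C x : circ_apply C x < 2 ^ size (couts C).
Proof. by rewrite -(size_map (nth false (run (bits_of (cin C) x) (cgates C)))) nat_of_bits_lt. Qed.

Lemma up_log22 : up_log 2 2 = 1. Proof. by []. Qed.

Lemma edge_of_pair k n a b s1 s2 E i : 0 < k -> circ_eval E (bits_of (cin E) i) = s1 ++ s2 ->
  size s1 = n + up_log 2 k -> nat_of_bits s1 = a -> nat_of_bits s2 = b ->
  a < k * 2 ^ n -> b < k * 2 ^ n -> edge_of k n E i = (a, b).
Proof.
move=> k0 Ec sz <- <- la lb.
by rewrite /edge_of Ec vwidthE // -sz take_size_cat // drop_size_cat // !modn_small.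
Qed.

Lemma nat_of_bits_rcons s b : nat_of_bits (s ++ [:: b]) = nat_of_bits s + 2 ^ size s * b.
Proof. by rewrite nat_of_bits_cat nat_of_bits_cons addn0. Qed.

Section CollisionReduction.
Variable C : circuit.
Hypothesis vC : col_valid C.
Let n := cin C.

Lemma col_edge i : i < 2 ^ n * 2 ^ n ->
  edge_of 2 n (col_circuit C) i = (circ_apply C (i %% 2 ^ n), 2 ^ n + circ_apply C (i %/ 2 ^ n)).
Proof.
move=> lti; have so : size (couts C) = n := vC.
have HA x : circ_apply C x < 2 ^ n by rewrite -so; exact: circ_apply_lt.
have E0 : i %/ 2 ^ n %/ 2 ^ n = 0 by rewrite -divnMA divn_small.
have Eb : bits_of (cin (col_circuit C)) i = bits_of n i ++ bits_of n (i %/ 2 ^ n) ++ [:: false].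
  rewrite [cin _]/= -/n -addnS bits_of_cat -[n.+1]addn1 bits_of_cat /bits_of /= divn1.
  by rewrite E0.
apply: (@edge_of_pair 2 n _ _ (circ_eval C (bits_of n i) ++ [:: false]) (circ_eval C (bits_of n (i %/ 2 ^ n)) ++ [:: true])) => //.
- rewrite Eb col_circuit_eval ?size_bits_of // !map_andbT.
  by rewrite -catA.
- by rewrite size_cat size_map so up_log22.
- by rewrite nat_of_bits_rcons muln0 addn0 /circ_apply -/n bits_of_mod.
- by rewrite nat_of_bits_rcons size_map so muln1 addnC /circ_apply -/n.
- by have := HA (i %% 2 ^ n); lia.
- by have := HA (i %/ 2 ^ n); lia.
Qed.

Lemma col_edge_last : edge_of 2 n (col_circuit C) (2 ^ n * 2 ^ n) = (0, 2 ^ n).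
Proof.
have so : size (couts C) = n := vC.
have p0 : 0 < 2 ^ n by rewrite expn_gt0.
have Eb : bits_of (cin (col_circuit C)) (2 ^ n * 2 ^ n) = bits_of n (2 ^ n * 2 ^ n) ++ bits_of n (2 ^ n) ++ [:: true].
  rewrite [cin _]/= -/n -addnS bits_of_cat mulnK // -[n.+1]addn1 bits_of_cat divnn p0 //.
apply: (@edge_of_pair 2 n _ _ ([seq b && false | b <- circ_eval C (bits_of n (2 ^ n * 2 ^ n))] ++ [:: false]) ([seq b && false | b <- circ_eval C (bits_of n (2 ^ n))] ++ [:: true])) => //.
- rewrite Eb col_circuit_eval ?size_bits_of //.
  by rewrite -catA.
- by rewrite size_cat !size_map so up_log22.
- by rewrite nat_of_bits_rcons nat_of_bits_and0 muln0.
- by rewrite nat_of_bits_rcons nat_of_bits_and0 !size_map so muln1.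
- by lia.
- by lia.
Qed.

Lemma col_colour_of v : v < 2 * 2 ^ n -> color_of 2 (col_inst C) v = (2 ^ n <= v).+1.
Proof.
move=> lt; rewrite /color_of /circ_apply /= /circ_eval /= -/n.
rewrite (nth_map 0) ?size_iota // nth_iota // nat_of_bits_cons addn0.
have -> : odd (v %/ 2 ^ n) = (2 ^ n <= v).
  case: leqP => H; last by rewrite divn_small.
  by rewrite -[v](subnKC H) divnDl // divnn expn_gt0 /= divn_small //; lia.
by case: (_ <= _).
Qed.

Lemma col_edge_bip i : i <= 2 ^ n * 2 ^ n ->
  let e := edge_of 2 n (col_circuit C) i in [/\ e.1 < 2 ^ n, 2 ^ n <= e.2 & e.2 < 2 * 2 ^ n].
Proof.
have HA x : circ_apply C x < 2 ^ n by have := circ_apply_lt C x; rewrite (vC : size _ = _).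
rewrite leq_eqVlt => /orP[/eqP ->|lt].
  by have p0 : 0 < 2 ^ n by [rewrite expn_gt0]; rewrite col_edge_last /=; split=> //; lia.
have H1 := HA (i %% 2 ^ n); have H2 := HA (i %/ 2 ^ n).
by rewrite col_edge //=; split=> //; lia.
Qed.

Lemma col_sol_ok s : bc_is_sol 2 (col_inst C) s -> exists i j,
  s = BCDup i j /\ col_is_sol C (col_g n i j).
Proof.
have HN : max_edge_index 2 n = 2 ^ n * 2 ^ n by rewrite /max_edge_index mul1n mul2n -addnn expnD.
have HA x : circ_apply C x < 2 ^ n by have := circ_apply_lt C x; rewrite (vC : size _ = _).
case: s => [i j|i] /=; rewrite -/n HN; last first.
  move=> [le]; have [l1 l2 l3] := col_edge_bip le; rewrite !col_colour_of //; last by apply: leq_trans l1 _; lia.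
  by rewrite l2 leqNgt l1.
move=> [li lj nij sp]; exists i, j; split=> //.
have [i1 i2 i3] := col_edge_bip li; have [j1 j2 j3] := col_edge_bip lj.
(* The crossed case of [same_pair] would put a left end, below [2 ^ n], equal to a right end. *)
have {sp} [E1 E2] : (edge_of 2 n (col_circuit C) i).1 = (edge_of 2 n (col_circuit C) j).1 /\
    (edge_of 2 n (col_circuit C) i).2 = (edge_of 2 n (col_circuit C) j).2.
  by move: sp => /orP[/andP[/eqP -> /eqP ->] //|/andP[/eqP E _]]; move: i1 j2; rewrite E; lia.
have p0 : 0 < 2 ^ n by rewrite expn_gt0.
have top k : k <= 2 ^ n * 2 ^ n -> (k %/ 2 ^ n %/ 2 ^ n == 0) = (k < 2 ^ n * 2 ^ n).
  by move=> le; rewrite -divnMA -leqn0 -ltnS ltn_divLR ?mul1n // muln_gt0 p0.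
have lm k : k %% 2 ^ n < 2 ^ n by rewrite ltn_mod.
have ld k : k < 2 ^ n * 2 ^ n -> k %/ 2 ^ n < 2 ^ n by move=> lt; rewrite ltn_divLR.
rewrite /col_g !top //; case: (ltnP i (2 ^ n * 2 ^ n)) => Hi; case: (ltnP j (2 ^ n * 2 ^ n)) => Hj.
- rewrite !col_edge //= in E1 E2; case: eqP => Eij /=.
    rewrite !(modn_small (ld _ _)) //; split; rewrite ?ld //; last by lia.
    by move=> Ed; apply: nij; rewrite (divn_eq i (2 ^ n)) (divn_eq j (2 ^ n)) Ed Eij.
  by split.
- have Ej : j = 2 ^ n * 2 ^ n by lia.
  by rewrite Ej col_edge_last col_edge //= in E1; split.
- have Ei : i = 2 ^ n * 2 ^ n by lia.
  by rewrite Ei col_edge_last col_edge //= in E1; split.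
- by case: nij; lia.
Qed.
End CollisionReduction.

Theorem collision_to_bad_colouring : poly_reduces Collision (BadColoring 2).
Proof.
apply: (@reduction Collision (BadColoring 2) (col_inst (Circuit 0 [::] [::])) (ColZero 0) col_f_e col_g_e).
- exact: polye_cost_on polye_col_f.
- exact: polye_col_g.
move=> C vC; exists (col_inst C); split.
- split; last by rewrite vwidthE //= up_log22 addn1.
  split; first by rewrite ewidthE //= /width -[up_log 2 _]/1 addn1.
  rewrite vwidthE //= size_cat /= size_cat !size_iota up_log22 /= (vC : size _ = _); lia.
- exact: eval_col_f.
move=> s /(col_sol_ok vC) [i [j [-> ok]]]; exists (col_g (cin C) i j); split=> //.
exact: eval_col_g.
Qed.

(** * From bad colourings to Turan *)

Lemma tb_cbs s : tb (CNode (map cb s)) = s.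
Proof. exact: tb_cb. Qed.

Definition pad_e (n x : expr) : expr := EFst (ECall2 split_e n x).
Lemma eval_pad n x r m i : eval n r = code_unary m -> eval x r = code_nat i ->
  tb (eval (pad_e n x) r) = bits_of m i.
Proof.
move=> En Ex; rewrite /pad_e !evalE En Ex /code_nat.
have [w [-> Ew]] := eval_split_leaf (code_unary m) (bin i) [::].
by rewrite /chd /= Ew elems_unary mkseq_bin.
Qed.
Lemma polye_pad n x : polye n -> polye x -> polye (pad_e n x).
Proof. by rewrite /pad_e; auto with pe. Qed.
#[export] Hint Resolve polye_pad : pe.

Lemma klea k : k <= 2 ^ up_log 2 k. Proof. exact: up_logP. Qed.

(** This is what makes the reduction of an endpoint a table on its [up_log 2 k] top bits. *)
Lemma modn_vertex k n x y : 0 < k -> x < 2 ^ n -> (x + 2 ^ n * y) %% nverts k n = x + 2 ^ n * (y %% k).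
Proof.
move=> k0 lx; rewrite /nverts.
have E : x + 2 ^ n * y = y %/ k * (k * 2 ^ n) + (x + 2 ^ n * (y %% k)).
  by rewrite {1}(divn_eq y k); move: (2 ^ n) (y %/ k) (y %% k) => p q z; nia.
rewrite E modnMDl modn_small //.
have := ltn_pmod y k0; move: (2 ^ n) (y %% k) lx => p z; nia.
Qed.

Lemma bits_of_vertex k n s1 s2 : 0 < k -> let a := up_log 2 k in
  size s1 = n -> size s2 = a ->
  bits_of (n + a) (nat_of_bits (s1 ++ s2) %% nverts k n) = s1 ++ bits_of a (nat_of_bits s2 %% k).
Proof.
move=> k0 a sz1 sz2; rewrite nat_of_bits_cat sz1 modn_vertex //; last by rewrite -sz1 nat_of_bits_lt.
have -> : nat_of_bits s1 + 2 ^ n * (nat_of_bits s2 %% k) = nat_of_bits (s1 ++ bits_of a (nat_of_bits s2 %% k)).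
  rewrite nat_of_bits_cat sz1 bits_of_small //.
  by apply: leq_trans (klea k); exact: ltn_pmod.
have {1}-> : n + a = size (s1 ++ bits_of a (nat_of_bits s2 %% k)) by rewrite size_cat size_bits_of sz1.
by rewrite bits_of_nat.
Qed.

Section Vertices.
Variables (k : nat) (KM : circuit).
Hypothesis k0 : 0 < k.
Let a := up_log 2 k.
Hypothesis szM : size (couts KM) = a.
Hypothesis evM : forall x, size x = a -> circ_eval KM x = bits_of a (nat_of_bits x %% k).

(** The raw output is cut into pieces of [n], [a], [n] and [a] bits, and [KM] reduces the two short
    ones modulo [k]. *)
Definition verts_e : expr := lock_e
  (ELet 3 (ECall2 evalc_e (V 1) (pad_e (EHd (V 1)) (V 2)))
  (ELet 4 (ECall2 split_e (V 0) (V 3))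
  (ELet 5 (ECall2 split_e (ELit (code_unary a)) (ESnd (V 4)))
  (ELet 6 (ECall2 split_e (V 0) (ESnd (V 5)))
  (EPair (ECall2 cat_e (EFst (V 4)) (ECall2 evalc_e (ELit (code_circuit KM)) (EFst (V 5))))
         (ECall2 cat_e (EFst (V 6)) (ECall2 evalc_e (ELit (code_circuit KM)) (ESnd (V 6)))))))))
.
Lemma eval_verts n E i r : edge_valid k n E -> exists w1 w2,
  [/\ eval verts_e ((0, code_unary n) :: (1, code_circuit E) :: (2, code_nat i) :: r) = CNode [:: w1; w2],
   tb w1 = bits_of (n + a) (edge_of k n E i).1 & tb w2 = bits_of (n + a) (edge_of k n E i).2].
Proof.
case=> ciE; rewrite vwidthE // -/a => coE.
rewrite /edge_of vwidthE // -/a; set out := circ_eval E (bits_of (cin E) i).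
have szo : size out = (n + a).*2 by rewrite size_map coE.
set l1 := take n out; set l2 := drop n out; set l3 := take a l2; set l4 := drop a l2.
set l5 := take n l4; set l6 := drop n l4.
have s2 : size l2 = n + a + a by rewrite size_drop szo; lia.
have s4 : size l4 = n + a by rewrite size_drop s2; lia.
have s6 : size l6 = a by rewrite size_drop s4; lia.
have s1 : size l1 = n by rewrite size_takel // szo; lia.
have s3 : size l3 = a by rewrite size_takel // s2; lia.
have s5 : size l5 = n by rewrite size_takel // s4; lia.
have E1 : take (n + a) out = l1 ++ l3 by rewrite takeD.
have E2 : drop (n + a) out = l5 ++ l6 by rewrite cat_take_drop /l4 /l2 drop_drop addnC.
rewrite E1 E2 !bits_of_vertex //.
have cbm s : CNode (map cb s) = CNode (map cb s) by [].
do 2 eexists; split.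
- rewrite /verts_e lock_eE.
  apply: (eval_let_eq (v := CNode (map cb out))).
    by rewrite eval_call2 eval_var [lookup _ 1]/= eval_evalc (eval_pad (m := cin E) (i := i)).
  apply: (eval_let_eq (v := CNode [:: CNode (map cb l1); CNode (map cb l2)])).
    by rewrite !evalE eval_split elems_unary ?size_map ?szo; [rewrite -map_take -map_drop|lia].
  apply: (eval_let_eq (v := CNode [:: CNode (map cb l3); CNode (map cb l4)])).
    by rewrite !evalE /chd /= eval_split elems_unary ?size_map ?s2; [rewrite -map_take -map_drop|lia].
  apply: (eval_let_eq (v := CNode [:: CNode (map cb l5); CNode (map cb l6)])).
    by rewrite !evalE /chd /= eval_split elems_unary ?size_map ?s4; [rewrite -map_take -map_drop|lia].
  by rewrite !evalE; reflexivity.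
- rewrite eval_cat eval_evalc /chd /= -map_cat !tb_cbs evM //.
- by rewrite eval_cat eval_evalc /chd /= -map_cat !tb_cbs evM.
Qed.
Lemma polye_verts : polye verts_e.
Proof. by rewrite /verts_e lock_eE; auto 60 with pe. Qed.
End Vertices.

Section Residue.
Variables (k : nat) (KH : circuit).
Hypothesis k0 : 0 < k.
Let a := up_log 2 k.
Hypothesis evH : forall r b, size r = a ->
  circ_eval KH (r ++ [:: b]) = bits_of a ((b + (nat_of_bits r).*2) %% k).

(** Horner's rule modulo [k], from the most significant bit, hence the reversal. [KH] sends a
    residue and a bit to the next residue, so arbitrarily long words need only a constant-size
    state. *)
Definition residue_e : expr := lock_e
  (EFold 10 11 (ECall1 rev_e (V 0)) (ELit (CNode (nseq a cF)))
    (ECall2 evalc_e (ELit (code_circuit KH)) (ECall2 cat_e (V 11) (ECons (V 10) ENil)))).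
Lemma eval_residue v r : tb (eval residue_e ((0, v) :: r)) = bits_of a (nat_of_bits (tb v) %% k).
Proof.
have lt_a x : x %% k < 2 ^ a by apply: leq_trans (klea k); exact: ltn_pmod.
rewrite /residue_e lock_eE eval_fold !evalE eval_rev /= foldl_rev /tb.
elim: (elems v) => [|u us IH] /=.
  rewrite mod0n map_nseq /=; elim: (a) => //= m ->.
  by rewrite bits_ofS.
rewrite !evalE eval_evalc eval_cat -/(tb _) tb_cbs.
rewrite {1}/tb /= map_cat {}IH evH ?size_bits_of // nat_of_bits_cons bits_of_small //.
by congr bits_of; rewrite -!muln2 -modnDmr modnMml modnDmr.
Qed.
Lemma polye_residue : polye residue_e.
Proof.
rewrite /residue_e lock_eE.
apply: (polye_fold_aff (k := 6 + 8 * size (couts KH))); auto 20 with pe.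
by move=> r v u; rewrite !evalE; apply: leq_trans (csz_evalc _ _ _) _; lia.
Qed.
End Residue.
#[export] Hint Resolve polye_verts polye_residue : pe.

Section CliqueColouring.
Variables (k : nat) (KM KH : circuit).
Hypothesis k1 : 1 < k.
Let k0 : 0 < k := ltnW k1.
Let a := up_log 2 k.
Hypothesis szM : size (couts KM) = a.
Hypothesis evM : forall x, size x = a -> circ_eval KM x = bits_of a (nat_of_bits x %% k).
Hypothesis evH : forall r b, size r = a ->
  circ_eval KH (r ++ [:: b]) = bits_of a ((b + (nat_of_bits r).*2) %% k).

Definition mono_e : expr := lock_e
  (ELet 2 (ECall3 (verts_e k KM) (EFst (V 0)) (ESnd (V 0)) (V 1))
   (ECall2 eq_e
     (ECall1 (residue_e k KH) (ECall2 evalc_e (EThd (V 0)) (EFst (V 2))))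
     (ECall1 (residue_e k KH) (ECall2 evalc_e (EThd (V 0)) (ESnd (V 2)))))).
Lemma polye_mono : polye mono_e.
Proof. by rewrite /mono_e lock_eE; auto 30 with pe. Qed.
Hint Resolve polye_mono : pe.

Lemma eval_mono I i r : bc_valid k I ->
  let e := edge_of k (bc_n I) (bc_E I) i in
  ctrue (eval mono_e ((0, code_bc_inst I) :: (1, code_nat i) :: r)) =
  (color_of k I e.1 == color_of k I e.2).
Proof.
move=> [vE]; rewrite vwidthE // -/a => ciC; set e := edge_of _ _ _ i.
have [w1 [w2 [Ev E1 E2]]] := eval_verts k0 szM evM i [::] vE.
have inj x y : (bits_of a (x %% k) == bits_of a (y %% k)) = (x %% k == y %% k).
  have lt z : z %% k < 2 ^ a by apply: leq_trans (klea k); exact: ltn_pmod.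
  by apply/eqP/eqP => [/(congr1 nat_of_bits)|->] //; rewrite !bits_of_small.
suff -> : eval mono_e ((0, code_bc_inst I) :: (1, code_nat i) :: r) =
   cb (color_of k I e.1 == color_of k I e.2) by rewrite ctrue_cb.
rewrite /mono_e lock_eE; apply: (eval_let_eq (v := CNode [:: w1; w2])); first by rewrite !evalE; exact: Ev.
rewrite !evalE eval_eq !(eval_residue k0 evH) ![lookup _ _]/=.
have -> : chd (ctl (ctl (code_bc_inst I))) = code_circuit (bc_C I) by [].
rewrite !eval_evalc !tb_cbs /chd /= E1 E2 -ciC inj.
by rewrite /color_of /circ_apply eqSS.
Qed.
End CliqueColouring.

Lemma residue_circuits k : 0 < k -> let a := up_log 2 k in exists KM KH : circuit,
  [/\ size (couts KM) = a, size (couts KH) = a,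
    forall x, size x = a -> circ_eval KM x = bits_of a (nat_of_bits x %% k) &
    forall r b, size r = a -> circ_eval KH (r ++ [:: b]) = bits_of a ((b + (nat_of_bits r).*2) %% k)].
Proof.
move=> k0 a.
have [|KM [_ sM evM]] := @table_circuit a a (fun x => bits_of a (nat_of_bits x %% k)).
  by move=> x _; exact: size_bits_of.
have [|KH [_ sH evH]] := @table_circuit a.+1 a
   (fun x => bits_of a ((last false x + (nat_of_bits (take a x)).*2) %% k)).
  by move=> x _; exact: size_bits_of.
exists KM, KH; split=> // r b sr; rewrite evH; last by rewrite size_cat sr addn1.
by rewrite last_cat -sr take_size_cat.
Qed.

Lemma pigeonhole k (f : nat -> nat) W : uniq W -> size W = k.+1 -> (forall v, 0 < f v <= k) ->
  exists u v, [/\ u \in W, v \in W, u <> v & f u = f v].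
Proof.
move=> uW sW fk; have : ~~ uniq (map f W).
  apply/negP => /(@uniq_leq_size _ _ (iota 1 k)); rewrite size_map sW size_iota ltnn.
  by move=> H; suff: false by []; apply: H => _ /mapP[v _ ->]; rewrite mem_iota add1n ltnS.
case/(uniqPn 0) => i [j [ltij]]; rewrite size_map => ltj.
rewrite !(nth_map 0) //; last exact: ltn_trans ltj.
move=> E; exists (nth 0 W i), (nth 0 W j); split=> //; try apply: mem_nth => //.
  exact: ltn_trans ltj.
by move/eqP; rewrite nth_uniq // ?(ltn_trans ltij) // ltn_eqF.
Qed.

Lemma filter_code_nat (p : pred code) s :
  [seq u <- map code_nat s | p u] = map code_nat [seq i <- s | p (code_nat i)].
Proof. by rewrite filter_map. Qed.

Section ColouringToTuran.
Variable k : nat.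
Hypothesis k1 : 1 < k.
Let k0 : 0 < k := ltnW k1.
Variables KM KH : circuit.
Hypothesis szM : size (couts KM) = up_log 2 k.
Hypothesis evM : forall x, size x = up_log 2 k -> circ_eval KM x = bits_of (up_log 2 k) (nat_of_bits x %% k).
Hypothesis evH : forall r b, size r = up_log 2 k ->
  circ_eval KH (r ++ [:: b]) = bits_of (up_log 2 k) ((b + (nat_of_bits r).*2) %% k).

(** A loop is monochromatic by itself and a repeated edge is passed on unchanged. For a clique the
    pigeonhole principle only says that some listed edge is monochromatic, so the list is filtered
    and its first survivor returned. *)
Definition clique_g_e : expr := lock_e
  (ELet 1 (EFst (V 0)) (ELet 2 (ESnd (V 0))
    (EIfNil (EHd (V 2)) (EPair (ELit (code_nat 1)) (ESnd (V 2)))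
      (EIfT (EHd (V 2)) (ETriple (ELit (code_nat 0)) (ESnd (V 2)) (EThd (V 2)))
        (EPair (ELit (code_nat 1))
          (EHd (filter_e (ECall2 (mono_e k KM KH) (V 1) (V 98)) (ESnd (V 2))))))))).
Lemma polye_clique_g : polye clique_g_e.
Proof. by have := @polye_mono k KM KH; rewrite /clique_g_e lock_eE; auto 30 with pe. Qed.

Lemma clique_g_ok I s : bc_valid k I -> tu_is_sol k (TUInst (bc_n I) (bc_E I)) s ->
  exists s', bc_is_sol k I s' /\
    eval clique_g_e [:: (0, CNode [:: code_bc_inst I; code_tu_sol s])] = code_bc_sol s'.
Proof.
move=> vI; rewrite /clique_g_e lock_eE.
case: s => [i [li E]|i j [li lj nij sp]|Ix [uI sI aI [W [uW sW _ clique]]]].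
- exists (BCMono i); split; first by split=> //; rewrite E.
  by rewrite !evalE.
- exists (BCDup i j); split; first by split.
  by rewrite !evalE.
pose mono i := let e := edge_of k (bc_n I) (bc_E I) i in color_of k I e.1 == color_of k I e.2.
have [|u [v [uiW viW nuv Ecol]]] := pigeonhole (f := color_of k I) uW sW.
  by move=> v; rewrite /color_of /= ltn_pmod.
have [i0 i0I sp] := clique u v uiW viW nuv.
have Hmono : i0 \in filter mono Ix.
  rewrite mem_filter i0I andbT /mono.
  by move: sp => /orP[] /= /andP[/eqP -> /eqP ->]; rewrite Ecol.
have [i [ss Ess]] : exists i ss, filter mono Ix = i :: ss.
  by case: (filter _ _) Hmono => // i ss _; exists i, ss.
have : i \in filter mono Ix by rewrite Ess mem_head.
rewrite mem_filter => /andP[/eqP Ei iI].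
exists (BCMono i); split; first by split=> //; exact: (allP aI).
rewrite !evalE eval_filter ![lookup _ _]/=.
have -> : elems (eval (ESnd (V 2)) [:: (2, code_tu_sol (TUClique Ix)); (1, code_bc_inst I);
   (0, CNode [:: code_bc_inst I; code_tu_sol (TUClique Ix)])]) = map code_nat Ix by [].
rewrite filter_code_nat.
rewrite (@eq_filter _ _ mono); last first.
  by move=> j; rewrite !evalE /= (eval_mono k1 szM evM evH).
by rewrite Ess.
Qed.
End ColouringToTuran.

Theorem bad_colouring_to_turan k : 2 <= k -> poly_reduces (BadColoring k) (Turan k).
Proof.
move=> k1; have [KM [KH [szM _ evM evH]]] := residue_circuits (ltnW k1).
apply: (@reduction (BadColoring k) (Turan k) (TUInst 0 (Circuit 0 [::] [::])) (BCMono 0)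
   (EPair (EFst (V 0)) (ESnd (V 0))) (clique_g_e k KM KH)).
- by apply: polye_cost_on; auto with pe.
- exact: polye_clique_g.
move=> I vI; exists (TUInst (bc_n I) (bc_E I)); split; first by case: vI.
- by [].
- by move=> s sol; exact: (clique_g_ok k1 szM evM evH vI sol).
Qed.

(** * Adding a colour class *)

Section ExtendEdges.
Variable k : nat.
Hypothesis k1 : 1 < k.
Let m := 'C(k, 2).
Let m' := 'C(k.+1, 2).
Let w := width m.
Let w' := width m'.
Let a := up_log 2 k.
Let a' := up_log 2 k.+1.

(* The indices with high part below [m], and the last one, list the old
   edges; the other ones list the pairs of an old and a new vertex. *)
Definition old_edge (h : nat) : bool := (h < m) || (h == m').

Variables K1 Kf Kv1 Kv2 : circuit.
Hypothesis ev1 : forall x, size x = w' -> circ_eval K1 x =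
  bits_of w (if nat_of_bits x == m' then m else nat_of_bits x).
Hypothesis evf : forall x, size x = w' -> circ_eval Kf x =
  [:: old_edge (nat_of_bits x); ~~ old_edge (nat_of_bits x)].
Hypothesis evv1 : forall x y, size x = w' -> size y = a -> circ_eval Kv1 (x ++ y) =
  bits_of a' (if old_edge (nat_of_bits x) then nat_of_bits y %% k else nat_of_bits x - m).
Hypothesis evv2 : forall x y, size x = w' -> size y = a -> circ_eval Kv2 (x ++ y) =
  bits_of a' (if old_edge (nat_of_bits x) then nat_of_bits y %% k else k).

Section Circuit.
Variables (n : nat) (E : circuit).
Let lo := iota 0 n.
Let hi := iota n n.
Let hs := iota (n + n) w'.
Let F := n + n + w'.
Let b1 := F + 1.
Let oh := emb_outs b1 K1 hs F.
Let g1 := ([::] ++ [:: GConst false]) ++ emb b1 K1 hs F.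
Let b2 := b1 + size (cgates K1).
Let ofl := emb_outs b2 Kf hs F.
Let g2 := g1 ++ emb b2 Kf hs F.
Let b3 := b2 + size (cgates Kf).
Let f := nth 0 ofl 0.
Let nf := nth 0 ofl 1.
Let insE := lo ++ hi ++ oh.
Let oE := emb_outs b3 E insE F.
Let g3 := g2 ++ emb b3 E insE F.
Let b4 := b3 + size (cgates E).
Let O1 := take n oE.
Let H1 := take a (drop n oE).
Let O2 := take n (drop a (drop n oE)).
Let H2 := drop n (drop a (drop n oE)).
Let v1 := emb_outs b4 Kv1 (hs ++ H1) F.
Let g4 := g3 ++ emb b4 Kv1 (hs ++ H1) F.
Let b5 := b4 + size (cgates Kv1).
Let v2 := emb_outs b5 Kv2 (hs ++ H2) F.
Let g5 := g4 ++ emb b5 Kv2 (hs ++ H2) F.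
Let b6 := b5 + size (cgates Kv2).
Let g6 := g5 ++ mux_gates b6 f nf O1 hi.
Let M1 := mux_outs b6 O1 hi.
Let b7 := b6 + n + n + n.
Let g7 := g6 ++ mux_gates b7 f nf O2 lo.
Let M2 := mux_outs b7 O2 lo.

(** A new index with parts [x], [y], [h] gives the edge from the old vertex [y + 2 ^ n * (h - m)] to
    the new vertex [x + 2 ^ n * k]; since [m' - m = k], every such pair occurs. On old indices the
    top bits are reduced modulo [k] here, as the output will be read modulo [k.+1] times [2 ^ n].
    [K1] replaces the new last high part by the old one before [E] is run. *)
Definition ext_circuit : circuit := Circuit (n + n + w') g7 (M1 ++ v1 ++ M2 ++ v2).

Hypothesis szE : size (couts E) = n + a + (n + a).

Let szoE : size oE = n + a + (n + a). Proof. by rewrite size_emb_outs. Qed.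
Let szO1 : size O1 = n. Proof. by rewrite size_takel // szoE; lia. Qed.
Let szH1 : size H1 = a. Proof. by rewrite size_takel // size_drop szoE; lia. Qed.
Let szO2 : size O2 = n. Proof. by rewrite size_takel // !size_drop szoE; lia. Qed.
Let szH2 : size H2 = a. Proof. by rewrite !size_drop szoE; lia. Qed.

Lemma ext_circuit_eval x y h : size x = n -> size y = n -> size h = w' ->
  let out := circ_eval E (x ++ y ++ bits_of w (if nat_of_bits h == m' then m else nat_of_bits h)) in
  let r := drop a (drop n out) in let fl := old_edge (nat_of_bits h) in
  circ_eval ext_circuit (x ++ y ++ h) =
  (if fl then take n out else y)
  ++ bits_of a' (if fl then nat_of_bits (take a (drop n out)) %% k else nat_of_bits h - m)
  ++ (if fl then take n r else x)
  ++ bits_of a' (if fl then nat_of_bits (drop n r) %% k else k).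
Proof.
move=> sx sy sh out r fl; rewrite circ_evalE [cgates _]/= [couts _]/=.
rewrite /g7 (run_cat _ g6) /g6 (run_cat _ g5) /g5 (run_cat _ g4) /g4 (run_cat _ g3).
rewrite /g3 (run_cat _ g2) /g2 (run_cat _ g1) /g1 (run_cat _ ([::] ++ [:: GConst false])).
set W0 := run _ ([::] ++ _); set W1 := run W0 _; set W2 := run W1 _; set W3 := run W2 _.
set W4 := run W3 _; set W5 := run W4 _; set W6 := run W5 _; set W7 := run W6 _.
have E0 : W0 = x ++ y ++ h ++ [:: false] by rewrite /W0 /run /= -cats1 -!catA.
have s0 : size W0 = b1 by rewrite E0 !size_cat sx sy sh /= /b1 /F; lia.
have s1 : size W1 = b2 by rewrite size_run s0 size_emb.
have s2 : size W2 = b3 by rewrite size_run s1 size_emb.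
have s3 : size W3 = b4 by rewrite size_run s2 size_emb.
have s4 : size W4 = b5 by rewrite size_run s3 size_emb.
have s5 : size W5 = b6 by rewrite size_run s4 size_emb.
have smux b X Y : size X = n -> size Y = n -> size (mux_gates b f nf X Y) = n + n + n.
  by move=> sX sY; rewrite !size_cat !size_bulk ?size_nseq ?size_iota ?sX ?sY //; lia.
have s6 : size W6 = b7 by rewrite size_run s5 smux ?size_iota // /b7; lia.
have RF : reads W0 [:: F] [:: false].
  split; first by rewrite s0 /= /b1 addn1 leqnn.
  by rewrite /= E0 nth_cat sx ifF ?nth_cat ?sy ?ifF ?nth_cat ?sh ?ifF; rewrite /F; try lia;
     rewrite (_ : n + n + w' - n - n - w' = 0) //; lia.
have Rx : reads W0 lo x.
  by have := @reads_iota W0 0 n; rewrite s0 E0 drop0 take_size_cat //; apply; rewrite /b1 /F; lia.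
have Ry : reads W0 hi y.
  by have := @reads_iota W0 n n; rewrite s0 E0 drop_size_cat // take_size_cat //; apply; rewrite /b1 /F; lia.
have Rh : reads W0 hs h.
  have := @reads_iota W0 (n + n) w'; rewrite s0 E0 catA drop_size_cat ?size_cat ?sx ?sy // take_size_cat //.
  by apply; rewrite /b1 /F; lia.
have R1 : reads W1 oh (bits_of w (if nat_of_bits h == m' then m else nat_of_bits h)).
  by rewrite -ev1 //; apply: reads_emb.
have Rf : reads W2 ofl [:: fl; ~~ fl] by rewrite -evf //; apply: reads_emb => //; exact: reads_run.
have szof : size ofl = 2 := reads_size Rf.
have Eof : ofl = [:: f; nf] by rewrite /f /nf; case: (ofl) szof => [|? [|? []]].
have Rfl : reads W2 [:: f] [:: fl].
  by move: Rf; rewrite Eof => -[/= /andP[lf _] [Ef _]]; split; rewrite /= ?lf ?Ef.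
have Rnf : reads W2 [:: nf] [:: ~~ fl].
  by move: Rf; rewrite Eof => -[/= /and3P[_ lf _] [_ Ef]]; split; rewrite /= ?lf ?Ef.
have RE : reads W3 oE out.
  apply: reads_emb => //; first by do 2 apply: reads_run.
  by do 2 (apply: reads_cat; first by do 2 apply: reads_run); exact: reads_run.
have RO1 : reads W3 O1 (take n out) by exact: reads_take.
have RH1 : reads W3 H1 (take a (drop n out)) by apply: reads_take; exact: reads_drop.
have RO2 : reads W3 O2 (take n r) by apply: reads_take; do 2 apply: reads_drop.
have RH2 : reads W3 H2 (drop n r) by do 3 apply: reads_drop.
have R4 : reads W4 v1 (bits_of a' (if fl then nat_of_bits (take a (drop n out)) %% k else nat_of_bits h - m)).
  rewrite -evv1 ?(esym (reads_size RH1)) //; apply: reads_emb => //; first by do 3 apply: reads_run.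
  by apply: reads_cat => //; do 3 apply: reads_run.
have R5 : reads W5 v2 (bits_of a' (if fl then nat_of_bits (drop n r) %% k else k)).
  rewrite -evv2 ?(esym (reads_size RH2)) //; apply: reads_emb => //; first by do 4 apply: reads_run.
  by apply: reads_cat; [do 4 apply: reads_run|exact: reads_run].
have R6 : reads W6 M1 (if fl then take n out else y).
  apply: reads_mux => //; [by rewrite size_iota|by do 3 apply: reads_run|by do 3 apply: reads_run|by do 2 apply: reads_run|by do 5 apply: reads_run].
have R7 : reads W7 M2 (if fl then take n r else x).
  apply: reads_mux => //; [by rewrite size_iota|by do 4 apply: reads_run|by do 4 apply: reads_run|by do 3 apply: reads_run|by do 6 apply: reads_run].
have [_ ->] := reads_cat (reads_run _ R6) (reads_cat (reads_run _ (reads_run _ (reads_run _ R4))) (reads_cat R7 (reads_run _ (reads_run _ R5)))).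
by [].
Qed.

Definition ext_e : expr := lock_e
  (ELet 2 (ECall2 range_e (ELit (code_nat 0)) (V 0))
  (ELet 3 (ECall2 range_e (EHd (V 2)) (V 0))
  (ELet 4 (ECall2 range_e (EHd (V 3)) (ELit (code_unary w')))
  (ELet 5 (ECall2 emit_e (EPair (EHd (V 4)) ENil) (ELit (CNode [:: code_gate (GConst false)])))
  (ELet 6 (ECall1 rev_e (ETl (V 2)))
  (ELet 7 (ECall1 rev_e (ETl (V 3)))
  (ELet 8 (ECall1 rev_e (ETl (V 4)))
  (ELet 9 (EHd (ESnd (V 5)))
  (ELet 10 (ECall4 emb_e (EFst (V 5)) (ELit (code_circuit K1)) (V 8) (V 9))
  (ELet 11 (ECall4 emb_e (EFst (V 10)) (ELit (code_circuit Kf)) (V 8) (V 9))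
  (ELet 12 (EHd (ESnd (V 11)))
  (ELet 13 (ESnd (ESnd (V 11)))
  (ELet 14 (ECall4 emb_e (EFst (V 11)) (V 1) (ECall2 cat_e (V 6) (ECall2 cat_e (V 7) (ESnd (V 10)))) (V 9))
  (ELet 15 (ECall2 split_e (V 0) (ESnd (V 14)))
  (ELet 16 (ECall2 split_e (ELit (code_unary a)) (ESnd (V 15)))
  (ELet 17 (ECall2 split_e (V 0) (ESnd (V 16)))
  (ELet 18 (ECall4 emb_e (EFst (V 14)) (ELit (code_circuit Kv1)) (ECall2 cat_e (V 8) (EFst (V 16))) (V 9))
  (ELet 19 (ECall4 emb_e (EFst (V 18)) (ELit (code_circuit Kv2)) (ECall2 cat_e (V 8) (ESnd (V 17))) (V 9))
  (ELet 20 (ECall5 mux_e (EFst (V 19)) (V 12) (V 13) (EFst (V 15)) (V 7))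
  (ELet 21 (ECall5 mux_e (EFst (V 20)) (V 12) (V 13) (EFst (V 17)) (V 6))
  (ETriple (ECall2 uadd_e (V 0) (ECall2 uadd_e (V 0) (ELit (code_unary w'))))
    (ESnd (EFst (V 21)))
    (ECall2 cat_e (ESnd (V 20)) (ECall2 cat_e (ESnd (V 18)) (ECall2 cat_e (ESnd (V 21)) (ESnd (V 19)))))
  ))))))))))))))))))))).
Lemma polye_ext : polye ext_e.
Proof. by rewrite /ext_e lock_eE; auto 200 with pe. Qed.

Lemma eval_ext r : size ofl = 2 ->
  eval ext_e ((0, code_unary n) :: (1, code_circuit E) :: r) = code_circuit ext_circuit.
Proof.
move=> szof; have Eof : ofl = [:: f; nf] by rewrite /f /nf; case: (ofl) szof => [|? [|? []]].
rewrite /ext_e lock_eE.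
apply: (eval_let_eq (v := CNode (code_nat n :: rev (map code_nat lo)))).
  by rewrite !evalE eval_range elems_unary.
apply: (eval_let_eq (v := CNode (code_nat (n + n) :: rev (map code_nat hi)))).
  by rewrite !evalE eval_range elems_unary.
apply: (eval_let_eq (v := CNode (code_nat F :: rev (map code_nat hs)))).
  by rewrite !evalE eval_range elems_unary.
apply: (eval_let_eq (v := CNode [:: cst b1 ([::] ++ [:: GConst false]); cnats [:: F]])).
  by rewrite !evalE (eval_emit F [::] [:: GConst false]).
apply: (eval_let_eq (v := cnats lo)); first by rewrite !evalE eval_rev [elems _]/= revK.
apply: (eval_let_eq (v := cnats hi)); first by rewrite !evalE eval_rev [elems _]/= revK.
apply: (eval_let_eq (v := cnats hs)); first by rewrite !evalE eval_rev [elems _]/= revK.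
apply: (eval_let_eq (v := code_nat F)); first by [].
apply: (eval_let_eq (v := CNode [:: cst b2 g1; cnats oh])); first by rewrite !evalE; exact: eval_emb.
apply: (eval_let_eq (v := CNode [:: cst b3 g2; cnats ofl])); first by rewrite !evalE; exact: eval_emb.
apply: (eval_let_eq (v := code_nat f)); first by rewrite Eof.
apply: (eval_let_eq (v := code_nat nf)); first by rewrite Eof.
apply: (eval_let_eq (v := CNode [:: cst b4 g3; cnats oE])).
  rewrite !evalE !eval_cat ![elems _]/= -!map_cat; exact: eval_emb.
apply: (eval_let_eq (v := CNode [:: cnats O1; cnats (drop n oE)])).
  by rewrite !evalE eval_split elems_unary ?size_map ?szE; [rewrite -map_take -map_drop|lia].
apply: (eval_let_eq (v := CNode [:: cnats H1; cnats (drop a (drop n oE))])).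
  by rewrite !evalE eval_split elems_unary ?size_map ?size_drop ?szoE; [rewrite -map_take -map_drop|lia].
apply: (eval_let_eq (v := CNode [:: cnats O2; cnats H2])).
  by rewrite !evalE eval_split elems_unary ?size_map ?size_drop ?szoE; [rewrite -map_take -map_drop|lia].
apply: (eval_let_eq (v := CNode [:: cst b5 g4; cnats v1])).
  rewrite !evalE !eval_cat ![elems _]/= -!map_cat; exact: eval_emb.
apply: (eval_let_eq (v := CNode [:: cst b6 g5; cnats v2])).
  rewrite !evalE !eval_cat ![elems _]/= -!map_cat; exact: eval_emb.
apply: (eval_let_eq (v := CNode [:: cst b7 g6; cnats M1])).
  by rewrite !evalE [lookup _ _]/= /chd /= eval_mux ?szO1 ?size_iota.
apply: (eval_let_eq (v := CNode [:: cst (b7 + n + n + n) g7; cnats M2])).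
  by rewrite !evalE /chd /= eval_mux ?szO2 ?size_iota.
rewrite !evalE ![lookup _ _]/= !eval_uadd !elems_unary !eval_cat /chd /= -!map_cat.
by rewrite /code_circuit /= addnA.
Qed.
End Circuit.
End ExtendEdges.

Lemma table_circuit2 p q r (f : seq bool -> seq bool -> seq bool) : (forall x y, size (f x y) = r) ->
  exists C, size (couts C) = r /\
    forall x y, size x = p -> size y = q -> circ_eval C (x ++ y) = f x y.
Proof.
move=> Hf; have [|C [_ sC evC]] := @table_circuit (p + q) r (fun x => f (take p x) (drop p x)).
  by move=> x _; exact: Hf.
exists C; split=> // x y sx sy; rewrite evC ?size_cat ?sx ?sy //.
by rewrite -sx take_size_cat // drop_size_cat.
Qed.

Lemma ext_circuits k : let w' := width 'C(k.+1, 2) in let w := width 'C(k, 2) in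
  let a := up_log 2 k in let a' := up_log 2 k.+1 in
  exists K1 Kf Kv1 Kv2 : circuit,
  [/\ [/\ size (couts Kf) = 2, size (couts Kv1) = a' & size (couts Kv2) = a'],
    forall x, size x = w' -> circ_eval K1 x =
      bits_of w (if nat_of_bits x == 'C(k.+1, 2) then 'C(k, 2) else nat_of_bits x),
    forall x, size x = w' -> circ_eval Kf x =
      [:: old_edge k (nat_of_bits x); ~~ old_edge k (nat_of_bits x)],
    forall x y, size x = w' -> size y = a -> circ_eval Kv1 (x ++ y) =
      bits_of a' (if old_edge k (nat_of_bits x) then nat_of_bits y %% k else nat_of_bits x - 'C(k, 2)) &
    forall x y, size x = w' -> size y = a -> circ_eval Kv2 (x ++ y) =
      bits_of a' (if old_edge k (nat_of_bits x) then nat_of_bits y %% k else k)].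
Proof.
move=> w' w a a'.
have [|K1 [_ _ ev1]] := @table_circuit w' w (fun x => bits_of w (if nat_of_bits x == 'C(k.+1, 2) then 'C(k, 2) else nat_of_bits x)).
  by move=> x _; exact: size_bits_of.
have [|Kf [_ sf evf]] := @table_circuit w' 2 (fun x => [:: old_edge k (nat_of_bits x); ~~ old_edge k (nat_of_bits x)]).
  by [].
have [|Kv1 [sv1 evv1]] := @table_circuit2 w' a a' (fun x y => bits_of a' (if old_edge k (nat_of_bits x) then nat_of_bits y %% k else nat_of_bits x - 'C(k, 2))).
  by move=> x y; exact: size_bits_of.
have [|Kv2 [sv2 evv2]] := @table_circuit2 w' a a' (fun x y => bits_of a' (if old_edge k (nat_of_bits x) then nat_of_bits y %% k else k)).
  by move=> x y; exact: size_bits_of.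
by exists K1, Kf, Kv1, Kv2.
Qed.

(** * Old and new indices of the extended edge list *)

Definition high (n i : nat) : nat := i %/ 2 ^ n %/ 2 ^ n.
(* The last index of the new instance lists the last old edge. *)
Definition old_index (k n i : nat) : nat :=
  if high n i == 'C(k.+1, 2) then 'C(k, 2) * (2 ^ n * 2 ^ n) else i.

Lemma max_edge_indexE k n : max_edge_index k n = 'C(k, 2) * (2 ^ n * 2 ^ n).
Proof. by rewrite /max_edge_index mul2n -addnn expnD. Qed.

Section ExtendedEdges.
Variables (k n : nat) (E : circuit).
Hypothesis k1 : 1 < k.
Let m := 'C(k, 2).
Let m' := 'C(k.+1, 2).
Let w := width m.
Let w' := width m'.
Let a := up_log 2 k.
Let a' := up_log 2 k.+1.
Variables K1 Kf Kv1 Kv2 : circuit.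
Hypothesis szf : size (couts Kf) = 2.
Hypothesis szv1 : size (couts Kv1) = a'.
Hypothesis szv2 : size (couts Kv2) = a'.
Hypothesis ev1 : forall x, size x = w' -> circ_eval K1 x =
  bits_of w (if nat_of_bits x == m' then m else nat_of_bits x).
Hypothesis evf : forall x, size x = w' -> circ_eval Kf x =
  [:: old_edge k (nat_of_bits x); ~~ old_edge k (nat_of_bits x)].
Hypothesis evv1 : forall x y, size x = w' -> size y = a -> circ_eval Kv1 (x ++ y) =
  bits_of a' (if old_edge k (nat_of_bits x) then nat_of_bits y %% k else nat_of_bits x - m).
Hypothesis evv2 : forall x y, size x = w' -> size y = a -> circ_eval Kv2 (x ++ y) =
  bits_of a' (if old_edge k (nat_of_bits x) then nat_of_bits y %% k else k).
Hypothesis vE : edge_valid k n E.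

Let E' := ext_circuit k K1 Kf Kv1 Kv2 n E.
Let e := edge_of k n E.
Let e' := edge_of k.+1 n E'.
Let old i := old_edge k (high n i).
Let N' := max_edge_index k.+1 n.
Let iota' := old_index k n.
Let k0 : 0 < k := ltnW k1.

Let szE : size (couts E) = n + a + (n + a).
Proof. by case: vE => _; rewrite vwidthE // addnn. Qed.
Let m'E : m' = m + k. Proof. by rewrite /m' binS bin1. Qed.
Let p0 : 0 < 2 ^ n. Proof. by rewrite expn_gt0. Qed.
Let N'E : N' = m' * (2 ^ n * 2 ^ n). Proof. exact: max_edge_indexE. Qed.
Let m0 : 0 < m. Proof. by rewrite bin_gt0. Qed.

Lemma ext_valid : edge_valid k.+1 n E'.
Proof.
split; first by rewrite ewidthE.
rewrite vwidthE // /E' /ext_circuit /= !size_cat !size_iota !size_emb_outs szv1 szv2.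
rewrite -/a' !size_takel ?size_drop ?size_emb_outs ?szE; lia.
Qed.

Let high_le i : i <= N' -> high n i <= m'.
Proof. by move=> le; rewrite /high -divnMA -(mulnK m' (_ : 0 < 2 ^ n * 2 ^ n)) ?muln_gt0 ?p0 // leq_div2r // -N'E. Qed.

Let highE i : i <= N' -> i = i %% 2 ^ n + 2 ^ n * (i %/ 2 ^ n %% 2 ^ n + 2 ^ n * high n i).
Proof. by rewrite /high {1}(divn_eq i (2 ^ n)) {1}(divn_eq (i %/ 2 ^ n) (2 ^ n)); lia. Qed.

Let high_last i : i <= N' -> high n i = m' -> i = N'.
Proof. by move=> le Eh; have := highE le; rewrite Eh N'E; move: le; rewrite N'E; nia. Qed.

Let bitsE i v : bits_of (n + n + v) i = bits_of n i ++ bits_of n (i %/ 2 ^ n) ++ bits_of v (high n i).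
Proof. by rewrite -addnA !bits_of_cat. Qed.

Let nat_high i : i <= N' -> nat_of_bits (bits_of w' (high n i)) = high n i.
Proof. by move=> le; apply: bits_of_small; apply: leq_ltn_trans (high_le le) (width_lt _). Qed.

Lemma old_bits i : i <= N' -> old i ->
  bits_of n i ++ bits_of n (i %/ 2 ^ n) ++ bits_of w (if high n i == m' then m else high n i) =
  bits_of (cin E) (iota' i).
Proof.
move=> le oi; case: vE => -> _; rewrite ewidthE // -/w bitsE /iota' /old_index.
case: eqP => Eh //; rewrite (high_last le Eh) N'E -/m.
(* Both last indices have vanishing low words, so exchanging the high part is enough. *)
have Z x : bits_of n (x * 2 ^ n) = bits_of n 0 by rewrite -bits_of_mod modnMl.
have HH x : high n (x * (2 ^ n * 2 ^ n)) = x by rewrite /high -divnMA mulnK // muln_gt0 p0.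
by rewrite HH !mulnA !Z !mulnK // !Z.
Qed.

Lemma lt_vertices v : v < k * 2 ^ n -> v < k.+1 * 2 ^ n. Proof. by rewrite mulSn; lia. Qed.

Lemma ext_edge_old i : i <= N' -> old i -> e' i = e (iota' i).
Proof.
move=> le oi; set out := circ_eval E (bits_of (cin E) (iota' i)).
have szo : size out = n + a + (n + a) by rewrite size_map.
have Eo : circ_eval E' (bits_of (cin E') i) =
   (take n out ++ bits_of a' (nat_of_bits (take a (drop n out)) %% k)) ++
   (take n (drop a (drop n out)) ++ bits_of a' (nat_of_bits (drop n (drop a (drop n out))) %% k)).
  rewrite [cin E']/= bitsE (ext_circuit_eval k1 ev1 evf evv1 evv2 szE) ?size_bits_of // nat_high //.
  by rewrite -/(old i) oi old_bits // -!catA.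
have lt1 x : nat_of_bits x %% k < 2 ^ a'.
  by apply: leq_trans (klea k.+1); have := ltn_pmod (nat_of_bits x) k0; lia.
have [st1 st2] : size (take n out) = n /\ size (take n (drop a (drop n out))) = n.
  by rewrite !size_takel ?size_drop ?szo //; lia.
have nv s t : size s = n -> nat_of_bits (s ++ bits_of a' (nat_of_bits t %% k)) = nat_of_bits (s ++ t) %% nverts k n.
  move=> ss; rewrite !nat_of_bits_cat ss bits_of_small // modn_vertex //.
  by rewrite -ss nat_of_bits_lt.
have := @edge_of_pair k.+1 n _ _ _ _ E' i _ Eo _ (nv _ _ st1) (nv _ _ st2).
rewrite -takeD cat_take_drop drop_drop [a + n]addnC => H.
rewrite /e' H //; first by rewrite /e /edge_of vwidthE // -/a.
- by rewrite size_cat st1 size_bits_of.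
- by apply: lt_vertices; rewrite ltn_pmod // muln_gt0 k0.
- by apply: lt_vertices; rewrite ltn_pmod // muln_gt0 k0.
Qed.

Lemma ext_edge_new i : i <= N' -> ~~ old i ->
  [/\ m <= high n i < m' &
   e' i = (i %/ 2 ^ n %% 2 ^ n + 2 ^ n * (high n i - m), i %% 2 ^ n + 2 ^ n * k)].
Proof.
move=> le oi.
have hb : m <= high n i < m'.
  by have := high_le le; move: oi; rewrite /old /old_edge negb_or -/m -/m'; lia.
split=> //.
have Eo : circ_eval E' (bits_of (cin E') i) =
   (bits_of n (i %/ 2 ^ n) ++ bits_of a' (high n i - m)) ++ (bits_of n i ++ bits_of a' k).
  rewrite [cin E']/= bitsE (ext_circuit_eval k1 ev1 evf evv1 evv2 szE) ?size_bits_of // nat_high //.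
  by rewrite -/(old i) (negbTE oi) -!catA.
have lt1 x : x <= k -> x < 2 ^ a' by move=> lx; apply: leq_trans (klea k.+1).
have lm x : x %% 2 ^ n < 2 ^ n by rewrite ltn_mod.
apply: (edge_of_pair _ Eo) => //.
- by rewrite size_cat !size_bits_of.
- by rewrite nat_of_bits_cat size_bits_of nat_of_bits_of bits_of_small //; apply: lt1; lia.
- by rewrite nat_of_bits_cat size_bits_of nat_of_bits_of bits_of_small //; apply: lt1.
- by have := lm (i %/ 2 ^ n); have : high n i - m < k by [lia]; move: (2 ^ n) (_ - m) (_ %% _) => p x y; nia.
- by have := lm i; move: (2 ^ n) (_ %% _) => p y; nia.
Qed.

Lemma edge_lt i : (e i).1 < nverts k n /\ (e i).2 < nverts k n.
Proof. by rewrite /e /edge_of !ltn_pmod // muln_gt0 k0. Qed.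

Lemma ext_edge_lt i : i <= N' -> (e' i).1 < nverts k n.
Proof.
move=> le; case oi : (old i).
  by rewrite ext_edge_old //; case: (edge_lt (iota' i)).
have [|hb ->] := ext_edge_new le; first by rewrite oi.
rewrite /= /nverts; have : i %/ 2 ^ n %% 2 ^ n < 2 ^ n by rewrite ltn_mod.
have : high n i - m < k by lia.
by move: (2 ^ n) (_ - m) (_ %% _) => p x y; nia.
Qed.

(** The first endpoint is always old, so the second one alone reveals from the edge whether its
    index is old. *)
Lemma ext_edge_old_lt i : i <= N' -> ((e' i).2 < nverts k n) = old i.
Proof.
move=> le; case oi : (old i); first by rewrite ext_edge_old //; case: (edge_lt (iota' i)).
by have [|hb ->] := ext_edge_new le; [rewrite oi|rewrite /= /nverts mulnC ltnNge leq_addl].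
Qed.

Lemma old_index_le i : i <= N' -> old i -> iota' i <= max_edge_index k n.
Proof.
move=> le; rewrite /old /old_edge /iota' /old_index -/m' max_edge_indexE -/m.
case: eqP => // Eh; rewrite orbF -/m /high -divnMA => lt.
by apply: ltnW; rewrite -ltn_divLR // muln_gt0 p0.
Qed.

Lemma old_index_inj i j : i <= N' -> j <= N' -> old i -> old j -> iota' i = iota' j -> i = j.
Proof.
move=> li lj; rewrite /old /old_edge /iota' /old_index -/m' -/m.
have lt x : high n x < m -> x < m * (2 ^ n * 2 ^ n).
  by rewrite /high -divnMA ltn_divLR // muln_gt0 p0.
case: (eqVneq (high n i) m') => [Ei|_]; case: (eqVneq (high n j) m') => [Ej|_] //.
- by rewrite (high_last li Ei) (high_last lj Ej).
- by rewrite orbF => _ /lt; lia.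
- by rewrite orbF => /lt; lia.
Qed.

(** The crossed case would identify an old with a new vertex. Otherwise the first endpoint
    determines [y] and [h], and the second determines [x]. *)
Lemma new_edge_inj i j : i <= N' -> j <= N' -> ~~ old i -> ~~ old j -> same_pair (e' i) (e' j) -> i = j.
Proof.
move=> li lj oi oj.
have [hi Ei] := ext_edge_new li oi; have [hj Ej] := ext_edge_new lj oj.
have L1 := ext_edge_lt li; have L2 : ~~ ((e' j).2 < nverts k n) by rewrite ext_edge_old_lt.
move=> /orP[/andP[/eqP E1 /eqP E2]|/andP[/eqP E1 _]]; last by rewrite E1 in L1; rewrite L1 in L2.
rewrite (highE li) (highE lj); rewrite Ei Ej /= in E1 E2.
have inj x y z t : x < 2 ^ n -> z < 2 ^ n -> x + 2 ^ n * y = z + 2 ^ n * t -> x = z /\ y = t.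
  move=> lx lz Eq; have := congr1 (fun u => u %/ 2 ^ n) Eq; have := congr1 (fun u => u %% 2 ^ n) Eq.
  by rewrite /= ![_ + 2 ^ n * _]addnC ![2 ^ n * _]mulnC !modnMDl !divnMDl // !modn_small // !divn_small // !addn0.
have lm x : x %% 2 ^ n < 2 ^ n by rewrite ltn_mod.
have [F1 F2] := inj _ _ _ _ (lm _) (lm _) E1; have [F3 _] := inj _ _ _ _ (lm _) (lm _) E2.
by rewrite F1 F3 (_ : high n i = high n j) //; lia.
Qed.

Lemma ext_dup i j : i <= N' -> j <= N' -> i <> j -> same_pair (e' i) (e' j) ->
  [/\ iota' i <= max_edge_index k n, iota' j <= max_edge_index k n, iota' i <> iota' j &
      same_pair (e (iota' i)) (e (iota' j))].
Proof.
move=> li lj nij sp.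
have L1 := ext_edge_lt li; have L2 := ext_edge_lt lj.
have L3 := ext_edge_old_lt li; have L4 := ext_edge_old_lt lj.
(* An unordered pair contains a new vertex or not, and this decides the kind of either index. *)
have Eo : old i = old j.
  move: sp => /orP[/andP[/eqP E1 /eqP E2]|/andP[/eqP E1 /eqP E2]]; first by rewrite -L3 -L4 E2.
  by rewrite -L3 -L4 E2 -E1 L1 L2.
case oi : (old i) Eo => /esym oj.
  split; [exact: old_index_le|exact: old_index_le| |by rewrite -!ext_edge_old].
  by move=> E1; apply: nij; exact: old_index_inj E1.
by case: nij; apply: new_edge_inj; rewrite ?oi ?oj.
Qed.

Lemma ext_loop i : i <= N' -> (e' i).1 = (e' i).2 ->
  [/\ old i, iota' i <= max_edge_index k n & (e (iota' i)).1 = (e (iota' i)).2].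
Proof.
move=> le El; have oi : old i by rewrite -ext_edge_old_lt // -El ext_edge_lt.
by split=> //; [exact: old_index_le|rewrite -ext_edge_old].
Qed.
End ExtendedEdges.

(** * From k-Turan to (k+1)-Turan *)

Definition incident (e : nat -> nat * nat) (z i : nat) : bool := ((e i).1 == z) || ((e i).2 == z).

Definition is_clique (e : nat -> nat * nat) (q : nat) (Ix W : seq nat) : Prop :=
  [/\ uniq Ix, size Ix = 'C(q, 2), uniq W, size W = q &
    all (fun i => ((e i).1 \in W) && ((e i).2 \in W)) Ix /\
    (forall u v, u \in W -> v \in W -> u <> v -> exists2 i, i \in Ix & same_pair (e i) (u, v))].

Section RemoveVertex.
Variables (e : nat -> nat * nat) (q : nat) (Ix W : seq nat) (z : nat).
Hypothesis cl : is_clique e q.+1 Ix W.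
Hypothesis zW : z \in W.

Let uI : uniq Ix. Proof. by case: cl. Qed.
Let uW : uniq W. Proof. by case: cl. Qed.
Let sW : size W = q.+1. Proof. by case: cl. Qed.
Let inW i : i \in Ix -> (e i).1 \in W /\ (e i).2 \in W.
Proof. by case: cl => _ _ _ _ [/allP H _] /H /andP. Qed.

(* Edges as two-element sets of positions in [W]; as many indices as pairs,
   so the map is a bijection. *)
Let pos (v : nat) : 'I_q.+1 := inord (index v W).
Let pr (i : nat) : {set 'I_q.+1} := [set pos (e i).1; pos (e i).2].
Let pairs : seq {set 'I_q.+1} := enum [set A : {set 'I_q.+1} | #|A| == 2].

Let pos_inj u v : u \in W -> v \in W -> pos u = pos v -> u = v.
Proof.
move=> uiW viW /(congr1 val); rewrite /= !inordK -?sW ?index_mem // => E.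
by rewrite -(nth_index 0 uiW) E nth_index.
Qed.

Let perm_pairs : perm_eq (map pr Ix) pairs.
Proof.
have szp : size pairs = 'C(q.+1, 2) by rewrite /pairs -cardE card_draws card_ord.
have sub : {subset pairs <= map pr Ix}.
  move=> A; rewrite mem_enum inE => /cards2P[x [y [nxy ->]]].
  pose u := nth 0 W x; pose v := nth 0 W y.
  have lt (o : 'I_q.+1) : o < size W by rewrite sW.
  have Pu (o : 'I_q.+1) : pos (nth 0 W o) = o.
    by apply: val_inj; rewrite /= inordK index_uniq // ltn_ord.
  have nuv : u <> v by move/eqP; rewrite nth_uniq // => /eqP /val_inj /eqP; rewrite (negbTE nxy).
  case: cl => _ _ _ _ [_ /(_ u v (mem_nth _ (lt x)) (mem_nth _ (lt y)) nuv) [i iI sp]].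
  apply/mapP; exists i => //; rewrite /pr.
  case/orP: sp => /= /andP[/eqP -> /eqP ->]; rewrite !Pu //; exact: setUC.
rewrite perm_sym; apply: uniq_perm; [exact: enum_uniq| |].
  apply: (leq_size_uniq (enum_uniq _) sub).
  by rewrite size_map szp; case: cl => _ ->.
apply: (uniq_min_size (enum_uniq _) sub _).2.
by rewrite size_map szp; case: cl => _ ->.
Qed.

(** A solution needs exactly the right number of indices, which covering all pairs would only bound
    from below. By the bijection between indices and pairs, the survivors correspond to the
    two-element subsets that avoid [z]. *)
Lemma remove_vertex : is_clique e q [seq i <- Ix | ~~ incident e z i] (rem z W).
Proof.
have memr v : (v \in rem z W) = (v != z) && (v \in W) by rewrite mem_rem_uniq.
split; [exact: filter_uniq| |exact: rem_uniq|by rewrite size_rem // sW|].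
- have -> : size [seq i <- Ix | ~~ incident e z i] = count (fun A : {set 'I_q.+1} => pos z \notin A) (map pr Ix).
    rewrite size_filter count_map; apply: eq_in_count => i iI /=.
    have [i1 i2] := inW iI; rewrite /pr !inE /incident; congr (~~ (_ || _)).
      by apply/eqP/eqP => [->|/pos_inj ->].
    by apply/eqP/eqP => [->|/pos_inj ->].
  rewrite (permP perm_pairs) -size_filter.
  have -> : size [seq A : {set 'I_q.+1} <- pairs | pos z \notin A] = #|[set A : {set 'I_q.+1} | A \subset ~: [set pos z] & #|A| == 2]|.
    rewrite cardE; apply: perm_size; apply: uniq_perm; [exact: filter_uniq (enum_uniq _)|exact: enum_uniq|move=> A].
    have Es : (A \subset ~: [set pos z]) = (pos z \notin A) by rewrite -{1}(setCK A) setCS sub1set inE.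
    by rewrite mem_filter !mem_enum inE inE Es.
  by rewrite cards_draws cardsC1 card_ord.
- split.
    apply/allP => i; rewrite mem_filter /incident negb_or => /andP[/andP[n1 n2] iI].
    by rewrite !memr n1 n2 /=; have [-> ->] := inW iI.
  move=> u v; rewrite !memr => /andP[nu uiW] /andP[nv viW] nuv.
  case: cl => _ _ _ _ [_ /(_ u v uiW viW nuv) [i iI sp]]; exists i => //.
  rewrite mem_filter iI andbT /incident.
  by case/orP: sp => /= /andP[/eqP -> /eqP ->]; rewrite (negbTE nu) (negbTE nv).
Qed.
End RemoveVertex.

Lemma clique_reindex e e' (f : nat -> nat) q Ix W : {in Ix &, injective f} ->
  (forall i, i \in Ix -> e' i = e (f i)) -> is_clique e' q Ix W -> is_clique e q (map f Ix) W.
Proof.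
move=> fi Ee [uI sI uW sW [inW cov]]; split=> //; first by rewrite map_inj_in_uniq.
  by rewrite size_map.
split.
  apply/allP => _ /mapP[i iI ->]; rewrite -Ee //; exact: (allP inW).
move=> u v uiW viW nuv; have [i iI sp] := cov u v uiW viW nuv.
by exists (f i); [exact: map_f|rewrite -Ee].
Qed.

Definition zadd_e : expr := EFold 10 11 (V 0) (V 1) (EBc false (V 11)).
(** Multiplication by [2 ^ n] puts [n] zeros in front. For [c = 0] the result would be a nonempty
    word of zeros, which is no [code_nat]. *)
Lemma eval_zadd n c r : 0 < c -> eval zadd_e ((0, code_unary n) :: (1, code_nat c) :: r) = code_nat (c * 2 ^ n).
Proof.
rewrite /zadd_e eval_fold !evalE /= => c0.
elim: n => [|n IH] /= in c c0 *; first by rewrite muln1.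
have -> : eval (EBc false (V 11)) [:: (11, code_nat c), (10, CLeaf [:: true]), (0, code_unary n.+1), (1, code_nat c) & r] = code_nat (c * 2).
  rewrite evalE /= /code_nat /=; case: c c0 => // c _; congr CLeaf.
  by rewrite muln2 doubleS [RHS]binE -doubleS odd_double doubleK.
have := IH (c * 2); rewrite muln_gt0 c0 -mulnA -expnS => /(_ isT) <-.
by [].
Qed.
Lemma polye_zadd : polye zadd_e.
Proof.
apply: (polye_fold_aff (k := 2)); auto with pe.
by move=> r v u; rewrite !evalE /=; have := csz_bcons false v; lia.
Qed.
#[export] Hint Resolve polye_zadd : pe.

Section TuranReduction.
Variables (k : nat).
Hypothesis k1 : 1 < k.
Let m := 'C(k, 2).
Let m' := 'C(k.+1, 2).
Let k0 : 0 < k := ltnW k1.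

Definition old_index_e : expr := lock_e
  (EIfT (ECall2 eq_e (EThd (ECall2 coords_e (V 0) (V 1))) (ELit (code_nat m')))
    (ECall2 zadd_e (V 0) (ECall2 zadd_e (V 0) (ELit (code_nat m)))) (V 1)).
Lemma eval_old_index n i r :
  eval old_index_e ((0, code_unary n) :: (1, code_nat i) :: r) = code_nat (old_index k n i).
Proof.
rewrite /old_index_e lock_eE !evalE eval_coords eval_eq /chd /= ctrue_cb tb_nat_eq.
rewrite !eval_zadd ?muln_gt0 ?expn_gt0 ?bin_gt0 // ?k1 //.
by rewrite /old_index /high -/m -/m'; case: (_ == m'); rewrite ?mulnA.
Qed.
Lemma polye_old_index : polye old_index_e.
Proof. by rewrite /old_index_e lock_eE; auto 40 with pe. Qed.
Hint Resolve polye_old_index : pe.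

Variables KM Kf : circuit.
Hypothesis szM : size (couts KM) = up_log 2 k.
Hypothesis evM : forall x, size x = up_log 2 k -> circ_eval KM x = bits_of (up_log 2 k) (nat_of_bits x %% k).
Hypothesis evf : forall x, size x = width m' -> circ_eval Kf x =
  [:: old_edge k (nat_of_bits x); ~~ old_edge k (nat_of_bits x)].

Definition is_new_e : expr := lock_e
  (ESnd (ECall2 evalc_e (ELit (code_circuit Kf))
    (pad_e (ELit (code_unary (width m'))) (EThd (ECall2 coords_e (V 0) (V 1)))))).
Lemma eval_is_new n i r : high n i <= m' ->
  ctrue (eval is_new_e ((0, code_unary n) :: (1, code_nat i) :: r)) = ~~ old_edge k (high n i).
Proof.
move=> le; rewrite /is_new_e lock_eE eval_snd eval_call2 eval_lit eval_evalc.
rewrite (eval_pad (m := width m') (i := high n i)) //; last by rewrite !evalE eval_coords.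
rewrite evf ?size_bits_of // bits_of_small /=; last exact: leq_ltn_trans le (width_lt _).
by rewrite /chd /= ctrue_cb.
Qed.
Lemma polye_is_new : polye is_new_e.
Proof. by rewrite /is_new_e lock_eE; auto 40 with pe. Qed.
Hint Resolve polye_is_new : pe.

(* [0]: instance, [1]: index of an old edge, [2]: vertex. *)
Definition avoids_e : expr := lock_e
  (ELet 3 (ECall3 (verts_e k KM) (EFst (V 0)) (ESnd (V 0)) (V 1))
    (EIfT (ECall2 eq_e (V 2) (EFst (V 3))) EF (EIfT (ECall2 eq_e (V 2) (ESnd (V 3))) EF ET))).
Lemma eval_avoids I i z vz r : tu_valid k I -> z < nverts k (tu_n I) ->
  tb vz = bits_of (tu_n I + up_log 2 k) z ->
  ctrue (eval avoids_e ((0, code_tu_inst I) :: (1, code_nat i) :: (2, vz) :: r)) =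
  ~~ incident (edge_of k (tu_n I) (tu_E I)) z i.
Proof.
move=> vI lz Ez; have [w1 [w2 [Ev E1 E2]]] := eval_verts k0 szM evM i [::] vI.
set e := edge_of _ _ _ in E1 E2 *; have [l1 l2] := edge_lt (tu_n I) (tu_E I) k1 i.
have vlt v : v < nverts k (tu_n I) -> v < 2 ^ (tu_n I + up_log 2 k).
  by move=> lv; apply: leq_trans lv _; rewrite /nverts expnD mulnC leq_mul2l klea orbT.
have beq v : v < nverts k (tu_n I) ->
   (bits_of (tu_n I + up_log 2 k) z == bits_of (tu_n I + up_log 2 k) v) = (v == z).
  move=> lv; apply/eqP/eqP => [/(congr1 nat_of_bits)|-> //].
  by rewrite !bits_of_small ?vlt.
suff -> : eval avoids_e ((0, code_tu_inst I) :: (1, code_nat i) :: (2, vz) :: r) = cb (~~ incident e z i) by rewrite ctrue_cb.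
rewrite /avoids_e lock_eE; apply: (eval_let_eq (v := CNode [:: w1; w2])); first by rewrite !evalE; exact: Ev.
rewrite !evalE !eval_eq ![lookup _ _]/= /chd /= !ctrue_cb Ez E1 E2 !beq // /incident.
by case: (_ == z) => //; case: (_ == z).
Qed.
Lemma polye_avoids : polye avoids_e.
Proof. by rewrite /avoids_e lock_eE; auto 40 with pe. Qed.
Hint Resolve polye_avoids : pe.

Definition turan_clique_e : expr := lock_e
  (ELet 2 (EFst (V 0))
  (EIfNil (filter_e (ECall2 is_new_e (V 2) (V 98)) (V 1))
    (ELet 3 (map_e 10 (ECall2 old_index_e (V 2) (V 10)) (V 1))
    (ELet 4 (EFst (ECall3 (verts_e k KM) (V 2) (ESnd (V 0)) (EHd (V 3))))
      (filter_e (ECall3 avoids_e (V 0) (V 98) (V 4)) (V 3))))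
    (map_e 10 (ECall2 old_index_e (V 2) (V 10))
      (filter_e (EIfT (ECall2 is_new_e (V 2) (V 98)) EF ET) (V 1))))).
Lemma polye_turan_clique : polye turan_clique_e.
Proof. by rewrite /turan_clique_e lock_eE; auto 60 with pe. Qed.
Hint Resolve polye_turan_clique : pe.

Definition turan_g_e : expr := lock_e
  (ELet 1 (EFst (V 0)) (ELet 2 (ESnd (V 0)) (ELet 3 (EFst (V 1))
    (EIfNil (EHd (V 2)) (EPair (ELit (code_nat 0)) (ECall2 old_index_e (V 3) (ESnd (V 2))))
      (EIfT (EHd (V 2))
        (ETriple (ELit (code_nat 1)) (ECall2 old_index_e (V 3) (ESnd (V 2))) (ECall2 old_index_e (V 3) (EThd (V 2))))
        (EPair (ELit (code_nat 2)) (ECall2 turan_clique_e (V 1) (ESnd (V 2))))))))).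
Lemma polye_turan_g : polye turan_g_e.
Proof. by rewrite /turan_g_e lock_eE; auto 60 with pe. Qed.

(** Without new edges all [k + 2] vertices are old, and the first endpoint of the first listed edge
    is removed. Otherwise there is exactly one new vertex, and keeping the old edges is the same as
    removing that vertex. *)
Definition old_clique (n : nat) (E : circuit) (Ix : seq nat) : seq nat :=
  let isnew i := ~~ old_edge k (high n i) in
  if [seq i <- Ix | isnew i] is [::] then
    let J := map (old_index k n) Ix in
    [seq j <- J | ~~ incident (edge_of k n E) (edge_of k n E (head 0 J)).1 j]
  else map (old_index k n) [seq i <- Ix | ~~ isnew i].

Lemma eval_turan_clique I Ix r : tu_valid k I -> Ix != [::] ->
  (forall i, i \in Ix -> high (tu_n I) i <= m') ->
  eval turan_clique_e ((0, code_tu_inst I) :: (1, cnats Ix) :: r) =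
  cnats (old_clique (tu_n I) (tu_E I) Ix).
Proof.
set n := tu_n I; move=> vI nI hi; rewrite /turan_clique_e lock_eE.
apply: (eval_let_eq (v := code_unary n)); first by [].
set r1 := _ :: _.
have filt (F : expr) (p : pred nat) r2 : (forall i, i \in Ix -> ctrue (eval F ((98, code_nat i) :: r2)) = p i) ->
    [seq u <- map code_nat Ix | ctrue (eval F ((98, u) :: r2))] = map code_nat [seq i <- Ix | p i].
  by move=> H; rewrite filter_map; congr map; apply: eq_in_filter => i /H.
have mapi r2 l : lookup r2 2 = code_unary n ->
    [seq eval (ECall2 old_index_e (V 2) (V 10)) ((10, u) :: r2) | u <- map code_nat l] = map code_nat (map (old_index k n) l).
  move=> L2; rewrite -!map_comp; apply: eq_map => i /=; rewrite !evalE [lookup _ 2]/= L2 eval_old_index //.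
rewrite eval_ifnil eval_filter -[elems _]/(map code_nat Ix) (filt _ (fun i => ~~ old_edge k (high n i))); last first.
  by move=> i iI; rewrite !evalE; apply: eval_is_new; exact: hi.
rewrite /old_clique; case Ef : [seq i <- Ix | ~~ old_edge k (high n i)] => [|c cs]; rewrite /cisnil /=.
  have [j [js EJ]] : exists j js, map (old_index k n) Ix = j :: js.
    by case: (Ix) nI => // i ix _; do 2 eexists.
  apply: (eval_let_eq (v := cnats (map (old_index k n) Ix))).
    by rewrite eval_map -[elems _]/(map code_nat Ix) mapi.
  have [w1 [w2 [Ev E1 E2]]] := eval_verts k0 szM evM j [::] vI.
  apply: (eval_let_eq (v := w1)).
    rewrite !evalE EJ; have := Ev; rewrite /r1 /= => Ev'.
    by rewrite [eval _ _](_ : _ = CNode [:: w1; w2]) //.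
  rewrite eval_filter -[elems _]/(map code_nat (map (old_index k n) Ix)) filter_code_nat.
  have [l1 l2] := edge_lt n (tu_E I) k1 j.
  have -> : head 0 (map (old_index k n) Ix) = j by rewrite EJ.
  rewrite /cnats; congr (CNode (map _ _)); apply: eq_filter => i.
  by rewrite !evalE (eval_avoids _ _ vI l1).
rewrite eval_map eval_filter -[elems (eval (V 1) _)]/(map code_nat Ix).
rewrite (filt _ (fun i => ~~ ~~ old_edge k (high n i))); last first.
  move=> i iI; rewrite !evalE -(eval_is_new [::] (hi i iI)).
  by case: (ctrue (eval is_new_e _)).
by rewrite -[elems _]/(map code_nat _) mapi.
Qed.
End TuranReduction.

Section TuranStep.
Variable k : nat.
Hypothesis k1 : 1 < k.
Let m := 'C(k, 2).
Let m' := 'C(k.+1, 2).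
Let w := width m.
Let w' := width m'.
Let a := up_log 2 k.
Let a' := up_log 2 k.+1.
Let k0 : 0 < k := ltnW k1.
Variables KM K1 Kf Kv1 Kv2 : circuit.
Hypothesis szM : size (couts KM) = a.
Hypothesis evM : forall x, size x = a -> circ_eval KM x = bits_of a (nat_of_bits x %% k).
Hypothesis szf : size (couts Kf) = 2.
Hypothesis szv1 : size (couts Kv1) = a'.
Hypothesis szv2 : size (couts Kv2) = a'.
Hypothesis ev1 : forall x, size x = w' -> circ_eval K1 x =
  bits_of w (if nat_of_bits x == m' then m else nat_of_bits x).
Hypothesis evf : forall x, size x = w' -> circ_eval Kf x =
  [:: old_edge k (nat_of_bits x); ~~ old_edge k (nat_of_bits x)].
Hypothesis evv1 : forall x y, size x = w' -> size y = a -> circ_eval Kv1 (x ++ y) =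
  bits_of a' (if old_edge k (nat_of_bits x) then nat_of_bits y %% k else nat_of_bits x - m).
Hypothesis evv2 : forall x y, size x = w' -> size y = a -> circ_eval Kv2 (x ++ y) =
  bits_of a' (if old_edge k (nat_of_bits x) then nat_of_bits y %% k else k).

Lemma high_leq n i : i <= max_edge_index k.+1 n -> high n i <= m'.
Proof.
move=> le; rewrite /high -divnMA -(mulnK m' (_ : 0 < 2 ^ n * 2 ^ n)) ?muln_gt0 ?expn_gt0 //.
by rewrite leq_div2r // -max_edge_indexE.
Qed.

Section Instance.
Variable I : tu_inst.
Hypothesis vI : tu_valid k I.
Let n := tu_n I.
Let E := tu_E I.
Let E' := ext_circuit k K1 Kf Kv1 Kv2 n E.
Let e := edge_of k n E.
Let e' := edge_of k.+1 n E'.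
Let N' := max_edge_index k.+1 n.
Let old i := old_edge k (high n i).
Let eold := @ext_edge_old k n E k1 K1 Kf Kv1 Kv2 szf szv1 szv2 ev1 evf evv1 evv2 vI.
Let elt := @ext_edge_lt k n E k1 K1 Kf Kv1 Kv2 szf szv1 szv2 ev1 evf evv1 evv2 vI.
Let eolt := @ext_edge_old_lt k n E k1 K1 Kf Kv1 Kv2 szf szv1 szv2 ev1 evf evv1 evv2 vI.

Lemma old_clique_ok Ix : tu_is_sol k.+1 (TUInst n E') (TUClique Ix) ->
  tu_is_sol k I (TUClique (old_clique k n E Ix)).
Proof.
move=> [uI sI /allP aI [W [uW sW inW cov]]].
have cl : is_clique e' k.+2 Ix W by split.
have inj (J : seq nat) : {subset J <= Ix} -> (forall i, i \in J -> old i) -> {in J &, injective (old_index k n)}.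
  by move=> sub oJ i j iJ jJ; apply: (old_index_inj k1 szf szv1 szv2 vI); by [apply/aI/sub|exact: oJ].
have sol J W' : is_clique e k.+1 J W' -> {in J, forall i, i <= max_edge_index k n} -> tu_is_sol k I (TUClique J).
  by move=> [uJ sJ uW' sW' [iW c]] leJ; split=> //; [apply/allP|exists W'].
rewrite /old_clique; case Ef : [seq i <- Ix | ~~ old_edge k (high n i)] => [|c cs].
  have oI i : i \in Ix -> old i.
    by move=> iI; apply: contraFT (in_nil i); rewrite -Ef mem_filter iI andbT.
  have clJ : is_clique e k.+2 (map (old_index k n) Ix) W.
    apply: clique_reindex cl; first by apply: inj.
    by move=> i iI; apply: eold; [exact: aI|exact: oI].
  have zW : (e (head 0 (map (old_index k n) Ix))).1 \in W.
    have : 0 < size (map (old_index k n) Ix) by rewrite size_map sI bin_gt0.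
    case: (map _ _) clJ => // j js [_ _ _ _ [/= /andP[/andP[-> _] _] _]] //.
  apply: (sol _ _ (remove_vertex clJ zW)) => j; rewrite mem_filter => /andP[_ /mapP[i iI ->]].
  by apply: old_index_le; [exact: aI|exact: oI].
have : c \in c :: cs by exact: mem_head.
rewrite -Ef mem_filter => /andP[nc cI]; set z := (e' c).2.
have big i : i \in Ix -> ~~ old i -> nverts k n <= (e' i).2.
  by move=> iI oi; rewrite leqNgt eolt ?aI.
have memW i : i \in Ix -> (e' i).2 \in W by move=> /(allP inW) /andP[].
(* A new edge that misses [z] would end in a second new vertex; the clique edge joining it to [z]
   would then have a new first endpoint, which [ext_edge_lt] forbids. *)
have Efl : [seq i <- Ix | ~~ ~~ old_edge k (high n i)] = [seq i <- Ix | ~~ incident e' z i].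
  apply: eq_in_filter => i iI; have le := aI i iI; rewrite negbK -/(old i) /incident.
  case oi : (old i).
    have l1 := elt le; have l2 := eolt le; have lz := big c cI nc.
    by apply/esym; rewrite negb_or; apply/andP; split; apply/eqP => Ez; move: lz;
       rewrite /z in Ez *; rewrite leqNgt -Ez ?l1 // eolt // -/(old i) oi.
  apply/esym/negbTE; rewrite negbK; apply/orP; right; apply/negPn/negP => /eqP nz.
  have [l lI sp] := cov _ _ (memW _ iI) (memW _ cI) nz.
  have := elt (aI l lI); rewrite -/e' in sp *.
  by case/orP: sp => /andP[/eqP -> _]; rewrite ltnNge big ?oi.
rewrite Efl; apply: (sol _ (rem z W)).
  apply: (clique_reindex (e' := e')); last exact: remove_vertex cl (memW _ cI).
    apply: inj; first by move=> i; rewrite mem_filter => /andP[].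
    by move=> i; rewrite -Efl mem_filter negbK => /andP[].
  by move=> i; rewrite -Efl mem_filter negbK => /andP[oi iI]; apply: eold => //; exact: aI.
move=> j /mapP[i]; rewrite -Efl mem_filter negbK => /andP[oi iI] ->.
by apply: old_index_le => //; exact: aI.
Qed.

Lemma turan_g_ok s : tu_is_sol k.+1 (TUInst n E') s -> exists s', tu_is_sol k I s' /\
  eval (turan_g_e k KM Kf) [:: (0, CNode [:: code_tu_inst I; code_tu_sol s])] = code_tu_sol s'.
Proof.
case: s => [i [li El]|i j [li lj nij sp]|Ix sol].
- exists (TULoop (old_index k n i)); split.
    by have [_ le E1] := ext_loop k1 szf szv1 szv2 ev1 evf evv1 evv2 vI li El; split.
  by rewrite /turan_g_e lock_eE !evalE eval_old_index.
- exists (TUDup (old_index k n i) (old_index k n j)); split.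
    by have := ext_dup k1 szf szv1 szv2 ev1 evf evv1 evv2 vI li lj nij sp; case.
  by rewrite /turan_g_e lock_eE !evalE !eval_old_index.
exists (TUClique (old_clique k n E Ix)); split; first exact: old_clique_ok.
case: sol => uI sI aI _.
rewrite /turan_g_e lock_eE !evalE ![lookup _ _]/= /chd /= (eval_turan_clique k1 szM evM evf) //.
  by rewrite -size_eq0 sI -lt0n bin_gt0.
by move=> i iI; apply: high_leq; exact: (allP aI).
Qed.
End Instance.
End TuranStep.

Theorem turan_to_turanS k : 2 <= k -> poly_reduces (Turan k) (Turan k.+1).
Proof.
move=> k1; have [KM [_ [szM _ evM _]]] := residue_circuits (ltnW k1).
have [K1 [Kf [Kv1 [Kv2 [[szf szv1 szv2] ev1 evf evv1 evv2]]]]] := ext_circuits k.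
apply: (@reduction (Turan k) (Turan k.+1) (TUInst 0 (Circuit 0 [::] [::])) (TULoop 0)
   (EPair (EFst (V 0)) (ECall2 (ext_e k K1 Kf Kv1 Kv2) (EFst (V 0)) (ESnd (V 0)))) (turan_g_e k KM Kf)).
- by apply: polye_cost_on; have := @polye_ext k K1 Kf Kv1 Kv2; auto 30 with pe.
- exact: polye_turan_g.
move=> I vI; exists (TUInst (tu_n I) (ext_circuit k K1 Kf Kv1 Kv2 (tu_n I) (tu_E I))); split.
- exact: ext_valid.
- rewrite !evalE ![lookup _ _]/= /chd /= eval_ext //; last by rewrite size_emb_outs.
  by case: vI => _; rewrite vwidthE ?(ltnW k1) // addnn.
- by move=> s sol; apply: (turan_g_ok k1 szM evM szf szv1 szv2 ev1 evf evv1 evv2 vI sol).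
Qed.

(** * From bad k-colourings to bad (k+1)-colourings *)

Definition nb (v : code) : nat := nat_of_bits (tb v).

Lemma size_stripb s : size (stripb s) <= size s.
Proof. by elim: s => //= -[] s; rewrite -/(stripb s) //; case: (stripb s). Qed.

Lemma csz_nb v : csz (code_nat (nb v)) <= 6 + 2 * csz v.
Proof.
rewrite /nb /code_nat bin_nat_of_bits csz_leaf leq_add2l leq_mul2l /=.
apply: leq_trans (size_elems v); rewrite -(size_map ctrue) -/(tb v).
exact: size_stripb.
Qed.

Lemma csz_nat_add x i : csz (code_nat (x + i)) <= csz (code_nat x) + 2 * i.
Proof.
elim: i => [|i IH]; first by rewrite muln0 !addn0.
by rewrite addnS -(eval_inc_nat _ [::]); apply: leq_trans (csz_inc _ _) _; lia.
Qed.

Lemma csz_elems v : all (fun u => csz u <= csz v) (elems v).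
Proof. by apply/(all_nthP nilc) => i _; exact: csz_nth_elems. Qed.

Lemma csz_ren T F h Z : all (fun x => csz (code_nat x) <= Z) T -> csz (code_nat F) <= Z ->
  csz (code_gate (ren T F h)) <= 20 + 2 * Z.
Proof.
move=> /(all_nthP F) HT HF.
have H i : csz (code_nat (nth F T i)) <= Z.
  by case: (ltnP i (size T)) => ?; [exact: HT|rewrite nth_default].
have [c0 c1] : csz (code_nat 0) = 6 /\ csz (code_nat 1) = 8 by rewrite /code_nat !csz_leaf.
have [c2 c3] : csz (code_nat 2) = 10 /\ csz (code_nat 3) = 10 by rewrite /code_nat !csz_leaf.
case: h => [b|i|i j|i j] /=; rewrite csz_node /= ?c0 ?c1 ?c2 ?c3; first by rewrite csz_leaf /=; lia.
- by have := H i; lia.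
- by have := H i; have := H j; lia.
- by have := H i; have := H j; lia.
Qed.

Section Horner.
Variables (k : nat) (KH : circuit).
Let a := up_log 2 k.
Let g := size (cgates KH).

(* Horner's scheme modulo [k] over wires, one copy of [KH] per wire; the
   state is the next free wire, the gates emitted and the current residue. *)
Definition hstep (F : nat) (st : nat * seq gate * seq nat) (u : nat) : nat * seq gate * seq nat :=
  let: (b, gs, r) := st in
  (b + size (cgates KH), gs ++ emb b KH (r ++ [:: u]) F, emb_outs b KH (r ++ [:: u]) F).
Definition hinit (F b : nat) : nat * seq gate * seq nat := (b, [::], nseq (up_log 2 k) F).
Definition hcode (st : nat * seq gate * seq nat) : code :=
  let: (b, gs, r) := st in CNode [:: cst b gs; cnats r].

(** Cost bounds quantify over all environments, including malformed ones. [strip_e] reads any code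
    as a number, so that [foldl_hstep] describes the states unconditionally. *)
Definition hstep_e : expr :=
  ECall4 emb_e (EFst (V 11)) (ELit (code_circuit KH))
    (ECall2 cat_e (ESnd (V 11)) (ECons (ECall1 strip_e (V 10)) ENil)) (ECall1 strip_e (V 2)).
Definition hinit_e : expr :=
  EPair (EPair (ECall1 strip_e (V 0)) ENil) (map_e 10 (ECall1 strip_e (V 2)) (ELit (CNode (nseq a cF)))).
Definition horner_e : expr := lock_e (EFold 10 11 (ECall1 rev_e (V 1)) hinit_e hstep_e).

Lemma eval_hinit r : eval hinit_e r = hcode (hinit (nb (lookup r 2)) (nb (lookup r 0))).
Proof.
rewrite /hinit_e !evalE eval_map !evalE !eval_strip /=.
by rewrite /hinit /= /cnats !map_nseq !evalE eval_strip.
Qed.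

Lemma eval_hstep st u r : eval hstep_e ((11, hcode st) :: (10, u) :: r) =
  hcode (hstep (nb (lookup r 2)) st (nb u)).
Proof.
case: st => [[b gs] rs]; rewrite /hstep_e !evalE !eval_strip eval_cat ![lookup _ _]/= /chd /=.
have E : map code_nat rs ++ [:: code_nat (nb u)] = map code_nat (rs ++ [:: nb u]) by rewrite map_cat.
by rewrite E eval_emb.
Qed.

Lemma foldl_hstep us r : foldl (fun st u => eval hstep_e ((11, st) :: (10, u) :: r)) (eval hinit_e r) us =
  hcode (foldl (hstep (nb (lookup r 2))) (hinit (nb (lookup r 2)) (nb (lookup r 0))) (map nb us)).
Proof.
rewrite eval_hinit; elim/last_ind: us => // us u IH.
by rewrite map_rcons !foldl_rcons IH eval_hstep.
Qed.

Lemma eval_horner b us F r :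
  eval horner_e ((0, code_nat b) :: (1, cnats us) :: (2, code_nat F) :: r) =
  hcode (foldl (hstep F) (hinit F b) (rev us)).
Proof.
rewrite /horner_e lock_eE eval_fold foldl_hstep !evalE eval_rev ![lookup _ _]/= /nb !tb_nat.
by rewrite -map_rev -map_comp map_id_in // => x _ /=; rewrite tb_nat.
Qed.

Lemma horner_bound F b us Z : csz (code_nat F) <= Z -> csz (code_nat b) <= Z ->
  all (fun x => csz (code_nat x) <= Z) us -> let Z' := Z + 2 * g * size us in
  let: (b', gs, r) := foldl (hstep F) (hinit F b) us in
  [/\ csz (code_nat b') <= Z', all (fun x => csz (code_nat x) <= Z') r, size r <= a + size (couts KH) &
    sumn (map csz (map code_gate gs)) <= size us * (g * (20 + 2 * Z'))].
Proof.
move=> lF lb; elim/last_ind: us => [|us u IH] /=.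
  by move=> _; rewrite muln0 addn0 lb all_nseq lF orbT size_nseq leq_addr.
rewrite all_rcons => /andP[lu /IH]; rewrite foldl_rcons size_rcons /=.
case: (foldl _ _ _) => [[b' gs] r] /= [l1 l2 l3 l4]; rewrite -/g.
set Z0 := Z + 2 * g * size us in l1 l2 l4; have -> : Z + 2 * g * (size us).+1 = Z0 + 2 * g by rewrite /Z0; lia.
have lT : all (fun x => csz (code_nat x) <= Z0 + 2 * g) (emb_tab b' KH (r ++ [:: u])).
  rewrite /emb_tab !all_cat /= andbT; apply/andP; split.
  - by apply/andP; split; [apply: sub_all l2 => x|]; rewrite /Z0 in l1 *; lia.
  by apply/allP => x; rewrite mem_iota -/g => lx; have := csz_nat_add b' (x - b'); rewrite subnKC; lia.
have lFZ : csz (code_nat F) <= Z0 + 2 * g by rewrite /Z0; lia.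
split.
- by have := csz_nat_add b' g; lia.
- rewrite /emb_outs all_map; apply/allP => i _ /=.
  by case: (ltnP i (size (emb_tab b' KH (r ++ [:: u])))) => ?; [apply: (allP lT); exact: mem_nth|rewrite nth_default].
- by rewrite size_emb_outs leq_addl.
rewrite !map_cat sumn_cat mulSn addnC; apply: leq_add.
  have := fun h => csz_ren h lT lFZ; move: (20 + _) => B HB.
  rewrite /emb -!map_comp /g; elim: (cgates KH) => //= h hs IHh.
  by rewrite mulSn leq_add ?HB.
by apply: leq_trans l4 _; rewrite !leq_mul2l; apply/orP; right; apply/orP; right; lia.
Qed.

Lemma polye_horner : polye horner_e.
Proof.
rewrite /horner_e lock_eE; apply: polye_fold_bound; [by auto with pe| | |].
- by rewrite /hinit_e; auto 20 with pe.
- by rewrite /hstep_e; auto 20 with pe.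
pose L r := csz (lookup r 1); pose Z r := 6 + 2 * (csz (lookup r 0) + L r + csz (lookup r 2)).
pose Z' r := Z r + 2 * g * L r.
have pL : poly esz L by exact: poly_csz (polye_var 1).
have pZ' : poly esz Z'.
  apply: poly_add; last by apply: poly_mul; [exact: poly_const|].
  apply: poly_add; first exact: poly_const.
  apply: poly_mul; first exact: poly_const.
  by do 2 (apply: poly_add; last by exact: (poly_csz (polye_var _))); exact: (poly_csz (polye_var 0)).
suff [c Hc] : poly esz (fun r => 24 + Z' r + L r * (g * (20 + 2 * Z' r)) + (a + size (couts KH)) * Z' r).
  exists c => r t; apply: leq_trans (Hc r); rewrite foldl_hstep.
  set us := take t _; have lus : size us <= L r.
    rewrite /us size_take_min !evalE eval_rev /= size_rev.
    by apply: leq_trans (geq_minr _ _) _; exact: size_elems.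
  have aus : all (fun x => csz (code_nat x) <= Z r) (map nb us).
    have : all (fun u => csz u <= L r) (elems (eval (ECall1 rev_e (V 1)) r)).
      by rewrite !evalE eval_rev /= all_rev; exact: csz_elems.
    rewrite -{1}(cat_take_drop t (elems _)) all_cat -/us => /andP[H _].
    by rewrite all_map; apply: sub_all H => u lu /=; apply: leq_trans (csz_nb u) _; rewrite /Z; lia.
  have lF : csz (code_nat (nb (lookup r 2))) <= Z r by apply: leq_trans (csz_nb _) _; rewrite /Z; lia.
  have lb : csz (code_nat (nb (lookup r 0))) <= Z r by apply: leq_trans (csz_nb _) _; rewrite /Z; lia.
  have := horner_bound lF lb aus; rewrite size_map; case: (foldl _ _ _) => [[b' gs] rs] /= [l1 l2 l3 l4].
  have le : Z r + 2 * g * size us <= Z' r by rewrite leq_add2l leq_mul2l lus orbT.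
  have l5 : sumn (map csz (map code_nat rs)) <= size rs * Z' r.
    elim: (rs) l2 => //= x xs IHx /andP[lx /IHx ls].
    by rewrite mulSn leq_add // (leq_trans lx).
  have l6 : size rs * Z' r <= (a + size (couts KH)) * Z' r by rewrite leq_mul2r l3 orbT.
  have l7 : size us * (g * (20 + 2 * (Z r + 2 * g * size us))) <= L r * (g * (20 + 2 * Z' r)).
    by apply: leq_mul => //; rewrite leq_mul2l leq_add2l leq_mul2l le !orbT.
  have := leq_trans l1 le; have := leq_trans l4 l7; have := leq_trans l5 l6.
  rewrite /cnats /cst !csz_node /= !csz_node /= csz_node.
  move: (Z' r) (_ * Z' r) (L r * _) (sumn _) (sumn _) => x1 x2 x3 x4 x5; lia.
apply: poly_add; last by apply: poly_mul; [exact: poly_const|].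
apply: poly_add; first by apply: poly_add; [exact: poly_const|].
apply: poly_mul => //; apply: poly_mul; first exact: poly_const.
by apply: poly_add; [exact: poly_const|apply: poly_mul; [exact: poly_const|]].
Qed.
Hypothesis k0 : 0 < k.
Hypothesis evH : forall r b, size r = a ->
  circ_eval KH (r ++ [:: b]) = bits_of a ((b + (nat_of_bits r).*2) %% k).

Lemma reads_horner W F b us bs : size W = b -> reads W [:: F] [:: false] -> reads W us bs ->
  let: (b', gs, r) := foldl (hstep F) (hinit F b) (rev us) in
  size (run W gs) = b' /\ reads (run W gs) r (bits_of a (nat_of_bits bs %% k)).
Proof.
move=> sW RF [Hus <-]; set v := nth false W.
have lt_a x : x %% k < 2 ^ a by apply: leq_trans (klea k); exact: ltn_pmod.
elim: us Hus => [_|u us IH /= /andP[lu /IH]].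
  rewrite /= mod0n; split=> //; have -> : bits_of a 0 = nseq a false.
    by elim: (a) => //= m IHm; rewrite bits_ofS IHm.
  exact: reads_nseq.
rewrite rev_cons foldl_rcons; case: (foldl _ _ _) => [[b' gs] r] /= [sz R].
rewrite !run_cat size_run size_emb sz; split=> //.
have -> : nat_of_bits (v u :: map v us) %% k = (v u + (nat_of_bits (map v us) %% k).*2) %% k.
  by rewrite nat_of_bits_cons -!muln2 -[RHS]modnDmr modnMml modnDmr.
have -> : bits_of a ((v u + (nat_of_bits (map v us) %% k).*2) %% k) =
   circ_eval KH (bits_of a (nat_of_bits (map v us) %% k) ++ [:: v u]).
  by rewrite evH ?size_bits_of // bits_of_small.
apply: reads_emb => //; first exact: reads_run.
by apply: reads_cat => //; apply: reads_run; split=> //=; rewrite lu.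
Qed.
End Horner.

Lemma take_bits_of p q x : p <= q -> take p (bits_of q x) = bits_of p x.
Proof. by move=> le; rewrite -(subnKC le) bits_of_cat take_size_cat // size_bits_of. Qed.

Lemma drop_bits_of p q x : drop p (bits_of (p + q) x) = bits_of q (x %/ 2 ^ p).
Proof. by rewrite bits_of_cat drop_size_cat // size_bits_of. Qed.

Section ExtendColouring.
Variable k : nat.
Hypothesis k1 : 1 < k.
Let k0 : 0 < k := ltnW k1.
Let a := up_log 2 k.
Let a' := up_log 2 k.+1.
Let aa' : a <= a'. Proof. exact: leq_up_log. Qed.
Variables KH KF : circuit.
Hypothesis evH : forall r b, size r = a ->
  circ_eval KH (r ++ [:: b]) = bits_of a ((b + (nat_of_bits r).*2) %% k).
Hypothesis evF : forall x y, size x = a -> size y = a' -> circ_eval KF (x ++ y) =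
  bits_of a' (if nat_of_bits y == k then k else nat_of_bits x).

Section Circuit.
Variables (n : nat) (C : circuit).
Let lo := iota 0 (n + a).
Let hs := iota n a'.
Let F := n + a'.
Let b1 := F + 1.
Let g1 := [::] ++ [:: GConst false].
Let oC := emb_outs b1 C lo F.
Let g2 := g1 ++ emb b1 C lo F.
Let b2 := b1 + size (cgates C).
Let st := foldl (hstep KH F) (hinit k F b2) (rev oC).
Let b3 := st.1.1.
Let g3 := g2 ++ st.1.2.
Let g4 := g3 ++ emb b3 KF (st.2 ++ hs) F.

(** The old colour is reduced modulo [k] before it is read modulo [k.+1], and [KF] overrides it by
    [k] when the top part of the vertex is [k]. Vertices now have [n + a'] bits, but old ones fit
    into the first [n + a], which are the inputs of [C]. *)
Definition colour_circuit : circuit := Circuit (n + a') g4 (emb_outs b3 KF (st.2 ++ hs) F).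

Lemma colour_circuit_eval z : size z = n + a' -> circ_eval colour_circuit z =
  bits_of a' (if nat_of_bits (drop n z) == k then k
              else nat_of_bits (circ_eval C (take (n + a) z)) %% k).
Proof.
move=> sz; rewrite circ_evalE [cgates _]/= [couts _]/=.
rewrite /g4 (run_cat _ g3) /g3 (run_cat _ g2) /g2 (run_cat _ g1).
set W1 := run z g1; set W2 := run W1 _; set W3 := run W2 _; set W4 := run W3 _.
have E1 : W1 = rcons z false by [].
have s1 : size W1 = b1 by rewrite E1 size_rcons sz /b1 addn1.
have s2 : size W2 = b2 by rewrite size_run s1 size_emb.
have RF : reads W1 [:: F] [:: false].
  by split; rewrite /= ?s1 /b1 ?addn1 ?leqnn // E1 nth_rcons sz ltnn eqxx.
have Rlo : reads W1 lo (take (n + a) z).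
  have := @reads_iota W1 0 (n + a); rewrite drop0 E1 -cats1 takel_cat ?sz ?leq_add2l //; apply.
  by rewrite size_cat sz /=; lia.
have Rhs : reads W1 hs (drop n z).
  have := @reads_iota W1 n a'; rewrite E1 -cats1 drop_cat sz.
  have -> : take a' (if n < n + a' then drop n z ++ [:: false] else drop (n - (n + a')) [:: false]) = drop n z.
    case: ltnP => H; first by rewrite takel_cat ?take_oversize // size_drop sz; lia.
    have a0 : a' = 0 by lia.
    by rewrite a0 take0 drop_oversize // sz; lia.
  by apply; rewrite size_cat sz /=; lia.
have RC : reads W2 oC (circ_eval C (take (n + a) z)) by exact: reads_emb.
have := reads_horner k0 evH s2 (reads_run _ RF) RC.
rewrite -/st (surjective_pairing st) (surjective_pairing st.1) -/W3 => -[s3 R3].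
have R4 : reads W4 (emb_outs b3 KF (st.2 ++ hs) F)
   (circ_eval KF (bits_of a (nat_of_bits (circ_eval C (take (n + a) z)) %% k) ++ drop n z)).
  apply: reads_emb => //; first by do 2 apply: reads_run.
  by apply: reads_cat => //; do 2 apply: reads_run.
case: R4 => _ ->; rewrite evF ?size_bits_of // ?size_drop ?sz ?addKn // bits_of_small //.
by apply: leq_trans (klea k); exact: ltn_pmod.
Qed.

Definition colour_e : expr := lock_e
  (ELet 2 (ECall2 range_e (ELit (code_nat 0)) (V 0))
  (ELet 3 (ECall2 range_e (EHd (V 2)) (ELit (code_unary a)))
  (ELet 4 (ECall2 range_e (EHd (V 2)) (ELit (code_unary a')))
  (ELet 5 (ECall2 emit_e (EPair (EHd (V 4)) ENil) (ELit (CNode [:: code_gate (GConst false)])))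
  (ELet 6 (ECall2 cat_e (ECall1 rev_e (ETl (V 2))) (ECall1 rev_e (ETl (V 3))))
  (ELet 7 (ECall1 rev_e (ETl (V 4)))
  (ELet 8 (EHd (ESnd (V 5)))
  (ELet 9 (ECall4 emb_e (EFst (V 5)) (V 1) (V 6) (V 8))
  (ELet 10 (ECall3 (horner_e k KH) (EFst (EFst (V 9))) (ESnd (V 9)) (V 8))
  (ELet 11 (ECall4 emb_e
     (EPair (EFst (EFst (V 10))) (ECall2 cat_e (ESnd (EFst (V 9))) (ESnd (EFst (V 10)))))
     (ELit (code_circuit KF)) (ECall2 cat_e (ESnd (V 10)) (V 7)) (V 8))
  (ETriple (ECall2 uadd_e (V 0) (ELit (code_unary a'))) (ESnd (EFst (V 11))) (ESnd (V 11))
  ))))))))))).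
Lemma polye_colour : polye colour_e.
Proof. by have := @polye_horner k KH; rewrite /colour_e lock_eE; auto 100 with pe. Qed.

Lemma eval_colour r :
  eval colour_e ((0, code_unary n) :: (1, code_circuit C) :: r) = code_circuit colour_circuit.
Proof.
rewrite /colour_e lock_eE.
apply: (eval_let_eq (v := CNode (code_nat n :: rev (map code_nat (iota 0 n))))).
  by rewrite !evalE eval_range elems_unary.
apply: (eval_let_eq (v := CNode (code_nat (n + a) :: rev (map code_nat (iota n a))))).
  by rewrite !evalE eval_range elems_unary.
apply: (eval_let_eq (v := CNode (code_nat F :: rev (map code_nat hs)))).
  by rewrite !evalE eval_range elems_unary.
apply: (eval_let_eq (v := CNode [:: cst b1 g1; cnats [:: F]])).
  by rewrite !evalE (eval_emit F [::] [:: GConst false]).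
apply: (eval_let_eq (v := cnats lo)).
  by rewrite !evalE !eval_rev eval_cat ![elems _]/= !revK -map_cat -iotaD.
apply: (eval_let_eq (v := cnats hs)); first by rewrite !evalE eval_rev [elems _]/= revK.
apply: (eval_let_eq (v := code_nat F)); first by [].
apply: (eval_let_eq (v := CNode [:: cst b2 g2; cnats oC])); first by rewrite !evalE; exact: eval_emb.
apply: (eval_let_eq (v := hcode st)); first by rewrite !evalE; exact: eval_horner.
apply: (eval_let_eq (v := CNode [:: cst (b3 + size (cgates KF)) g4; cnats (emb_outs b3 KF (st.2 ++ hs) F)])).
  rewrite !evalE ![lookup _ _]/= /g4 /g3 /b3; move: (g2) (st) => G [[b gs] rs].
  rewrite /chd /= !eval_cat ![elems _]/= -!map_cat; exact: eval_emb.
by rewrite !evalE ![lookup _ _]/= eval_uadd elems_unary.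
Qed.
End Circuit.

Section Instance.
Variable I : bc_inst.
Hypothesis vI : bc_valid k I.
Let n := bc_n I.
Variable E' : circuit.
Let J := BCInst n E' (colour_circuit n (bc_C I)).

Lemma colour_old v : v < nverts k n -> color_of k.+1 J v = color_of k I v.
Proof.
move=> lv; have p0 : 0 < 2 ^ n by rewrite expn_gt0.
have lh : v %/ 2 ^ n < k by rewrite ltn_divLR.
have le x : x <= k -> x < 2 ^ a' by move=> lx; apply: leq_trans (klea k.+1).
rewrite /color_of /circ_apply /= colour_circuit_eval ?size_bits_of //.
rewrite drop_bits_of take_bits_of ?leq_add2l // (bits_of_small (le _ (ltnW lh))) ltn_eqF //.
have lm x : x %% k < k by rewrite ltn_mod.
rewrite bits_of_small; last by apply/le/ltnW.
by case: vI => _ ->; rewrite vwidthE // -/n -/a modn_small // ltnW // ltnS lm.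
Qed.

Lemma colour_new x : x < 2 ^ n -> color_of k.+1 J (x + 2 ^ n * k) = k.+1.
Proof.
move=> lx; have lk : k < 2 ^ a' by exact: klea k.+1.
rewrite /color_of /circ_apply /= colour_circuit_eval ?size_bits_of //.
rewrite drop_bits_of addnC [2 ^ n * k]mulnC divnMDl ?expn_gt0 // divn_small // addn0.
by rewrite !(bits_of_small lk) eqxx (bits_of_small lk) modn_small.
Qed.
End Instance.
End ExtendColouring.

Section ColouringStep.
Variable k : nat.
Hypothesis k1 : 1 < k.
Let m := 'C(k, 2).
Let m' := 'C(k.+1, 2).
Let w := width m.
Let w' := width m'.
Let a := up_log 2 k.
Let a' := up_log 2 k.+1.
Variables KH KF K1 Kf Kv1 Kv2 : circuit.
Hypothesis evH : forall r b, size r = a ->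
  circ_eval KH (r ++ [:: b]) = bits_of a ((b + (nat_of_bits r).*2) %% k).
Hypothesis evF : forall x y, size x = a -> size y = a' -> circ_eval KF (x ++ y) =
  bits_of a' (if nat_of_bits y == k then k else nat_of_bits x).
Hypothesis szf : size (couts Kf) = 2.
Hypothesis szv1 : size (couts Kv1) = a'.
Hypothesis szv2 : size (couts Kv2) = a'.
Hypothesis ev1 : forall x, size x = w' -> circ_eval K1 x =
  bits_of w (if nat_of_bits x == m' then m else nat_of_bits x).
Hypothesis evf : forall x, size x = w' -> circ_eval Kf x =
  [:: old_edge k (nat_of_bits x); ~~ old_edge k (nat_of_bits x)].
Hypothesis evv1 : forall x y, size x = w' -> size y = a -> circ_eval Kv1 (x ++ y) =
  bits_of a' (if old_edge k (nat_of_bits x) then nat_of_bits y %% k else nat_of_bits x - m).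
Hypothesis evv2 : forall x y, size x = w' -> size y = a -> circ_eval Kv2 (x ++ y) =
  bits_of a' (if old_edge k (nat_of_bits x) then nat_of_bits y %% k else k).

Definition colouring_f_e : expr := lock_e
  (ETriple (EFst (V 0)) (ECall2 (ext_e k K1 Kf Kv1 Kv2) (EFst (V 0)) (ESnd (V 0)))
    (ECall2 (colour_e k KH KF) (EFst (V 0)) (EThd (V 0)))).
Lemma polye_colouring_f : polye colouring_f_e.
Proof.
have := @polye_ext k K1 Kf Kv1 Kv2; have := @polye_colour k KH KF.
by rewrite /colouring_f_e lock_eE; auto 40 with pe.
Qed.

Definition colouring_g_e : expr := lock_e
  (ELet 2 (ESnd (V 0)) (ELet 3 (EFst (EFst (V 0)))
    (EIfNil (EHd (V 2))
      (ETriple (ELit (code_nat 0)) (ECall2 (old_index_e k) (V 3) (ESnd (V 2))) (ECall2 (old_index_e k) (V 3) (EThd (V 2))))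
      (EPair (ELit (code_nat 1)) (ECall2 (old_index_e k) (V 3) (ESnd (V 2))))))).
Lemma polye_colouring_g : polye colouring_g_e.
Proof. by have := @polye_old_index k; rewrite /colouring_g_e lock_eE; auto 60 with pe. Qed.

Section Instance.
Variable I : bc_inst.
Hypothesis vI : bc_valid k I.
Let n := bc_n I.
Let E := bc_E I.
Let vE : edge_valid k n E. Proof. by case: vI. Qed.
Let E' := ext_circuit k K1 Kf Kv1 Kv2 n E.
Let J := BCInst n E' (colour_circuit k KH KF n (bc_C I)).
Let e' := edge_of k.+1 n E'.

Lemma colouring_f_ok : bc_valid k.+1 J /\ eval colouring_f_e [:: (0, code_bc_inst I)] = code_bc_inst J.
Proof.
split; first by split; [exact: ext_valid|rewrite vwidthE].
rewrite /colouring_f_e lock_eE !evalE ![lookup _ _]/= /chd /= eval_ext ?eval_colour ?size_emb_outs //.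
by case: vE => _; rewrite vwidthE ?(ltnW k1) // addnn.
Qed.

Lemma colouring_g_ok s : bc_is_sol k.+1 J s -> exists s', bc_is_sol k I s' /\
  eval colouring_g_e [:: (0, CNode [:: code_bc_inst I; code_bc_sol s])] = code_bc_sol s'.
Proof.
case: s => [i j [li lj nij sp]|i [li Ec]].
- exists (BCDup (old_index k n i) (old_index k n j)); split.
    by have := ext_dup k1 szf szv1 szv2 ev1 evf evv1 evv2 vE li lj nij sp; case.
  by rewrite /colouring_g_e lock_eE !evalE !eval_old_index.
exists (BCMono (old_index k n i)); split; last first.
  by rewrite /colouring_g_e lock_eE !evalE !eval_old_index.
have {}Ec : color_of k.+1 J (e' i).1 = color_of k.+1 J (e' i).2 by [].
have elt : (e' i).1 < nverts k n := ext_edge_lt k1 szf szv1 szv2 ev1 evf evv1 evv2 vE li.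
case oi : (old_edge k (high n i)).
  have eold : e' i = edge_of k n E (old_index k n i) := ext_edge_old k1 szf szv1 szv2 ev1 evf evv1 evv2 vE li oi.
  have [l1 l2] := edge_lt n E k1 (old_index k n i).
  split; first exact: old_index_le.
  by move: Ec; rewrite eold !(colour_old k1 evH evF vI).
(* A new edge cannot be monochromatic: its new endpoint has colour [k.+1], its old one a colour at
   most [k]. *)
have [|_ Ee] := ext_edge_new k1 szf szv1 szv2 ev1 evf evv1 evv2 vE li; first by rewrite oi.
move: Ec; rewrite (colour_old k1 evH evF vI) // {2}/e' Ee [(_, _).2]/=.
rewrite (colour_new k1 evH evF) ?ltn_mod ?expn_gt0 // /color_of => -[Ek].
by have := ltn_pmod (circ_apply (bc_C I) (e' i).1) (ltnW k1); rewrite Ek ltnn.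
Qed.
End Instance.
End ColouringStep.

Theorem bad_colouringS k : 2 <= k -> poly_reduces (BadColoring k) (BadColoring k.+1).
Proof.
move=> k1; have [_ [KH [_ _ _ evH]]] := residue_circuits (ltnW k1).
have [K1 [Kf [Kv1 [Kv2 [[szf szv1 szv2] ev1 evf evv1 evv2]]]]] := ext_circuits k.
have [|KF [_ evF]] := @table_circuit2 (up_log 2 k) (up_log 2 k.+1) (up_log 2 k.+1)
  (fun x y => bits_of (up_log 2 k.+1) (if nat_of_bits y == k then k else nat_of_bits x)).
  by move=> x y; exact: size_bits_of.
pose C0 := Circuit 0 [::] [::].
apply: (@reduction (BadColoring k) (BadColoring k.+1) (BCInst 0 C0 C0) (BCMono 0)
   (colouring_f_e k KH KF K1 Kf Kv1 Kv2) (colouring_g_e k)).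
- by apply: polye_cost_on; exact: polye_colouring_f.
- exact: polye_colouring_g.
move=> I vI; have [vJ EJ] := colouring_f_ok k1 KH KF K1 szf szv1 szv2 vI.
by eexists; split; [exact: vJ|exact: EJ|exact: colouring_g_ok].
Qed.

Theorem theorem11 :
  [/\ poly_reduces Collision (BadColoring 2),
      (forall k, 2 <= k -> poly_reduces (BadColoring k) (Turan k))
        /\ poly_reduces (BadColoring 2) Mantel,
      (forall k, 2 <= k -> poly_reduces (BadColoring k) (BadColoring k.+1))
    & (forall k, 2 <= k -> poly_reduces (Turan k) (Turan k.+1))].
Proof.
split; [exact: collision_to_bad_colouring| |exact: bad_colouringS|exact: turan_to_turanS].
by split; [exact: bad_colouring_to_turan|exact: bad_colouring_to_turan].
Qed.
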